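(* (I) Let $1\le a\le q$ be integers. Then for every complex $s\neq 0$ with $\operatorname{Re}s<1$, $$\zeta\left(s,\frac aq\right)=2(2\pi q)^{s-1}\Gamma(1-s)\sum_{r=1}^{q}\sin\left(\frac{\pi s}{2}+\frac{2\pi r a}{q}\right)\zeta\left(1-s,\frac rq\right).$$ (II) Let $s_1,s_2$ be complex numbers with $\operatorname{Re}s_1<1$, $\operatorname{Re}s_2<1$ and $\operatorname{Re}(s_1+s_2)<1$. Then $$\int_0^1\zeta(s_1,\alpha)\zeta(s_2,\alpha)\,d\alpha=2(2\pi)^{s_1+s_2-2}\,\Gamma(1-s_1)\Gamma(1-s_2)\cos\left(\frac{\pi}{2}(s_1-s_2)\right)\zeta(2-s_1-s_2).$$
   Context: The Hurwitz zeta function $\zeta(s,\alpha)$ is defined by $\zeta(s,\alpha)=\sum_{n\ge 0}(n+\alpha)^{-s}$ for $\operatorname{Re}s>1$ and by analytic continuation in $s$ (with its only pole at $s=1$); $\zeta(s)=\zeta(s,1)$ is the Riemann zeta function. *)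

(* Defs.v *)
From Stdlib Require Import Reals ClassicalEpsilon.
From Coquelicot Require Import Coquelicot.

Open Scope R_scope.
Open Scope C_scope.

Definition Cexp (z : C) : C :=
  (exp (Re z) * cos (Im z), exp (Re z) * sin (Im z))%R.

Definition Csin (z : C) : C :=
  (Cexp (Ci * z) - Cexp (- (Ci * z))) / (2 * Ci).

Definition Ccos (z : C) : C :=
  (Cexp (Ci * z) + Cexp (- (Ci * z))) / 2.

(** [x ^ s] for a real base [x > 0], with the real logarithm of [x].
    Outside [x > 0] the value is junk. *)
Definition Rcpow (x : R) (s : C) : C := Cexp (s * RtoC (ln x)).

(** Euler's integral. It converges, and is the Gamma function, exactly when
    [Re s > 0]; no continuation to [Re s <= 0] is provided. *)
Definition CGamma (s : C) : C :=
  RInt_gen (V := C_R_CompleteNormedModule)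
    (fun t : R => Rcpow t (s - 1) * RtoC (exp (- t)))
    (at_right 0) (Rbar_locally p_infty).

(** [f] is the sum of a convergent complex power series around [s]. *)
Definition analytic_at (f : C -> C) (s : C) : Prop :=
  exists c : nat -> C,
    locally s (fun z : C =>
      is_pseries (K := C_AbsRing) (V := C_NormedModule) c (z - s) (f z)).

(** Since [C \ {1}] is connected, these two conditions determine [f] everywhere
    except at the pole [s = 1], where its value is unconstrained. *)
Definition is_hurwitz_zeta (alpha : R) (f : C -> C) : Prop :=
  (forall s : C, (1 < Re s)%R ->
     is_series (K := C_AbsRing) (V := C_NormedModule)
       (fun n : nat => Rcpow (INR n + alpha) (- s)) (f s)) /\
  (forall s : C, s <> 1 -> analytic_at f s).

(** Meaningful for [alpha > 0] and [s <> 1]. *)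
Definition hurwitz_zeta (s : C) (alpha : R) : C :=
  epsilon (inhabits (fun _ : C => RtoC 0)) (is_hurwitz_zeta alpha) s.

Definition riemann_zeta (s : C) : C := hurwitz_zeta s 1.

(* Main.v *)
(** The trapezoidal rule continues [zeta (s, a)] to [Re s > -1]. For [-1 < Re s < 0]
    the Fourier coefficients in [a] on [[0, 1]] reduce to
    [int_0^oo x^(-s) e^(-2 pi i n x) dx], and rotating the contour turns these into
    [Gamma (1 - s) (2 pi i n)^(s - 1)]. Since a continuous function is determined by its
    Fourier coefficients, [zeta] equals its Fourier series (Hurwitz' formula), which
    in turn continues [zeta] to [Re s < 0].

    (I) For [Re s < 0], split the Fourier series at [a / q] by residues mod [q]; the
    identity theorem extends the formula to [Re s < 1], [s <> 0].
    (II) For [Re s1, Re s2 < 0] this is Parseval's identity. The integral is analytic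
    in each variable as long as it converges, so the identity theorem applies first
    in [s1], then in [s2].

    Analyticity is handled as a quadratic Taylor bound that is uniform on a ball. Such
    functions satisfy Cauchy's formula (shrink the circle to a point), and conversely
    Cauchy's formula, which passes to uniform limits, gives the bound. *)

Require Import Defs.
From Stdlib Require Import ZArith Wf_nat Reals Lra Lia Psatz ClassicalEpsilon Classical.
From Coquelicot Require Import Coquelicot.
Open Scope C_scope.
Open Scope R_scope.

(** * Complex powers, derivatives and integrals of complex-valued functions *)

(** For Re s < 0 the integral of x^(-s) exp (-2 pi i n x) over the half-line has a growing integrand
    and does not converge as it stands. The trapezoidal boundary terms compensate: once linearised
    in the parameter, their Fourier coefficient cancels the boundary term of an integration by
    parts. What remains is a Mellin integral with exponent -s, whose real part lies in (0, 1) when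
    -1 < Re s < 0; this is the range in which both arcs of the rotated contour vanish. The
    coefficient therefore appears first as a multiple of Gamma (- s), and [CGamma_plus_1] brings it
    to Gamma (1 - s). [hurwitz_zeta] is picked by [epsilon] and carries no formula, so an explicit
    function on all of C minus 1 must be exhibited. No single expression serves: the trapezoidal one
    lives on Re s > -1, the Fourier series on Re s < 0, and they are glued along the strip in which
    Hurwitz' formula is proved. All contour integrals are integrals over a real parameter with
    values in C, seen as a real normed module; deformations of contours are differentiations in a
    second real parameter. *)

Notation contC f x := (continuous (T := R_UniformSpace) (U := C_R_NormedModule) f x).
Notation derivC f x l := (is_derive (K := R_AbsRing) (V := C_R_NormedModule) f x l).
Notation intC f a b l := (is_RInt (V := C_R_NormedModule) f a b l).
Definition IntC (f : R -> C) (a b : R) : C := RInt (V := C_R_CompleteNormedModule) f a b.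

Lemma C_eq (z w : C) : Re z = Re w -> Im z = Im w -> z = w.
Proof. destruct z, w; simpl; intros; subst; reflexivity. Qed.

(** The derivative and integral lemmas return terms built from the module operations of
    [C_R_NormedModule]. These agree with the field operations of C only after unfolding, so such
    identities are settled on real and imaginary parts. *)
Ltac Cparts :=
  apply C_eq; do 4 (unfold minus, plus, opp, scal, mult, zero, one; simpl);
  unfold Re, Im; simpl;
  match goal with |- @eq _ ?a ?b => change (@eq R a b) end; ring.

Lemma Re_minus (z w : C) : Re (z - w) = Re z - Re w.
Proof. destruct z, w; simpl; ring. Qed.

Lemma Im_minus (z w : C) : Im (z - w) = Im z - Im w.
Proof. destruct z, w; simpl; ring. Qed.

Lemma im_le_Cmod (z : C) : Rabs (Im z) <= Cmod z.
Proof. eapply Rle_trans; [apply Rmax_r | apply (Rmax_Cmod z)]. Qed.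

Lemma Cmod_le_sum (z : C) : Cmod z <= Rabs (Re z) + Rabs (Im z).
Proof.
  replace z with (RtoC (Re z) + RtoC (Im z) * Ci)%C.
  - eapply Rle_trans; [apply Cmod_triangle|].
    rewrite Cmod_mult, Cmod_Ci, !Cmod_R. apply Req_le.
    apply f_equal2; [f_equal | rewrite Rmult_1_r; f_equal]; simpl; ring.
  - apply C_eq; simpl; ring.
Qed.

Lemma Cmod_minus_sym (z w : C) : Cmod (z - w) = Cmod (w - z).
Proof. rewrite <- Cmod_opp. f_equal. ring. Qed.

Lemma Cmod_triangle_inv (z w : C) : Cmod z - Cmod w <= Cmod (z - w).
Proof.
  assert (H := Cmod_triangle (z - w)%C w).
  replace (z - w + w)%C with z in H by ring. lra.
Qed.

Lemma Cmod_dist_triangle (a b c : C) :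
  Cmod (a - c) <= Cmod (a - b) + Cmod (b - c).
Proof. replace (a - c)%C with ((a - b) + (b - c))%C by ring. apply Cmod_triangle. Qed.

Lemma Cmod_small_eq_0 (z : C) : (forall eps, 0 < eps -> Cmod z <= eps) -> z = 0%C.
Proof.
  intros H. apply Cmod_eq_0. destruct (Req_dec (Cmod z) 0) as [|Hn]; [assumption|].
  assert (Hp := Cmod_ge_0 z). specialize (H (Cmod z / 2)). lra.
Qed.

Lemma C_eq_of_minus (z w : C) : (z - w)%C = 0%C -> z = w.
Proof. intros H. replace z with (z - w + w)%C by ring. rewrite H. ring. Qed.

Lemma C_eq_eps (z w : C) : (forall eps, 0 < eps -> Cmod (z - w) <= eps) -> z = w.
Proof. intros H. apply C_eq_of_minus, Cmod_small_eq_0, H. Qed.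

Lemma Cmod_minus_diag (z : C) : Cmod (z - z) = 0.
Proof. replace (z - z)%C with (RtoC 0) by ring. apply Cmod_0. Qed.

(** * Neighbourhoods and limits in C through the modulus *)

Lemma norm_C_R (z : C) : @norm R_AbsRing C_R_NormedModule z = Cmod z.
Proof. symmetry; apply Cmod_norm. Qed.

Lemma ball_C_of_Cmod (x y : C) (e : R) : Cmod (y - x) < e -> @ball C_UniformSpace x e y.
Proof. apply C_NormedModule_mixin_compat1. Qed.

(** The uniform structure of C is that of a product, so its balls are squares. The square of
    half-side e lies in the disc of radius sqrt 2 times e, and 2 is a convenient bound for sqrt
    2. *)
Lemma Cmod_of_ball_C (x y : C) (e : posreal) :
  @ball C_UniformSpace x e y -> Cmod (y - x) < 2 * e.
Proof.
  intros H. apply C_NormedModule_mixin_compat2 in H.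
  eapply Rlt_le_trans; [apply H|].
  apply Rmult_le_compat_r; [apply Rlt_le, cond_pos|].
  apply Rle_trans with (sqrt (2 * 2)).
  - apply sqrt_le_1_alt; lra.
  - rewrite sqrt_square by lra; lra.
Qed.

Lemma locally_C (z : C) (P : C -> Prop) :
  locally (T := C_UniformSpace) z P <->
  exists d, 0 < d /\ forall w, Cmod (w - z) < d -> P w.
Proof.
  split.
  - intros [e He]. exists e. split; [apply cond_pos|].
    intros w Hw. apply He. apply ball_C_of_Cmod. exact Hw.
  - intros [d [Hd H]]. assert (Hd2 : 0 < d / 2) by lra.
    exists (mkposreal _ Hd2). intros w Hw. apply H.
    apply Cmod_of_ball_C in Hw. simpl in Hw. lra.
Qed.

Lemma filterlim_C {T : Type} (F : (T -> Prop) -> Prop) {FF : Filter F} (f : T -> C) (l : C) :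
  filterlim f F (locally (T := C_UniformSpace) l) <->
  forall eps, 0 < eps -> F (fun x => Cmod (f x - l) < eps).
Proof.
  split.
  - intros H eps He. apply (H (fun w => Cmod (w - l) < eps)).
    apply locally_C. exists eps; split; auto.
  - intros H P HP. apply locally_C in HP. destruct HP as [d [Hd HP]].
    unfold filtermap. generalize (H d Hd). apply filter_imp. intros x Hx; apply HP, Hx.
Qed.

Lemma contC_eps (f : R -> C) (x : R) :
  contC f x <->
  forall eps, 0 < eps -> exists d, 0 < d /\ forall y, Rabs (y - x) < d -> Cmod (f y - f x) < eps.
Proof.
  unfold continuous. split.
  - intros H eps He.
    assert (H1 := proj1 (filterlim_C (locally x) f (f x)) H eps He).
    destruct H1 as [d Hd]. exists d. split; [apply cond_pos|]. intros y Hy. apply Hd, Hy.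
  - intros H. apply (filterlim_C (locally x) f (f x)). intros eps He.
    destruct (H eps He) as [d [Hd Hy]]. exists (mkposreal d Hd). intros y. apply Hy.
Qed.

(** * Continuity of complex-valued functions of a real variable *)

Lemma contC_const (c : C) (x : R) : contC (fun _ => c) x.
Proof. apply continuous_const. Qed.

Lemma contC_pair (f g : R -> R) (x : R) :
  continuous f x -> continuous g x -> contC (fun t => (f t, g t)) x.
Proof.
  intros Hf Hg. apply contC_eps. intros eps He.
  assert (He2 : 0 < eps / 2) by lra.
  destruct (Hf (fun u => Rabs (u - f x) < eps / 2)) as [d1 H1].
  { exists (mkposreal _ He2). intros u Hu; apply Hu. }
  destruct (Hg (fun u => Rabs (u - g x) < eps / 2)) as [d2 H2].
  { exists (mkposreal _ He2). intros u Hu; apply Hu. }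
  exists (Rmin d1 d2). split; [apply Rmin_pos; apply cond_pos|].
  intros y Hy.
  assert (A1 := H1 y (Rlt_le_trans _ _ _ Hy (Rmin_l _ _))).
  assert (A2 := H2 y (Rlt_le_trans _ _ _ Hy (Rmin_r _ _))).
  eapply Rle_lt_trans; [apply Cmod_le_sum|]. simpl.
  unfold Rminus in *. lra.
Qed.

Lemma contC_Re (f : R -> C) (x : R) : contC f x -> continuous (fun t => Re (f t)) x.
Proof.
  intros Hf P [e HP]. destruct (proj1 (contC_eps f x) Hf e (cond_pos e)) as [d [Hd H]].
  exists (mkposreal d Hd). intros y Hy. apply HP.
  change (Rabs (Re (f y) - Re (f x)) < e).
  eapply Rle_lt_trans; [|apply (H y Hy)].
  replace (Re (f y) - Re (f x)) with (Re (f y - f x)) by apply Re_minus. apply re_le_Cmod.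
Qed.

Lemma contC_Im (f : R -> C) (x : R) : contC f x -> continuous (fun t => Im (f t)) x.
Proof.
  intros Hf P [e HP]. destruct (proj1 (contC_eps f x) Hf e (cond_pos e)) as [d [Hd H]].
  exists (mkposreal d Hd). intros y Hy. apply HP.
  change (Rabs (Im (f y) - Im (f x)) < e).
  eapply Rle_lt_trans; [|apply (H y Hy)].
  replace (Im (f y) - Im (f x)) with (Im (f y - f x)) by apply Im_minus. apply im_le_Cmod.
Qed.

Lemma contC_ext (f g : R -> C) (x : R) : (forall t, f t = g t) -> contC f x -> contC g x.
Proof. intros H. apply continuous_ext. exact H. Qed.

Lemma contC_RtoC (f : R -> R) (x : R) : continuous f x -> contC (fun t => RtoC (f t)) x.
Proof. intros H. apply contC_pair; [exact H | apply continuous_const]. Qed.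

Lemma contC_plus (f g : R -> C) (x : R) :
  contC f x -> contC g x -> contC (fun t => (f t + g t)%C) x.
Proof. intros Hf Hg. apply (continuous_plus (V := C_R_NormedModule) f g x Hf Hg). Qed.

Lemma contC_opp (f : R -> C) (x : R) : contC f x -> contC (fun t => (- f t)%C) x.
Proof. intros Hf. apply (continuous_opp (V := C_R_NormedModule) f x Hf). Qed.

Lemma contC_minus (f g : R -> C) (x : R) :
  contC f x -> contC g x -> contC (fun t => (f t - g t)%C) x.
Proof. intros Hf Hg. apply contC_plus; [|apply contC_opp]; assumption. Qed.

Lemma contC_mult (f g : R -> C) (x : R) :
  contC f x -> contC g x -> contC (fun t => (f t * g t)%C) x.
Proof.
  intros Hf Hg.
  apply contC_pair.
  - apply (continuous_minus (V := R_NormedModule));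
      apply (continuous_mult (K := R_AbsRing)); (apply contC_Re || apply contC_Im); assumption.
  - apply (continuous_plus (V := R_NormedModule));
      apply (continuous_mult (K := R_AbsRing)); (apply contC_Re || apply contC_Im); assumption.
Qed.

Lemma contC_Cexp (f : R -> C) (x : R) : contC f x -> contC (fun t => Cexp (f t)) x.
Proof.
  intros Hf. unfold Cexp.
  assert (HR := contC_Re _ _ Hf). assert (HI := contC_Im _ _ Hf).
  apply contC_pair; apply (continuous_mult (K := R_AbsRing)).
  - apply (continuous_exp_comp _ _ HR).
  - apply continuous_comp; [apply HI | apply continuous_cos].
  - apply (continuous_exp_comp _ _ HR).
  - apply continuous_comp; [apply HI | apply continuous_sin].
Qed.

Lemma contC_comp (f : R -> C) (g : R -> R) (x : R) :
  continuous g x -> contC f (g x) -> contC (fun t => f (g t)) x.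
Proof. intros Hg Hf. apply (continuous_comp g f x Hg Hf). Qed.

Lemma continuous_ln_pos (x : R) : 0 < x -> continuous ln x.
Proof. intros H. apply (ex_derive_continuous (V := R_NormedModule)). exists (/ x). apply is_derive_ln, H. Qed.

Lemma contC_Rcpow (s : C) (x : R) : 0 < x -> contC (fun t => Rcpow t s) x.
Proof.
  intros H. unfold Rcpow. apply contC_Cexp, contC_mult; [apply contC_const|].
  apply contC_RtoC, continuous_ln_pos, H.
Qed.

(** * Derivatives of complex-valued functions of a real variable *)

Lemma derivC_pair (f g : R -> R) (x df dg : R) :
  is_derive f x df -> is_derive g x dg -> derivC (fun t => (f t, g t)) x (df, dg).
Proof.
  intros Hf Hg.
  apply (filterdiff_ext_lin _ (fun y : R => (scal y df, scal y dg))).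
  - apply (filterdiff_comp_2 (U := R_NormedModule) (V := R_NormedModule)
      (W := C_R_NormedModule) f g (fun a b => (a, b)) _ _ (fun a b => (a, b)) Hf Hg).
    apply filterdiff_linear.
    (* The pairing map is the identity in disguise, so the bound on its norm is borrowed from the
       identity. *)
    assert (Hid := is_linear_id (K := R_AbsRing) (V := C_R_NormedModule)).
    destruct Hid as [h1 h2 h3]. split.
    + intros [u1 u2] [v1 v2]; reflexivity.
    + intros k [u1 u2]; reflexivity.
    + destruct h3 as [M HM]. exists M. split; [apply HM|].
      intros [u v]. apply (proj2 HM).
  - intros y; reflexivity.
Qed.

Lemma derivC_Re (f : R -> C) (x : R) (l : C) :
  derivC f x l -> is_derive (fun t => Re (f t)) x (Re l).
Proof.
  intros H.
  apply (filterdiff_ext_lin _ (fun y : R => fst (scal y l : C_R_NormedModule))); [|reflexivity].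
  apply (filterdiff_comp (U := R_NormedModule) (V := C_R_NormedModule) (W := R_NormedModule) f fst _ _ H).
  apply filterdiff_linear. apply (is_linear_fst (U := R_NormedModule) (V := R_NormedModule)).
Qed.

Lemma derivC_Im (f : R -> C) (x : R) (l : C) :
  derivC f x l -> is_derive (fun t => Im (f t)) x (Im l).
Proof.
  intros H.
  apply (filterdiff_ext_lin _ (fun y : R => snd (scal y l : C_R_NormedModule))); [|reflexivity].
  apply (filterdiff_comp (U := R_NormedModule) (V := C_R_NormedModule) (W := R_NormedModule) f snd _ _ H).
  apply filterdiff_linear. apply (is_linear_snd (U := R_NormedModule) (V := R_NormedModule)).
Qed.

Lemma derivC_eq (f : R -> C) (x : R) (l l' : C) : derivC f x l -> l = l' -> derivC f x l'.
Proof. intros H <-; exact H. Qed.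

Lemma derivC_ext (f g : R -> C) (x : R) (l : C) :
  (forall t, f t = g t) -> derivC f x l -> derivC g x l.
Proof. intros H. apply (is_derive_ext (K := R_AbsRing) (V := C_R_NormedModule)). exact H. Qed.

Lemma derivC_cont (f : R -> C) (x : R) (l : C) : derivC f x l -> contC f x.
Proof.
  intros H. apply (ex_derive_continuous (K := R_AbsRing) (V := C_R_NormedModule)).
  exists l; exact H.
Qed.

Lemma derivC_const (c : C) (x : R) : derivC (fun _ => c) x (RtoC 0).
Proof. apply (is_derive_const (K := R_AbsRing) (V := C_R_NormedModule)). Qed.

Lemma derivC_plus (f g : R -> C) (x : R) (a b : C) :
  derivC f x a -> derivC g x b -> derivC (fun t => (f t + g t)%C) x (a + b)%C.
Proof. intros. apply (is_derive_plus (K := R_AbsRing) (V := C_R_NormedModule)); assumption. Qed.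

Lemma derivC_minus (f g : R -> C) (x : R) (a b : C) :
  derivC f x a -> derivC g x b -> derivC (fun t => (f t - g t)%C) x (a - b)%C.
Proof. intros. apply (is_derive_minus (K := R_AbsRing) (V := C_R_NormedModule)); assumption. Qed.

Lemma derivC_RtoC (f : R -> R) (x l : R) : is_derive f x l -> derivC (fun t => RtoC (f t)) x (RtoC l).
Proof. intros H. apply derivC_pair; [exact H | apply (is_derive_const (V := R_NormedModule))]. Qed.

Lemma derivC_mult (f g : R -> C) (x : R) (a b : C) :
  derivC f x a -> derivC g x b ->
  derivC (fun t => (f t * g t)%C) x (a * g x + f x * b)%C.
Proof.
  intros Hf Hg.
  assert (F1 := derivC_Re _ _ _ Hf). assert (F2 := derivC_Im _ _ _ Hf).
  assert (G1 := derivC_Re _ _ _ Hg). assert (G2 := derivC_Im _ _ _ Hg).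
  assert (HM : forall (u v : R -> R) (du dv : R), is_derive u x du -> is_derive v x dv ->
     is_derive (fun t => u t * v t) x (du * v x + u x * dv)).
  { intros u v du dv Hu Hv. apply (is_derive_mult (K := R_AbsRing)); try assumption.
    intros; apply Rmult_comm. }
  assert (H := derivC_pair _ _ _ _ _
    (is_derive_minus (V := R_NormedModule) _ _ _ _ _ (HM _ _ _ _ F1 G1) (HM _ _ _ _ F2 G2))
    (is_derive_plus (V := R_NormedModule) _ _ _ _ _ (HM _ _ _ _ F1 G2) (HM _ _ _ _ F2 G1))).
  eapply derivC_eq; [exact H|].
  Cparts.
Qed.

Lemma derivC_Cexp (f : R -> C) (x : R) (l : C) :
  derivC f x l -> derivC (fun t => Cexp (f t)) x (l * Cexp (f x))%C.
Proof.
  intros Hf.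
  assert (F1 := derivC_Re _ _ _ Hf). assert (F2 := derivC_Im _ _ _ Hf).
  unfold Cexp.
  eapply derivC_eq.
  - apply derivC_pair.
    + apply (is_derive_mult (K := R_AbsRing)); [| |intros; apply Rmult_comm].
      * apply (is_derive_comp exp); [apply is_derive_exp | apply F1].
      * apply (is_derive_comp cos); [apply is_derive_cos | apply F2].
    + apply (is_derive_mult (K := R_AbsRing)); [| |intros; apply Rmult_comm].
      * apply (is_derive_comp exp); [apply is_derive_exp | apply F1].
      * apply (is_derive_comp sin); [apply is_derive_sin | apply F2].
  - Cparts.
Qed.

Lemma derivC_comp (f : R -> C) (g : R -> R) (x : R) (df : C) (dg : R) :
  derivC f (g x) df -> is_derive g x dg -> derivC (fun t => f (g t)) x (dg * df)%C.
Proof.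
  intros Hf Hg.
  eapply derivC_eq; [apply (is_derive_comp (K := R_AbsRing) (V := C_R_NormedModule) f g x df dg Hf Hg)|].
  Cparts.
Qed.

Lemma derivC_zero_const (f : R -> C) (a b : R) :
  (forall t, a <= t <= b -> derivC f t (RtoC 0)) -> a < b -> f a = f b.
Proof. intros H Hab. apply (eq_is_derive (V := C_R_NormedModule) f a b); [exact H | exact Hab]. Qed.


(** The form in which derivatives of parameter integrals arise: integrating a quadratic Taylor bound
    over the other variable yields exactly such an estimate. *)
Lemma derivC_of_quadratic (f : R -> C) (x : R) (l : C) (K d : R) :
  0 < d ->
  (forall h, Rabs h < d -> Cmod (f (x + h)%R - f x - h * l)%C <= K * h ^ 2) ->
  derivC f x l.
Proof.
  intros Hd H. split; [apply (is_linear_scal_l (K := R_AbsRing) (V := C_R_NormedModule))|].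
  intros y Hy.
  assert (y = x) by (symmetry; apply is_filter_lim_locally_unique, Hy). subst y.
  intros eps.
  assert (HK : 0 < Rabs K + 1) by (assert (0 <= Rabs K) by apply Rabs_pos; lra).
  assert (Hm : 0 < Rmin d (eps / (Rabs K + 1))).
  { apply Rmin_pos; [exact Hd|]. apply Rdiv_lt_0_compat; [apply cond_pos | exact HK]. }
  exists (mkposreal _ Hm). intros u Hu. change R in u.
  change (Rabs (u + - x) < Rmin d (eps / (Rabs K + 1))) in Hu.
  assert (Hh := H (u + - x)). replace (x + (u + - x)) with u in Hh by (simpl; ring).
  specialize (Hh (Rlt_le_trans _ _ _ Hu (Rmin_l _ _))).
  rewrite norm_C_R.
  match goal with |- _ <= _ * ?n => change n with (Rabs (u + - x)) end.
  replace (Cmod _) with (Cmod (f u - f x - RtoC (u + - x) * l)).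
  2:{ f_equal. Cparts. }
  eapply Rle_trans; [exact Hh|].
  set (h := u + - x) in *.
  assert (Hh2 := Rlt_le_trans _ _ _ Hu (Rmin_r _ _)).
  apply Rle_trans with (Rabs K * Rabs h * Rabs h).
  - replace (h ^ 2) with (Rabs h * Rabs h) by (rewrite <- Rabs_mult, Rabs_pos_eq by nra; ring).
    rewrite <- Rmult_assoc. assert (K <= Rabs K) by apply Rle_abs.
    assert (0 <= Rabs h) by apply Rabs_pos.
    apply Rmult_le_compat_r; [|apply Rmult_le_compat_r]; assumption.
  - apply Rmult_le_compat_r; [apply Rabs_pos|].
    apply Rlt_le in Hh2. apply (Rmult_le_compat_l (Rabs K + 1)) in Hh2; [|lra].
    replace ((Rabs K + 1) * (eps / (Rabs K + 1))) with (pos eps) in Hh2 by (field; lra).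
    assert (0 <= Rabs h) by apply Rabs_pos. lra.
Qed.

(** * Integrals of complex-valued functions *)

Lemma intC_eq (f : R -> C) (a b : R) (l l' : C) : intC f a b l -> l = l' -> intC f a b l'.
Proof. intros H <-; exact H. Qed.

Lemma intC_ext (f g : R -> C) (a b : R) (l : C) :
  (forall x, Rmin a b < x < Rmax a b -> f x = g x) -> intC f a b l -> intC g a b l.
Proof. apply (is_RInt_ext (V := C_R_NormedModule)). Qed.

Lemma intC_unique (f : R -> C) (a b : R) (l l' : C) : intC f a b l -> intC f a b l' -> l = l'.
Proof.
  intros H H'. rewrite <- (is_RInt_unique (V := C_R_CompleteNormedModule) f a b l H).
  apply (is_RInt_unique (V := C_R_CompleteNormedModule) f a b l' H').
Qed.

Lemma intC_cont (f : R -> C) (a b : R) :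
  (forall x, Rmin a b <= x <= Rmax a b -> contC f x) -> intC f a b (IntC f a b).
Proof.
  intros H. apply (RInt_correct (V := C_R_CompleteNormedModule)).
  apply (ex_RInt_continuous (V := C_R_CompleteNormedModule)). exact H.
Qed.

Lemma intC_plus (f g : R -> C) (a b : R) (l m : C) :
  intC f a b l -> intC g a b m -> intC (fun x => (f x + g x)%C) a b (l + m)%C.
Proof. apply (is_RInt_plus (V := C_R_NormedModule)). Qed.

Lemma intC_minus (f g : R -> C) (a b : R) (l m : C) :
  intC f a b l -> intC g a b m -> intC (fun x => (f x - g x)%C) a b (l - m)%C.
Proof. apply (is_RInt_minus (V := C_R_NormedModule)). Qed.

(** [C_R_NormedModule] only knows real scalars, so a complex factor is treated componentwise. *)
Lemma intC_mult_l (c : C) (f : R -> C) (a b : R) (l : C) :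
  intC f a b l -> intC (fun x => (c * f x)%C) a b (c * l)%C.
Proof.
  intros H.
  assert (H1 := is_RInt_fct_extend_fst (U := R_NormedModule) (V := R_NormedModule) f a b l H).
  assert (H2 := is_RInt_fct_extend_snd (U := R_NormedModule) (V := R_NormedModule) f a b l H).
  apply (is_RInt_fct_extend_pair (U := R_NormedModule) (V := R_NormedModule)).
  - apply (is_RInt_minus (V := R_NormedModule)); apply (is_RInt_scal (V := R_NormedModule)); assumption.
  - apply (is_RInt_plus (V := R_NormedModule)); apply (is_RInt_scal (V := R_NormedModule)); assumption.
Qed.

Lemma intC_mult_r (c : C) (f : R -> C) (a b : R) (l : C) :
  intC f a b l -> intC (fun x => (f x * c)%C) a b (l * c)%C.
Proof.
  intros H. eapply intC_eq; [|apply Cmult_comm].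
  apply (intC_ext (fun x => (c * f x)%C)); [intros; apply Cmult_comm|].
  apply intC_mult_l, H.
Qed.

Lemma intC_const (c : C) (a b : R) : intC (fun _ => c) a b (RtoC (b - a) * c)%C.
Proof.
  eapply intC_eq; [apply (is_RInt_const (V := C_R_NormedModule))|]. Cparts.
Qed.

Lemma intC_Chasles (f : R -> C) (a b c : R) (l m : C) :
  intC f a b l -> intC f b c m -> intC f a c (l + m)%C.
Proof. apply (is_RInt_Chasles (V := C_R_NormedModule)). Qed.

Lemma intC_derive (f df : R -> C) (a b : R) :
  (forall x, Rmin a b <= x <= Rmax a b -> derivC f x (df x)) ->
  (forall x, Rmin a b <= x <= Rmax a b -> contC df x) ->
  intC df a b (f b - f a)%C.
Proof. apply (is_RInt_derive (V := C_R_CompleteNormedModule)). Qed.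

Lemma intC_bound_const (f : R -> C) (a b : R) (l : C) (M : R) :
  a <= b -> (forall x, a <= x <= b -> Cmod (f x) <= M) -> intC f a b l -> Cmod l <= (b - a) * M.
Proof.
  intros Hab HM H. rewrite <- norm_C_R.
  apply (norm_RInt_le_const (V := C_R_NormedModule) f a b); auto.
  intros x Hx. rewrite norm_C_R. apply HM, Hx.
Qed.

Lemma intC_bound (f : R -> C) (g : R -> R) (a b : R) (l : C) (lg : R) :
  a <= b -> (forall x, a <= x <= b -> Cmod (f x) <= g x) ->
  intC f a b l -> is_RInt g a b lg -> Cmod l <= lg.
Proof.
  intros Hab HM H Hg. rewrite <- norm_C_R.
  apply (norm_RInt_le (V := C_R_NormedModule) f g a b); auto.
  intros x Hx. rewrite norm_C_R. apply HM, Hx.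
Qed.

(** The open interval suffices: integrands may have junk values at the endpoints. *)
Lemma intC_bound_open (f : R -> C) (a b : R) (l : C) (M : R) :
  a <= b -> 0 <= M -> (forall x, a < x < b -> Cmod (f x) <= M) -> intC f a b l ->
  Cmod l <= (b - a) * M.
Proof.
  intros Hab HM0 HM H.
  set (g := fun x => if Rlt_dec a x then if Rlt_dec x b then f x else RtoC 0 else RtoC 0).
  apply (intC_bound_const g a b); [exact Hab| |].
  - intros x _. unfold g. destruct (Rlt_dec a x); [destruct (Rlt_dec x b)|];
      [apply HM; lra | rewrite Cmod_0; exact HM0..].
  - apply (intC_ext f); [|exact H]. intros x Hx. unfold g.
    rewrite Rmin_left, Rmax_right in Hx by exact Hab.
    destruct (Rlt_dec a x); [destruct (Rlt_dec x b)|]; [reflexivity|lra|lra].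
Qed.

(** [filterlim_RInt] asks for uniform convergence on the whole line, while it is available only on
    the open interval. All functions are cut off to 0 elsewhere, which changes no integral. *)
Lemma intC_unif_lim (f : nat -> R -> C) (g : R -> C) (a b : R) (l : nat -> C) :
  a <= b -> (forall n, intC (f n) a b (l n)) ->
  (forall eps, 0 < eps -> exists N, forall n x, (N <= n)%nat -> a < x < b ->
     Cmod (f n x - g x) < eps) ->
  exists I : C, intC g a b I /\
    forall eps, 0 < eps -> exists N, forall n, (N <= n)%nat -> Cmod (l n - I) < eps.
Proof.
  intros Hab Hf Hu.
  set (cut := fun (h : R -> C) x =>
    if Rlt_dec a x then if Rlt_dec x b then h x else RtoC 0 else RtoC 0).
  assert (Hcut : forall h x, Rmin a b < x < Rmax a b -> cut h x = h x).
  { intros h x Hx. unfold cut. rewrite Rmin_left, Rmax_right in Hx by exact Hab.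
    destruct (Rlt_dec a x); [destruct (Rlt_dec x b)|]; [reflexivity|lra|lra]. }
  destruct (filterlim_RInt (V := C_R_CompleteNormedModule) (fun n => cut (f n)) a b eventually
    _ (cut g) l) as [I [H1 H2]].
  - intros n. apply (intC_ext (f n)); [|apply Hf]. intros; symmetry; auto.
  - apply filterlim_locally. intros eps.
    assert (He : 0 < eps / 2) by (assert (H := cond_pos eps); lra).
    destruct (Hu _ He) as [N HN].
    exists N. intros n Hn x. apply (ball_C_of_Cmod (cut g x) (cut (f n) x)).
    unfold cut. assert (H := cond_pos eps).
    destruct (Rlt_dec a x); [destruct (Rlt_dec x b)|].
    + specialize (HN n x Hn (conj r r0)). lra.
    + replace (0 - 0)%C with (RtoC 0) by ring. rewrite Cmod_0. exact H.
    + replace (0 - 0)%C with (RtoC 0) by ring. rewrite Cmod_0. exact H.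
  - exists I. split.
    + apply (intC_ext (cut g)); [auto | exact H2].
    + intros eps He. destruct (proj1 (filterlim_C eventually l I) H1 eps He) as [N HN].
      exists N. intros n Hn. apply HN, Hn.
Qed.

(** * The complex exponential and complex powers of positive reals *)

Lemma Cexp_plus (z w : C) : Cexp (z + w) = (Cexp z * Cexp w)%C.
Proof.
  unfold Cexp. rewrite re_plus, im_plus, exp_plus, cos_plus, sin_plus.
  apply C_eq; simpl; ring.
Qed.

Lemma Cexp_0 : Cexp 0 = 1%C.
Proof. unfold Cexp; simpl. rewrite exp_0, cos_0, sin_0. apply C_eq; simpl; ring. Qed.

Lemma Cmod_Cexp (z : C) : Cmod (Cexp z) = exp (Re z).
Proof.
  unfold Cexp, Cmod, fst, snd.
  replace (_ + _) with (exp (Re z) ^ 2).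
  - apply sqrt_pow2, Rlt_le, exp_pos.
  - assert (H := sin2_cos2 (Im z)). unfold Rsqr in H.
    transitivity (exp (Re z) ^ 2 * (sin (Im z) * sin (Im z) + cos (Im z) * cos (Im z)));
      [rewrite H|]; ring.
Qed.

Lemma Cexp_neq_0 (z : C) : Cexp z <> 0%C.
Proof.
  intros H. assert (H1 := Cmod_Cexp z). rewrite H, Cmod_0 in H1.
  assert (H2 := exp_pos (Re z)). lra.
Qed.

Lemma Cexp_opp (z : C) : Cexp (- z) = (/ Cexp z)%C.
Proof.
  assert (H : (Cexp (- z) * Cexp z = 1)%C).
  { rewrite <- Cexp_plus. replace (- z + z)%C with (RtoC 0) by ring. apply Cexp_0. }
  assert (Hz := Cexp_neq_0 z).
  transitivity (Cexp (- z) * Cexp z * / Cexp z)%C; [field; exact Hz | rewrite H; ring].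
Qed.


Lemma Cexp_RtoC (x : R) : Cexp (RtoC x) = RtoC (exp x).
Proof. unfold Cexp; simpl. rewrite cos_0, sin_0. apply C_eq; simpl; ring. Qed.

Lemma Cexp_Ci (x : R) : Cexp (Ci * RtoC x) = (cos x, sin x).
Proof.
  unfold Cexp. simpl. replace (0 * x - 1 * 0) with 0 by ring.
  replace (0 * 0 + 1 * x) with x by ring. rewrite exp_0. apply C_eq; simpl; ring.
Qed.

Lemma Cmod_Cexp_Ci (x : R) : Cmod (Cexp (Ci * RtoC x)) = 1.
Proof. rewrite Cmod_Cexp. simpl. replace (0 * x - 1 * 0) with 0 by ring. apply exp_0. Qed.

Lemma Cexp_2PI_nat (n : nat) : Cexp (Ci * RtoC (2 * PI * INR n)) = 1%C.
Proof.
  rewrite Cexp_Ci. apply C_eq; simpl.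
  - replace (2 * PI * INR n) with (0 + 2 * INR n * PI) by ring. rewrite cos_period. apply cos_0.
  - replace (2 * PI * INR n) with (0 + 2 * INR n * PI) by ring. rewrite sin_period. apply sin_0.
Qed.

Lemma Rcpow_plus (x : R) (s t : C) : Rcpow x (s + t)%C = (Rcpow x s * Rcpow x t)%C.
Proof. unfold Rcpow. rewrite <- Cexp_plus. f_equal. ring. Qed.

Lemma Rcpow_opp (x : R) (s : C) : Rcpow x (- s)%C = (/ Rcpow x s)%C.
Proof. unfold Rcpow. rewrite <- Cexp_opp. f_equal. ring. Qed.

Lemma Rcpow_mult (x y : R) (s : C) : 0 < x -> 0 < y ->
  Rcpow (x * y) s = (Rcpow x s * Rcpow y s)%C.
Proof.
  intros Hx Hy. unfold Rcpow. rewrite <- Cexp_plus. f_equal.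
  rewrite ln_mult by assumption. rewrite RtoC_plus. ring.
Qed.

Lemma Cmod_Rcpow (x : R) (s : C) : Cmod (Rcpow x s) = Rpower x (Re s).
Proof. unfold Rcpow, Rpower. rewrite Cmod_Cexp. f_equal. rewrite re_scal_r. ring. Qed.


Lemma Rcpow_0_r (x : R) : Rcpow x 0 = 1%C.
Proof. unfold Rcpow. rewrite Cmult_0_l. apply Cexp_0. Qed.

Lemma Rcpow_RtoC (x r : R) : Rcpow x (RtoC r) = RtoC (Rpower x r).
Proof. unfold Rcpow. rewrite <- RtoC_mult, Cexp_RtoC. reflexivity. Qed.

Lemma Rcpow_1_r (x : R) : 0 < x -> Rcpow x 1 = RtoC x.
Proof. intros H. rewrite Rcpow_RtoC, Rpower_1 by exact H. reflexivity. Qed.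

Lemma derivC_Rcpow (s : C) (x : R) : 0 < x ->
  derivC (fun t => Rcpow t s) x (s * Rcpow x (s - 1))%C.
Proof.
  intros H. unfold Rcpow at 1.
  eapply derivC_eq.
  - apply derivC_Cexp, derivC_mult; [apply derivC_const|].
    apply (derivC_RtoC ln), is_derive_ln, H.
  - cbv beta. fold (Rcpow x s). unfold Cminus. rewrite Rcpow_plus, Rcpow_opp, Rcpow_1_r by exact H.
    rewrite RtoC_inv by lra. rewrite Cmult_0_l, Cplus_0_l. rewrite <- !Cmult_assoc. f_equal. apply Cmult_comm.
Qed.

Lemma Rcpow_S_r (x : R) (s : C) : 0 < x -> Rcpow x (s + 1)%C = (Rcpow x s * RtoC x)%C.
Proof. intros H. rewrite Rcpow_plus, Rcpow_1_r by exact H. reflexivity. Qed.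

Lemma Rpower_pos (x y : R) : 0 < Rpower x y.
Proof. apply exp_pos. Qed.

(** * Quadratically approximable functions *)

Lemma derivC_eps (f : R -> C) (x : R) (l : C) :
  derivC f x l <->
  forall eps, 0 < eps -> exists d, 0 < d /\
    forall h, Rabs h < d -> Cmod (f (x + h)%R - f x - h * l)%C <= eps * Rabs h.
Proof.
  split.
  - intros [_ H] eps He. specialize (H x (fun P HP => HP) (mkposreal eps He)).
    destruct H as [d Hd]. exists d. split; [apply cond_pos|].
    intros h Hh. assert (Hb : @ball (AbsRing_UniformSpace R_AbsRing) x d (x + h)).
    { change (Rabs (x + h + - x) < d). replace (x + h + - x) with h by ring. exact Hh. }
    specialize (Hd (x + h) Hb). rewrite norm_C_R in Hd.
    change (norm (minus (x + h) x)) with (Rabs (x + h + - x)) in Hd.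
    replace (x + h + - x) with h in Hd by ring. simpl in Hd.
    eapply Rle_trans; [|exact Hd]. apply Req_le. f_equal.
    replace (minus (x + h) x) with h by (unfold minus, plus, opp; simpl; ring).
    Cparts.
  - intros H. split; [apply (is_linear_scal_l (K := R_AbsRing) (V := C_R_NormedModule))|].
    intros y Hy.
    assert (y = x) by (symmetry; apply is_filter_lim_locally_unique, Hy). subst y.
    intros eps. destruct (H eps (cond_pos eps)) as [d [Hd Hh]].
    exists (mkposreal d Hd). intros u Hu. change R in u.
    change (Rabs (u + - x) < d) in Hu. specialize (Hh _ Hu).
    replace (x + (u + - x)) with u in Hh by ring.
    rewrite norm_C_R. change (norm (minus u x)) with (Rabs (u + - x)).
    eapply Rle_trans; [|exact Hh]. apply Req_le. f_equal. Cparts.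
Qed.

(** A quadratic Taylor estimate, uniform on the ball. It makes [f'] Lipschitz,
    so no separate continuity of the derivative has to be carried around. *)
Definition QH (f : C -> C) (z0 : C) (r : R) : Prop :=
  exists (f' : C -> C) (K : R), 0 <= K /\
    forall w v : C, Cmod (w - z0) < r -> Cmod (v - z0) < r ->
      Cmod (f v - f w - (v - w) * f' w) <= K * Cmod (v - w) ^ 2.

Lemma QH_sub (f : C -> C) (z0 z1 : C) (r r1 : R) :
  QH f z0 r -> Cmod (z1 - z0) + r1 <= r -> QH f z1 r1.
Proof.
  intros [f' [K [HK H]]] Hr. exists f', K. split; [exact HK|].
  intros w v Hw Hv.
  assert (A1 := Cmod_dist_triangle w z1 z0). assert (A2 := Cmod_dist_triangle v z1 z0).
  apply H; lra.
Qed.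

Lemma QH_ext (f g : C -> C) (z0 : C) (r : R) :
  (forall z, Cmod (z - z0) < r -> f z = g z) -> QH f z0 r -> QH g z0 r.
Proof.
  intros He [f' [K [HK H]]]. exists f', K. split; [exact HK|].
  intros w v Hw Hv. rewrite <- (He w Hw), <- (He v Hv). apply H; assumption.
Qed.

(** Adding the Taylor estimates based at [w] and at [v] cancels the values of [f] and leaves (v - w)
    (f' v - f' w), bounded by 2 K |v - w|^2. *)
Lemma QH_deriv_Lipschitz (f f' : C -> C) (z0 : C) (r K : R) :
  (forall w v : C, Cmod (w - z0) < r -> Cmod (v - z0) < r ->
      Cmod (f v - f w - (v - w) * f' w) <= K * Cmod (v - w) ^ 2) ->
  forall w v : C, Cmod (w - z0) < r -> Cmod (v - z0) < r ->
    Cmod (f' v - f' w) <= 2 * K * Cmod (v - w).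
Proof.
  intros H w v Hw Hv.
  destruct (Req_dec (Cmod (v - w)) 0) as [H0|H0].
  - assert (v = w).
    { apply Cmod_eq_0 in H0. replace v with (v - w + w)%C by ring. rewrite H0. ring. }
    subst v. rewrite Cmod_minus_diag, H0. lra.
  - assert (H1 := H w v Hw Hv). assert (H2 := H v w Hv Hw).
    rewrite (Cmod_minus_sym w v) in H2.
    assert (Hp := Cmod_ge_0 (v - w)%C).
    apply Rmult_le_reg_l with (Cmod (v - w)); [lra|].
    rewrite <- Cmod_mult.
    replace ((v - w) * (f' v - f' w))%C with
      ((f v - f w - (v - w) * f' w) + (f w - f v - (w - v) * f' v))%C by ring.
    eapply Rle_trans; [apply Cmod_triangle|]. simpl in *. lra.
Qed.

Lemma QH_bounds (f : C -> C) (z0 : C) (r : R) : 0 < r ->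
  QH f z0 r ->
  exists (f' : C -> C) (K B : R), 0 <= K /\ 0 <= B /\
    (forall w v : C, Cmod (w - z0) < r -> Cmod (v - z0) < r ->
      Cmod (f v - f w - (v - w) * f' w) <= K * Cmod (v - w) ^ 2) /\
    (forall w v : C, Cmod (w - z0) < r -> Cmod (v - z0) < r ->
      Cmod (f v - f w) <= B * Cmod (v - w)) /\
    (forall w, Cmod (w - z0) < r -> Cmod (f w) <= B) /\
    (forall w, Cmod (w - z0) < r -> Cmod (f' w) <= B).
Proof.
  intros Hr [f' [K [HK H]]].
  assert (HL := QH_deriv_Lipschitz f f' z0 r K H).
  assert (H0 : Cmod (z0 - z0) < r) by (replace (z0 - z0)%C with (RtoC 0) by ring; rewrite Cmod_0; exact Hr).
  set (B1 := Cmod (f' z0) + 2 * K * r).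
  assert (HB1 : forall w, Cmod (w - z0) < r -> Cmod (f' w) <= B1).
  { intros w Hw. unfold B1.
    assert (A1 := HL z0 w H0 Hw). assert (A2 := Cmod_triangle_inv (f' w) (f' z0)).
    assert (2 * K * Cmod (w - z0) <= 2 * K * r) by (apply Rmult_le_compat_l; lra). lra. }
  assert (HB1p : 0 <= B1) by (unfold B1; assert (T := Cmod_ge_0 (f' z0)); assert (0 <= 2 * K * r) by nra; lra).
  set (B2 := B1 + K * (2 * r)).
  assert (HB2 : forall w v : C, Cmod (w - z0) < r -> Cmod (v - z0) < r ->
      Cmod (f v - f w) <= B2 * Cmod (v - w)).
  { intros w v Hw Hv. assert (A1 := H w v Hw Hv).
    assert (A2 := Cmod_triangle_inv (f v - f w) ((v - w) * f' w)%C).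
    rewrite Cmod_mult in A2. assert (A3 := HB1 w Hw).
    assert (A4 := Cmod_dist_triangle v z0 w). rewrite (Cmod_minus_sym z0 w) in A4.
    assert (A5 := Cmod_ge_0 (v - w)%C).
    assert (Cmod (v - w) * Cmod (f' w) <= B1 * Cmod (v - w)) by (rewrite Rmult_comm; apply Rmult_le_compat_r; assumption).
    assert (K * Cmod (v - w) ^ 2 <= K * (2 * r) * Cmod (v - w)).
    { replace (K * Cmod (v - w) ^ 2) with (K * Cmod (v - w) * Cmod (v - w)) by ring.
      apply Rmult_le_compat_r; [exact A5|]. apply Rmult_le_compat_l; lra. }
    unfold B2. lra. }
  assert (HB2p : 0 <= B2) by (unfold B2; assert (0 <= K * (2 * r)) by nra; lra).
  assert (HB12 : B1 <= B2) by (unfold B2; assert (0 <= K * (2 * r)) by nra; lra).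
  set (B3 := Cmod (f z0) + B2 * r + B2).
  assert (T0 := Cmod_ge_0 (f z0)). assert (T1 : 0 <= B2 * r) by nra.
  exists f', K, B3. repeat split; try assumption.
  - unfold B3; lra.
  - intros w v Hw Hv. eapply Rle_trans; [apply HB2; assumption|].
    apply Rmult_le_compat_r; [apply Cmod_ge_0 | unfold B3; lra].
  - intros w Hw. assert (A1 := HB2 z0 w H0 Hw). assert (A2 := Cmod_triangle_inv (f w) (f z0)).
    assert (B2 * Cmod (w - z0) <= B2 * r) by (apply Rmult_le_compat_l; lra). unfold B3; lra.
  - intros w Hw. eapply Rle_trans; [apply HB1; assumption | unfold B3; lra].
Qed.

Lemma QH_const (c z0 : C) (r : R) : QH (fun _ => c) z0 r.
Proof.
  exists (fun _ => RtoC 0), 0. split; [lra|]. intros w v _ _.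
  replace (c - c - (v - w) * 0)%C with (RtoC 0) by ring. rewrite Cmod_0. lra.
Qed.

Lemma QH_id (z0 : C) (r : R) : QH (fun z => z) z0 r.
Proof.
  exists (fun _ => RtoC 1), 0. split; [lra|]. intros w v _ _.
  replace (v - w - (v - w) * 1)%C with (RtoC 0) by ring. rewrite Cmod_0. lra.
Qed.

Lemma QH_plus (f g : C -> C) (z0 : C) (r : R) :
  QH f z0 r -> QH g z0 r -> QH (fun z => (f z + g z)%C) z0 r.
Proof.
  intros [f' [K [HK H]]] [g' [L [HL G]]].
  exists (fun z => (f' z + g' z)%C), (K + L). split; [lra|]. intros w v Hw Hv.
  replace (_ - _)%C with ((f v - f w - (v - w) * f' w) + (g v - g w - (v - w) * g' w))%C by ring.
  eapply Rle_trans; [apply Cmod_triangle|]. rewrite Rmult_plus_distr_r.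
  apply Rplus_le_compat; auto.
Qed.

Lemma QH_mult (f g : C -> C) (z0 : C) (r : R) :
  QH f z0 r -> QH g z0 r -> QH (fun z => (f z * g z)%C) z0 r.
Proof.
  intros Hf Hg. destruct (Rle_dec r 0) as [Hr|Hr].
  (* For [r <= 0] the ball is empty and any function passes for the derivative; [QH_bounds] is
     stated for a positive radius. *)
  { exists f, 0. split; [lra|]. intros w v Hw. assert (T := Cmod_ge_0 (w - z0)%C). lra. }
  apply Rnot_le_lt in Hr.
  destruct (QH_bounds f z0 r Hr Hf) as [f' [K [B [HK [HB [F1 [F2 [F3 F4]]]]]]]].
  destruct (QH_bounds g z0 r Hr Hg) as [g' [L [D [HL [HD [G1 [G2 [G3 G4]]]]]]]].
  exists (fun z => (f' z * g z + f z * g' z)%C), (B * D + D * K + B * L).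
  split; [nra|]. intros w v Hw Hv.
  replace (_ - _)%C with ((f v - f w) * (g v - g w) + g w * (f v - f w - (v - w) * f' w)
     + f w * (g v - g w - (v - w) * g' w))%C by ring.
  assert (Hd := Cmod_ge_0 (v - w)%C). set (d := Cmod (v - w)) in *.
  eapply Rle_trans; [apply Cmod_triangle|].
  eapply Rle_trans; [apply Rplus_le_compat_r, Cmod_triangle|]. rewrite !Cmod_mult.
  assert (A1 := F2 w v Hw Hv). assert (A2 := G2 w v Hw Hv).
  assert (A3 := F1 w v Hw Hv). assert (A4 := G1 w v Hw Hv). fold d in A1, A2, A3, A4.
  assert (E1 : Cmod (f v - f w) * Cmod (g v - g w) <= (B * d) * (D * d))
    by (apply Rmult_le_compat; auto; apply Cmod_ge_0).
  assert (E2 : Cmod (g w) * Cmod (f v - f w - (v - w) * f' w) <= D * (K * d ^ 2))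
    by (apply Rmult_le_compat; auto; apply Cmod_ge_0).
  assert (E3 : Cmod (f w) * Cmod (g v - g w - (v - w) * g' w) <= B * (L * d ^ 2))
    by (apply Rmult_le_compat; auto; apply Cmod_ge_0).
  replace ((B * D + D * K + B * L) * d ^ 2) with ((B * d) * (D * d) + D * (K * d ^ 2) + B * (L * d ^ 2)) by ring.
  lra.
Qed.

Lemma QH_opp (f : C -> C) (z0 : C) (r : R) : QH f z0 r -> QH (fun z => (- f z)%C) z0 r.
Proof.
  intros H. apply (QH_ext (fun z => (- (1)) * f z)%C); [intros; ring|].
  apply QH_mult; [apply QH_const | exact H].
Qed.

Lemma QH_minus (f g : C -> C) (z0 : C) (r : R) :
  QH f z0 r -> QH g z0 r -> QH (fun z => (f z - g z)%C) z0 r.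
Proof. intros; apply QH_plus; [|apply QH_opp]; assumption. Qed.

Lemma QH_comp (f g : C -> C) (z0 z1 : C) (r R1 : R) :
  0 < r -> 0 < R1 -> QH f z0 r -> QH g z1 R1 ->
  (forall z, Cmod (z - z0) < r -> Cmod (f z - z1) < R1) ->
  QH (fun z => g (f z)) z0 r.
Proof.
  intros Hr HR Hf Hg Hm.
  destruct (QH_bounds f z0 r Hr Hf) as [f' [K [B [HK [HB [F1 [F2 [F3 F4]]]]]]]].
  destruct (QH_bounds g z1 R1 HR Hg) as [g' [L [D [HL [HD [G1 [G2 [G3 G4]]]]]]]].
  exists (fun z => (f' z * g' (f z))%C), (L * B ^ 2 + D * K).
  split; [nra|]. intros w v Hw Hv.
  replace (_ - _)%C with ((g (f v) - g (f w) - (f v - f w) * g' (f w)) +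
     g' (f w) * (f v - f w - (v - w) * f' w))%C by ring.
  eapply Rle_trans; [apply Cmod_triangle|]. rewrite (Cmod_mult (g' (f w))).
  rewrite Rmult_plus_distr_r. apply Rplus_le_compat.
  - eapply Rle_trans; [apply G1; apply Hm; assumption|].
    rewrite Rmult_assoc. apply Rmult_le_compat_l; [exact HL|].
    rewrite <- Rpow_mult_distr. apply pow_incr. split; [apply Cmod_ge_0 | auto].
  - rewrite Rmult_assoc. apply Rmult_le_compat; auto; apply Cmod_ge_0.
Qed.

Lemma QH_reflect (f : C -> C) (c z0 : C) (r : R) :
  QH f (c - z0)%C r -> QH (fun z => f (c - z)%C) z0 r.
Proof.
  intros [f' [K [HK H]]]. exists (fun z => (- f' (c - z))%C), K. split; [exact HK|].
  intros w v Hw Hv.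
  assert (E : forall a, Cmod (c - a - (c - z0)) = Cmod (a - z0))
    by (intros a; rewrite Cmod_minus_sym; f_equal; ring).
  assert (A1 := H (c - w)%C (c - v)%C). rewrite !E in A1. specialize (A1 Hw Hv).
  rewrite (Cmod_minus_sym (c - v)) in A1.
  replace (c - w - (c - v))%C with (v - w)%C in A1 by ring.
  eapply Rle_trans; [|exact A1]. apply Req_le. f_equal. ring.
Qed.

(** The Taylor remainder of 1 / (z - a) is exactly (v - w)^2 / ((v - a) (w - a)^2), and on the ball
    each of the three factors of the denominator has modulus at least |z0 - a| - r. *)
Lemma Cinv_quadratic (a z0 : C) (r : R) (w v : C) :
  r < Cmod (z0 - a) -> Cmod (w - z0) < r -> Cmod (v - z0) < r ->
  Cmod (/ (v - a) - / (w - a) - (v - w) * (- / ((w - a) * (w - a))))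
  <= / (Cmod (z0 - a) - r) ^ 3 * Cmod (v - w) ^ 2.
Proof.
  intros Hr Hw Hv. set (d := Cmod (z0 - a) - r). assert (Hd : 0 < d) by (unfold d; lra).
  assert (Hb : forall z, Cmod (z - z0) < r -> d <= Cmod (z - a)).
  { intros z Hz. assert (T := Cmod_dist_triangle z0 z a). rewrite (Cmod_minus_sym z0 z) in T.
    unfold d; lra. }
  assert (Hn : forall z, Cmod (z - z0) < r -> (z - a)%C <> 0%C).
  { intros z Hz E. assert (T := Hb z Hz). rewrite E, Cmod_0 in T. lra. }
  assert (Nw := Hn w Hw). assert (Nv := Hn v Hv).
  replace (_ - _)%C with ((v - w) * (v - w) * / ((v - a) * ((w - a) * (w - a))))%C by (field; auto).
  assert (Nww : ((w - a) * (w - a))%C <> 0%C) by (apply Cmult_neq_0; assumption).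
  assert (Nall : ((v - a) * ((w - a) * (w - a)))%C <> 0%C) by (apply Cmult_neq_0; assumption).
  rewrite Cmod_mult, Cmod_mult, Cmod_inv by exact Nall.
  rewrite (Rmult_comm (/ _)). replace (Cmod (v - w) ^ 2) with (Cmod (v - w) * Cmod (v - w)) by ring.
  apply Rmult_le_compat_l; [apply Rmult_le_pos; apply Cmod_ge_0|].
  rewrite !Cmod_mult.
  assert (Bw := Hb w Hw). assert (Bv := Hb v Hv).
  apply Rinv_le_contravar; [apply pow_lt, Hd|].
  replace (d ^ 3) with (d * (d * d)) by ring.
  apply Rmult_le_compat; [lra|nra|exact Bv|].
  apply Rmult_le_compat; lra.
Qed.

Lemma QH_inv (a z0 : C) (r : R) : r < Cmod (z0 - a) -> QH (fun z => / (z - a))%C z0 r.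
Proof.
  intros Hr. exists (fun z => (- / ((z - a) * (z - a)))%C), (/ (Cmod (z0 - a) - r) ^ 3).
  split; [apply Rlt_le, Rinv_0_lt_compat, pow_lt; lra|].
  intros w v Hw Hv. apply Cinv_quadratic; assumption.
Qed.

(** The fundamental theorem of calculus along the segment t h is used twice: first for exp (t h),
    then for exp (t h) - t h, whose derivative h (exp (t h) - 1) is controlled by the first
    estimate. *)
Lemma Cexp_quadratic (h : C) :
  Cmod (Cexp h - 1 - h) <= Cmod h ^ 2 * exp (Cmod h) /\ Cmod (Cexp h - 1) <= Cmod h * exp (Cmod h).
Proof.
  assert (Hh := Cmod_ge_0 h).
  assert (D : forall (c : C) t, derivC (fun t => Cexp (RtoC t * c)) t (c * Cexp (RtoC t * c))%C).
  { intros c t. eapply derivC_eq.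
    - apply derivC_Cexp, derivC_mult; [apply derivC_RtoC, (is_derive_id (K := R_AbsRing)) | apply derivC_const].
    - unfold one; simpl. ring. }
  assert (Hc : forall (c : C) t, contC (fun t => Cexp (RtoC t * c)) t).
  { intros c t. eapply derivC_cont, D. }
  assert (P1 : forall c : C, Cmod c <= Cmod h -> Cmod (Cexp c - 1) <= Cmod c * exp (Cmod h)).
  { intros c Hcc.
    assert (I := intC_derive (fun t => Cexp (RtoC t * c)) (fun t => (c * Cexp (RtoC t * c))%C) 0 1
       (fun x _ => D c x) (fun x _ => contC_mult _ _ _ (contC_const c x) (Hc c x))).
    cbv beta in I. rewrite Cmult_1_l, Cmult_0_l, Cexp_0 in I.
    replace (Cmod c * exp (Cmod h)) with ((1 - 0) * (Cmod c * exp (Cmod h))) by ring.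
    apply (intC_bound_const _ _ _ _ _ Rle_0_1) with (2 := I).
    intros x Hx. rewrite Cmod_mult. apply Rmult_le_compat_l; [apply Cmod_ge_0|].
    rewrite Cmod_Cexp. rewrite re_scal_l.
    assert (T := re_le_Cmod c). assert (Re c <= Cmod c) by (eapply Rle_trans; [apply Rle_abs | exact T]).
    assert (T2 : x * Re c <= Cmod h).
    { apply Rle_trans with (x * Cmod c); [apply Rmult_le_compat_l; lra|].
      assert (T3 := Cmod_ge_0 c). nra. }
    destruct T2 as [T2|T2]; [left; apply exp_increasing, T2 | right; f_equal; exact T2]. }
  split; [|apply P1; lra].
  assert (I := intC_derive (fun t => (Cexp (RtoC t * h) - RtoC t * h)%C) (fun t => (h * Cexp (RtoC t * h) - h)%C) 0 1).
  assert (I' : intC (fun t => (h * Cexp (RtoC t * h) - h)%C) 0 1 (Cexp h - 1 - h)%C).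
  { eapply intC_eq; [apply I|].
    - intros x _. apply derivC_minus; [apply D|]. eapply derivC_eq.
      + apply derivC_mult; [apply derivC_RtoC, (is_derive_id (K := R_AbsRing)) | apply derivC_const].
      + unfold one; simpl; ring.
    - intros x _. apply contC_minus; [apply contC_mult; [apply contC_const | apply Hc] | apply contC_const].
    - rewrite !Cmult_1_l, Cmult_0_l, Cexp_0. ring. }
  replace (Cmod h ^ 2 * exp (Cmod h)) with ((1 - 0) * (Cmod h * (Cmod h * exp (Cmod h)))) by ring.
  apply (intC_bound_const _ _ _ _ _ Rle_0_1) with (2 := I').
  intros x Hx.
  replace (h * Cexp (x * h) - h)%C with (h * (Cexp (x * h) - 1))%C by ring.
  rewrite Cmod_mult. apply Rmult_le_compat_l; [exact Hh|].
  assert (Hxh : Cmod (RtoC x * h) <= Cmod h).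
  { rewrite Cmod_mult, Cmod_R, Rabs_pos_eq by lra. nra. }
  eapply Rle_trans; [apply P1; exact Hxh|].
  apply Rmult_le_compat_r; [apply Rlt_le, exp_pos | exact Hxh].
Qed.

Lemma exp_le (x y : R) : x <= y -> exp x <= exp y.
Proof. intros [H|H]; [left; apply exp_increasing, H | right; f_equal; exact H]. Qed.

(** The constant is explicit and increasing in |l|, so that [QH_integral] can take it uniformly over
    a range of [l]. The 3 r consists of r for the distance of [w] from [z0] and 2 r for |v - w|. *)
Lemma Cexp_linear_quadratic (l w v z0 : C) (r : R) :
  Cmod (w - z0) < r -> Cmod (v - z0) < r ->
  Cmod (Cexp (v * l) - Cexp (w * l) - (v - w) * (l * Cexp (w * l)))
  <= Cmod l ^ 2 * exp ((Cmod z0 + 3 * r) * Cmod l) * Cmod (v - w) ^ 2.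
Proof.
  intros Hw Hv.
  replace (_ - _)%C with (Cexp (w * l) * (Cexp ((v - w) * l) - 1 - (v - w) * l))%C.
  2:{ replace (v * l)%C with (w * l + (v - w) * l)%C by ring. rewrite Cexp_plus. ring. }
  rewrite Cmod_mult.
  assert (A := proj1 (Cexp_quadratic ((v - w) * l)%C)). rewrite Cmod_mult in A.
  assert (Hd := Cmod_ge_0 (v - w)%C). assert (Hl := Cmod_ge_0 l).
  assert (Hvw : Cmod (v - w) <= 2 * r).
  { assert (T := Cmod_dist_triangle v z0 w). rewrite (Cmod_minus_sym z0 w) in T. lra. }
  assert (Hw' : Cmod w <= Cmod z0 + r) by (assert (T := Cmod_triangle_inv w z0); lra).
  assert (E1 : Cmod (Cexp (w * l)) <= exp ((Cmod z0 + r) * Cmod l)).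
  { rewrite Cmod_Cexp. apply exp_le. eapply Rle_trans; [apply Rle_abs|].
    eapply Rle_trans; [apply re_le_Cmod|]. rewrite Cmod_mult. apply Rmult_le_compat_r; assumption. }
  eapply Rle_trans.
  { apply Rmult_le_compat; [apply Cmod_ge_0 | apply Cmod_ge_0 | exact E1 | exact A]. }
  replace ((Cmod z0 + 3 * r) * Cmod l) with ((Cmod z0 + r) * Cmod l + 2 * r * Cmod l) by ring.
  rewrite exp_plus.
  assert (E2 : exp (Cmod (v - w) * Cmod l) <= exp (2 * r * Cmod l))
    by (apply exp_le, Rmult_le_compat_r; assumption).
  replace (Cmod l ^ 2 * (exp ((Cmod z0 + r) * Cmod l) * exp (2 * r * Cmod l)) * Cmod (v - w) ^ 2)
    with (exp ((Cmod z0 + r) * Cmod l) * ((Cmod (v - w) * Cmod l) ^ 2 * exp (2 * r * Cmod l))) by ring.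
  apply Rmult_le_compat_l; [apply Rlt_le, exp_pos|].
  apply Rmult_le_compat_l; [apply pow2_ge_0 | exact E2].
Qed.

Lemma QH_Cexp_mult (l z0 : C) (r : R) : QH (fun z => Cexp (z * l)) z0 r.
Proof.
  exists (fun z => (l * Cexp (z * l))%C), (Cmod l ^ 2 * exp ((Cmod z0 + 3 * r) * Cmod l)).
  split; [apply Rmult_le_pos; [apply pow2_ge_0 | apply Rlt_le, exp_pos]|].
  intros w v Hw Hv. apply Cexp_linear_quadratic; assumption.
Qed.

Lemma QH_Rcpow (x : R) (z0 : C) (r : R) : QH (fun z => Rcpow x z) z0 r.
Proof. apply QH_Cexp_mult. Qed.

Lemma QH_sum_n (f : nat -> C -> C) (z0 : C) (r : R) (n : nat) :
  (forall k, QH (f k) z0 r) -> QH (fun z => sum_n (G := C_AbelianMonoid) (fun k => f k z) n) z0 r.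
Proof.
  intros H. induction n.
  - apply (QH_ext (f 0%nat)); [|apply H]. intros; rewrite sum_O; reflexivity.
  - apply (QH_ext (fun z => sum_n (G := C_AbelianMonoid) (fun k => f k z) n + f (S n) z)%C).
    + intros; rewrite sum_Sn; reflexivity.
    + apply QH_plus; [exact IHn | apply H].
Qed.

Lemma contC_bounded (f : R -> C) (a b : R) :
  a <= b -> (forall t, a <= t <= b -> contC f t) ->
  exists M, 0 <= M /\ forall t, a <= t <= b -> Cmod (f t) <= M.
Proof.
  intros Hab Hf.
  destruct (continuity_ab_maj (fun t => Cmod (f t)) a b Hab) as [m [Hm _]].
  - intros c Hc. apply continuity_pt_filterlim. intros P [e HP].
    destruct (proj1 (contC_eps f c) (Hf c Hc) e (cond_pos e)) as [d [Hd H]].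
    exists (mkposreal d Hd). intros y Hy. apply HP.
    change (Rabs (Cmod (f y) - Cmod (f c)) < e).
    specialize (H y Hy). assert (T1 := Cmod_triangle_inv (f y) (f c)).
    assert (T2 := Cmod_triangle_inv (f c) (f y)). rewrite (Cmod_minus_sym (f c)) in T2.
    apply Rabs_def1; lra.
  - exists (Cmod (f m)). split; [apply Cmod_ge_0 | exact Hm].
Qed.

(** Differentiation under the integral sign: on a compact interval [l] and [u] are bounded, hence so
    is the Taylor constant of exp (z l(t)) u(t). Truncated Gamma integrals and integrals of powers
    have this form, with [l] a logarithm up to sign. *)
Lemma QH_integral (l : R -> R) (u : R -> C) (a b : R) (z0 : C) (r : R) (F : C -> C) :
  a <= b -> 0 <= r ->
  (forall t, a <= t <= b -> continuous l t) -> (forall t, a <= t <= b -> contC u t) ->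
  (forall z, Cmod (z - z0) < r -> intC (fun t => (Cexp (z * RtoC (l t)) * u t)%C) a b (F z)) ->
  QH F z0 r.
Proof.
  intros Hab Hr Hl Hu HF.
  destruct (contC_bounded (fun t => RtoC (l t)) a b Hab) as [L [HL0 HL]].
  { intros t Ht. apply contC_RtoC, Hl, Ht. }
  destruct (contC_bounded u a b Hab Hu) as [U [HU0 HU]].
  assert (Hz0 := Cmod_ge_0 z0).
  set (K := L ^ 2 * exp ((Cmod z0 + 3 * r) * L) * U).
  assert (HK : 0 <= K).
  { unfold K. apply Rmult_le_pos; [|exact HU0].
    apply Rmult_le_pos; [apply pow2_ge_0 | apply Rlt_le, exp_pos]. }
  assert (Hdc : forall w t, a <= t <= b -> contC (fun t => (RtoC (l t) * Cexp (w * RtoC (l t)) * u t)%C) t).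
  { intros w t Ht. assert (contC (fun t => RtoC (l t)) t) by (apply contC_RtoC, Hl, Ht).
    apply contC_mult; [|apply Hu, Ht]. apply contC_mult; [assumption|].
    apply contC_Cexp, contC_mult; [apply contC_const | assumption]. }
  exists (fun z => IntC (fun t => (RtoC (l t) * Cexp (z * RtoC (l t)) * u t)%C) a b), ((b - a) * K).
  split; [apply Rmult_le_pos; lra|]. intros w v Hw Hv.
  assert (I : intC (fun t => (Cexp (v * RtoC (l t)) * u t - Cexp (w * RtoC (l t)) * u t -
     (v - w) * (RtoC (l t) * Cexp (w * RtoC (l t)) * u t))%C) a b
     (F v - F w - (v - w) * IntC (fun t => (RtoC (l t) * Cexp (w * RtoC (l t)) * u t)%C) a b)%C).
  { apply intC_minus; [apply intC_minus; apply HF; assumption|].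
    apply intC_mult_l, intC_cont. intros t Ht. apply Hdc.
    rewrite Rmin_left, Rmax_right in Ht by exact Hab. exact Ht. }
  rewrite Rmult_assoc. apply (intC_bound_const _ _ _ _ _ Hab) with (2 := I).
  intros t Ht.
  replace (_ - _)%C with ((Cexp (v * RtoC (l t)) - Cexp (w * RtoC (l t)) - (v - w) * (RtoC (l t) * Cexp (w * RtoC (l t)))) * u t)%C by ring.
  rewrite Cmod_mult.
  assert (A := Cexp_linear_quadratic (RtoC (l t)) w v z0 r Hw Hv).
  eapply Rle_trans.
  { apply Rmult_le_compat; [apply Cmod_ge_0 | apply Cmod_ge_0 | exact A | apply HU, Ht]. }
  unfold K. assert (Hlt := HL t Ht). assert (Hlt0 := Cmod_ge_0 (RtoC (l t))).
  replace (L ^ 2 * exp ((Cmod z0 + 3 * r) * L) * U * Cmod (v - w) ^ 2)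
    with (L ^ 2 * exp ((Cmod z0 + 3 * r) * L) * Cmod (v - w) ^ 2 * U) by ring.
  apply Rmult_le_compat_r; [exact HU0|]. apply Rmult_le_compat_r; [apply pow2_ge_0|].
  apply Rmult_le_compat; [apply pow2_ge_0 | apply Rlt_le, exp_pos | apply pow_incr; lra|].
  apply exp_le, Rmult_le_compat_l; lra.
Qed.

(** Such a function has derivative 0. Clamping the argument to [0, 1] extends it to the line and
    preserves the bound, so the endpoints need no one-sided derivatives. *)
Lemma quadratic_variation_const (phi : R -> C) (K : R) :
  (forall x y, 0 <= x <= 1 -> 0 <= y <= 1 -> Cmod (phi y - phi x) <= K * (y - x) ^ 2) ->
  phi 0 = phi 1.
Proof.
  intros H. set (cl := fun x => Rmax 0 (Rmin 1 x)).
  assert (Hcl : forall x, 0 <= cl x <= 1).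
  { intros x. unfold cl. split; [apply Rmax_l|]. apply Rmax_lub; [lra | apply Rmin_l]. }
  assert (Hlip : forall x y, (cl y - cl x) ^ 2 <= (y - x) ^ 2).
  { intros x y. rewrite <- !Rsqr_pow2. apply Rsqr_le_abs_1. unfold cl, Rmax, Rmin.
    repeat destruct Rle_dec; unfold Rabs; repeat destruct Rcase_abs; lra. }
  assert (HK : 0 <= K).
  { assert (T := H 0 1 ltac:(lra) ltac:(lra)). assert (T2 := Cmod_ge_0 (phi 1 - phi 0)%C). lra. }
  replace (phi 0) with (phi (cl 0)) by (f_equal; unfold cl; rewrite Rmin_right, Rmax_left; lra).
  replace (phi 1) with (phi (cl 1)) by (f_equal; unfold cl; rewrite Rmin_right, Rmax_right; lra).
  apply (derivC_zero_const (fun x => phi (cl x))); [|lra].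
  intros t _. apply derivC_of_quadratic with K 1; [lra|].
  intros h _. replace (_ - _ - _)%C with (phi (cl (t + h)%R) - phi (cl t))%C by ring.
  eapply Rle_trans; [apply H; apply Hcl|].
  apply Rmult_le_compat_l; [exact HK|].
  replace (h ^ 2) with ((t + h - t) ^ 2) by ring. apply Hlip.
Qed.

(** The chain rule along a curve. The witnesses of [QH] are exposed rather than packed, so that
    callers can go on using the same [f']. *)
Lemma derivC_comp_QH (f f' : C -> C) (z0 : C) (r K : R) (g : R -> C) (t : R) (dg : C) :
  (forall w v : C, Cmod (w - z0) < r -> Cmod (v - z0) < r ->
      Cmod (f v - f w - (v - w) * f' w) <= K * Cmod (v - w) ^ 2) ->
  0 <= K -> Cmod (g t - z0) < r -> derivC g t dg ->
  derivC (fun x => f (g x)) t (dg * f' (g t))%C.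
Proof.
  intros H HK Hin Hg. apply derivC_eps. intros eps He.
  assert (Hg' := proj1 (derivC_eps g t dg) Hg).
  set (M := Cmod dg + 1). assert (HM : 0 < M) by (unfold M; assert (T := Cmod_ge_0 dg); lra).
  set (B := Cmod (f' (g t)) + 1). assert (HB : 0 < B) by (unfold B; assert (T := Cmod_ge_0 (f' (g t))); lra).
  destruct (Hg' 1 ltac:(lra)) as [d1 [Hd1 H1]].
  destruct (Hg' (eps / 2 / B)) as [d2 [Hd2 H2]]; [apply Rdiv_lt_0_compat; lra|].
  destruct (proj1 (contC_eps g t) (derivC_cont _ _ _ Hg) (r - Cmod (g t - z0))) as [d3 [Hd3 H3]]; [lra|].
  set (d4 := eps / 2 / ((K + 1) * M ^ 2)).
  assert (HKM : 0 < (K + 1) * M ^ 2) by (apply Rmult_lt_0_compat; [lra | apply pow_lt; lra]).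
  assert (Hd4 : 0 < d4) by (unfold d4; apply Rdiv_lt_0_compat; lra).
  exists (Rmin (Rmin d1 d2) (Rmin d3 d4)). split; [repeat apply Rmin_pos; assumption|].
  intros h Hh.
  assert (h1 : Rabs h < d1) by (eapply Rlt_le_trans; [exact Hh|]; eapply Rle_trans; [apply Rmin_l | apply Rmin_l]).
  assert (h2 : Rabs h < d2) by (eapply Rlt_le_trans; [exact Hh|]; eapply Rle_trans; [apply Rmin_l | apply Rmin_r]).
  assert (h3 : Rabs h < d3) by (eapply Rlt_le_trans; [exact Hh|]; eapply Rle_trans; [apply Rmin_r | apply Rmin_l]).
  assert (h4 : Rabs h < d4) by (eapply Rlt_le_trans; [exact Hh|]; eapply Rle_trans; [apply Rmin_r | apply Rmin_r]).
  assert (Hin2 : Cmod (g (t + h)%R - z0)%C < r).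
  { assert (T := Cmod_dist_triangle (g (t + h)) (g t) z0).
    specialize (H3 (t + h)). replace (t + h - t) with h in H3 by ring. specialize (H3 h3). lra. }
  replace (f (g (t + h)%R) - f (g t) - h * (dg * f' (g t)))%C with
    ((f (g (t + h)%R) - f (g t) - (g (t + h)%R - g t) * f' (g t)) + (g (t + h)%R - g t - h * dg) * f' (g t))%C by ring.
  eapply Rle_trans; [apply Cmod_triangle|]. rewrite (Cmod_mult _ (f' (g t))).
  assert (E1 := H _ _ Hin Hin2).
  assert (E2 : Cmod (g (t + h)%R - g t)%C <= M * Rabs h).
  { assert (T := Cmod_triangle_inv (g (t + h)%R - g t) (h * dg)%C). rewrite Cmod_mult, Cmod_R in T.
    assert (T1 := H1 h h1). unfold M. lra. }
  assert (E3 := H2 h h2). assert (Hah := Rabs_pos h).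
  assert (E4 : Cmod (g (t + h)%R - g t)%C ^ 2 <= (M * Rabs h) ^ 2) by (apply pow_incr; split; [apply Cmod_ge_0 | exact E2]).
  assert (E5 : K * Cmod (g (t + h)%R - g t)%C ^ 2 <= (K + 1) * (M * Rabs h) ^ 2).
  { apply Rmult_le_compat; try lra. apply pow2_ge_0. }
  assert (E6 : (K + 1) * (M * Rabs h) ^ 2 <= eps / 2 * Rabs h).
  { replace ((K + 1) * (M * Rabs h) ^ 2) with (((K + 1) * M ^ 2 * Rabs h) * Rabs h) by ring.
    apply Rmult_le_compat_r; [exact Hah|].
    apply Rle_trans with ((K + 1) * M ^ 2 * d4); [apply Rmult_le_compat_l; lra|].
    unfold d4. right. field. split; lra. }
  assert (E7 : Cmod (g (t + h)%R - g t - h * dg)%C * Cmod (f' (g t)) <= eps / 2 * Rabs h).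
  { apply Rle_trans with ((eps / 2 / B * Rabs h) * B).
    - apply Rmult_le_compat; [apply Cmod_ge_0 | apply Cmod_ge_0 | exact E3 | unfold B; lra].
    - right. field. lra. }
  lra.
Qed.

(** * Integrals over circles *)

Definition circ (r t : R) : C := (RtoC r * Cexp (Ci * RtoC t))%C.

Lemma Cmod_circ (r t : R) : 0 <= r -> Cmod (circ r t) = r.
Proof.
  intros H. unfold circ. rewrite Cmod_mult, Cmod_R, Cmod_Cexp_Ci, Rabs_pos_eq by exact H. ring.
Qed.

Lemma derivC_circ (r t : R) : derivC (circ r) t (Ci * circ r t)%C.
Proof.
  unfold circ. eapply derivC_eq.
  - apply derivC_mult; [apply derivC_const|]. apply derivC_Cexp, derivC_mult; [apply derivC_const|].
    apply derivC_RtoC, (is_derive_id (K := R_AbsRing)).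
  - unfold one; simpl. ring.
Qed.

Lemma contC_circ (r t : R) : contC (circ r) t.
Proof. eapply derivC_cont, derivC_circ. Qed.

Lemma circ_0_2PI (r : R) : circ r 0 = circ r (2 * PI).
Proof.
  unfold circ. rewrite !Cexp_Ci. rewrite cos_2PI, sin_2PI, cos_0, sin_0. reflexivity.
Qed.

Lemma contC_inv (f : R -> C) (x : R) : f x <> 0%C -> contC f x -> contC (fun t => (/ f t)%C) x.
Proof.
  intros Hn Hf.
  assert (HN : continuous (fun t => / (fst (f t) ^ 2 + snd (f t) ^ 2)) x).
  { apply continuous_Rinv_comp.
    - apply (continuous_plus (V := R_NormedModule)); simpl;
      repeat apply (continuous_mult (K := R_AbsRing)); try apply continuous_const;
      (apply contC_Re || apply contC_Im); exact Hf.
    - intros E. assert (T := pow2_ge_0 (fst (f x))). assert (T2 := pow2_ge_0 (snd (f x))).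
      apply Hn, C_eq; unfold Re, Im; simpl; nra. }
  apply contC_pair; apply (continuous_mult (K := R_AbsRing)); try exact HN.
  - apply contC_Re, Hf.
  - apply (continuous_opp (V := R_NormedModule)), contC_Im, Hf.
Qed.

Lemma circ_minus_lower (r t : R) (W : C) : 0 <= r -> r - Cmod W <= Cmod (circ r t - W).
Proof. intros H. assert (T := Cmod_triangle_inv (circ r t) W). rewrite Cmod_circ in T by exact H. lra. Qed.

Lemma circ_minus_neq_0 (r t : R) (W : C) : 0 <= r -> Cmod W < r -> (circ r t - W)%C <> 0%C.
Proof.
  intros Hr HW E. assert (T := circ_minus_lower r t W Hr). rewrite E, Cmod_0 in T. lra.
Qed.

Lemma derivC_inv_circ (r t : R) (W : C) : 0 <= r -> Cmod W < r ->
  derivC (fun t => / (circ r t - W))%C t (- (Ci * circ r t) / ((circ r t - W) * (circ r t - W)))%C.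
Proof.
  intros Hr HW.
  assert (Hn := circ_minus_neq_0 r t W Hr HW).
  assert (Hlo := circ_minus_lower r t W Hr).
  set (d := Cmod (circ r t - W) / 2).
  assert (Hd : d < Cmod (circ r t - W)) by (unfold d; lra).
  eapply derivC_eq.
  - apply (derivC_comp_QH (fun z => / (z - W))%C (fun z => - / ((z - W) * (z - W)))%C (circ r t) d
      (/ (Cmod (circ r t - W) - d) ^ 3) (circ r) t (Ci * circ r t)%C).
    + intros w v Hw Hv. apply Cinv_quadratic; assumption.
    + apply Rlt_le, Rinv_0_lt_compat, pow_lt; lra.
    + rewrite Cmod_minus_diag. unfold d; lra.
    + apply derivC_circ.
  - field. exact Hn.
Qed.

(** Cauchy's formula for the constant 1. Moving the pole from [W] to 0 through the points m W does
    not change the integral: its derivative in m is W times the integral of u / (u - m W)^2, an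
    exact derivative on a closed curve. At m = 0 the kernel is 1. *)
Lemma intC_circ_kernel (r : R) (W : C) : 0 < r -> Cmod W < r ->
  intC (fun t => circ r t / (circ r t - W))%C 0 (2 * PI) (RtoC (2 * PI)).
Proof.
  intros Hr HW. assert (Hpi : 0 <= 2 * PI) by (assert (T := PI_RGT_0); lra).
  assert (HmW : forall m, 0 <= m <= 1 -> Cmod (RtoC m * W) <= Cmod W).
  { intros m Hm. rewrite Cmod_mult, Cmod_R, Rabs_pos_eq by lra. assert (T := Cmod_ge_0 W). nra. }
  assert (Hn : forall m t, 0 <= m <= 1 -> (circ r t - RtoC m * W)%C <> 0%C).
  { intros m t Hm. apply circ_minus_neq_0; [lra|]. assert (T := HmW m Hm). lra. }
  assert (Hc : forall m t, 0 <= m <= 1 -> contC (fun t => / (circ r t - RtoC m * W))%C t).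
  { intros m t Hm. apply contC_inv; [apply Hn, Hm|]. apply contC_minus; [apply contC_circ | apply contC_const]. }
  set (J := fun m : R => IntC (fun t => circ r t / (circ r t - RtoC m * W))%C 0 (2 * PI)).
  assert (HJ : forall m, 0 <= m <= 1 -> intC (fun t => circ r t / (circ r t - RtoC m * W))%C 0 (2 * PI) (J m)).
  { intros m Hm. apply intC_cont. intros t _. apply contC_mult; [apply contC_circ | apply Hc, Hm]. }
  assert (HZ : forall m, 0 <= m <= 1 ->
    intC (fun t => circ r t / ((circ r t - RtoC m * W) * (circ r t - RtoC m * W)))%C 0 (2 * PI) (RtoC 0)).
  { intros m Hm.
    assert (I := intC_derive (fun t => / (circ r t - RtoC m * W))%C
      (fun t => - (Ci * circ r t) / ((circ r t - RtoC m * W) * (circ r t - RtoC m * W)))%C 0 (2 * PI)).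
    assert (I' := fun A B => intC_mult_l Ci _ _ _ _ (I A B)). clear I.
    eapply intC_eq; [eapply intC_ext; [|apply I']|].
    - intros t _. simpl. replace (Ci * (- (Ci * circ r t) / ((circ r t - m * W) * (circ r t - m * W))))%C
       with ((- (Ci * Ci)) * (circ r t / ((circ r t - m * W) * (circ r t - m * W))))%C by (field; apply Hn, Hm).
      replace (- (Ci * Ci))%C with (RtoC 1) by Cparts. ring.
    - intros t _. apply derivC_inv_circ; [lra|]. assert (T := HmW m Hm). lra.
    - intros t _. apply contC_mult.
      + apply contC_opp, contC_mult; [apply contC_const | apply contC_circ].
      + apply contC_inv; [apply Cmult_neq_0; apply Hn, Hm|].
        apply contC_mult; (apply contC_minus; [apply contC_circ | apply contC_const]).
    - rewrite circ_0_2PI. ring. }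
  set (d := r - Cmod W).
  assert (Hlo : forall m t, 0 <= m <= 1 -> d <= Cmod (circ r t - RtoC m * W)).
  { intros m t Hm. assert (T := circ_minus_lower r t (RtoC m * W)%C). assert (T2 := HmW m Hm). unfold d; lra. }
  assert (Hd : 0 < d) by (unfold d; lra).
  assert (HJ01 : J 0 = J 1).
  (* The remainder beyond the vanishing linear term is u W^2 (y - x)^2 / ((u - y W) (u - x W)^2),
     and each denominator factor is at least [d]. *)
  { apply quadratic_variation_const with ((2 * PI - 0) * (r * Cmod W ^ 2 * / d ^ 3)).
    intros x y Hx Hy.
    assert (I := intC_minus _ _ _ _ _ _ (intC_minus _ _ _ _ _ _ (HJ y Hy) (HJ x Hx))
      (intC_mult_l (RtoC (y - x) * W)%C _ _ _ _ (HZ x Hx))).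
    replace (J y - J x)%C with (J y - J x - (y - x)%R * W * 0)%C by ring.
    rewrite Rmult_assoc. apply (intC_bound_const _ _ _ _ _ Hpi) with (2 := I).
    intros t _. assert (N1 := Hn x t Hx). assert (N2 := Hn y t Hy).
    replace (_ - _)%C with (circ r t * (W * W) * RtoC ((y - x) * (y - x)) * / ((circ r t - y * W) * ((circ r t - x * W) * (circ r t - x * W))))%C.
    2:{ rewrite RtoC_mult, RtoC_minus. field. split; assumption. }
    assert (N3 : ((circ r t - x * W) * (circ r t - x * W))%C <> 0%C) by (apply Cmult_neq_0; assumption).
    assert (N4 : ((circ r t - y * W) * ((circ r t - x * W) * (circ r t - x * W)))%C <> 0%C) by (apply Cmult_neq_0; assumption).
    rewrite Cmod_mult, Cmod_inv by exact N4. rewrite !Cmod_mult, Cmod_R, Cmod_circ by lra.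
    rewrite Rabs_pos_eq by apply Rle_0_sqr.
    replace (r * Cmod W ^ 2 * / d ^ 3 * (y - x) ^ 2) with (r * (Cmod W * Cmod W) * ((y - x) * (y - x)) * / d ^ 3) by ring.
    apply Rmult_le_compat_l.
    { apply Rmult_le_pos; [|apply Rle_0_sqr]. apply Rmult_le_pos; [lra | apply Rle_0_sqr]. }
    apply Rinv_le_contravar; [apply pow_lt, Hd|]. replace (d ^ 3) with (d * (d * d)) by ring.
    assert (L1 := Hlo x t Hx). assert (L2 := Hlo y t Hy).
    apply Rmult_le_compat; [lra | nra | exact L2 | apply Rmult_le_compat; lra]. }
  assert (H1 := HJ 1 ltac:(lra)). rewrite <- HJ01 in H1.
  assert (E0 : J 0 = RtoC (2 * PI)).
  { apply (intC_unique _ _ _ _ _ (HJ 0 ltac:(lra))).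
    eapply intC_eq; [eapply intC_ext; [|apply (intC_const 1 0 (2 * PI))]|].
    - intros t _. simpl. assert (T := Hn 0 t ltac:(lra)). replace (circ r t - 0 * W)%C with (circ r t) in * by ring.
      field. exact T.
    - rewrite RtoC_minus. ring. }
  rewrite E0 in H1. eapply intC_ext; [|exact H1].
  intros t _. simpl. rewrite Cmult_1_l. reflexivity.
Qed.

(** * Cauchy's formula *)

(** On the circle z = z0 + u with u = [circ r t] one has dz = i u dt, so the kernel dz / (2 pi i (z
    - z0 - W)) becomes u / (u - W) dt / (2 pi). No derivative of [f] occurs, which is what lets the
    formula survive uniform limits. *)
Definition cauchy_formula (f : C -> C) (z0 : C) (r : R) : Prop :=
  (forall t, contC (fun t => f (z0 + circ r t)%C) t) /\
  (exists M, forall t, Cmod (f (z0 + circ r t)%C) <= M) /\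
  (forall W, Cmod W < r ->
     intC (fun t => f (z0 + circ r t) * (circ r t / (circ r t - W)))%C 0 (2 * PI)
       (RtoC (2 * PI) * f (z0 + W))%C).

Lemma contC_circ_kernel (r t : R) (W : C) : 0 <= r -> Cmod W < r ->
  contC (fun t => circ r t / (circ r t - W))%C t.
Proof.
  intros Hr HW. apply contC_mult; [apply contC_circ|].
  apply contC_inv; [apply circ_minus_neq_0; assumption|].
  apply contC_minus; [apply contC_circ | apply contC_const].
Qed.

(* The integral of f along the circle, shrunk linearly towards w, does not
   depend on the shrinking factor. *)
Lemma QH_cauchy_formula (f : C -> C) (z0 : C) (r r1 : R) :
  0 < r -> r < r1 -> QH f z0 r1 -> cauchy_formula f z0 r.
Proof.
  intros Hr Hr1 Hf. assert (Hpi : 0 <= 2 * PI) by (assert (T := PI_RGT_0); lra).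
  destruct (QH_bounds f z0 r1 ltac:(lra) Hf) as [f' [K [B [HK [HB [F1 [F2 [F3 F4]]]]]]]].
  assert (HL := QH_deriv_Lipschitz f f' z0 r1 K F1).
  assert (Hcirc : forall t, Cmod (z0 + circ r t - z0) < r1).
  { intros t. replace (z0 + circ r t - z0)%C with (circ r t) by ring. rewrite Cmod_circ; lra. }
  assert (Dz : forall (c m : C) t, derivC (fun t => (c + m * circ r t)%C) t (m * (Ci * circ r t))%C).
  { intros c m t. eapply derivC_eq.
    - apply derivC_plus; [apply derivC_const|]. apply derivC_mult; [apply derivC_const | apply derivC_circ].
    - simpl; ring. }
  repeat split.
  - intros t. eapply derivC_cont.
    apply (derivC_comp_QH f f' z0 r1 K (fun t => z0 + circ r t)%C t (1 * (Ci * circ r t))%C F1 HK (Hcirc t)).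
    eapply derivC_ext; [|apply (Dz z0 1%C t)]. intros; simpl. ring.
  - exists B. intros t. apply F3, Hcirc.
  - intros W HW.
    set (z := fun (l t : R) => (z0 + (1 - RtoC l) * W + RtoC l * circ r t)%C).
    assert (Hz : forall l t, 0 <= l <= 1 -> Cmod (z l t - z0) < r1).
    { intros l t Hl. unfold z. 
      replace (z0 + (1 - l) * W + l * circ r t - z0)%C with (RtoC (1 - l) * W + l * circ r t)%C by (rewrite RtoC_minus; ring).
      eapply Rle_lt_trans; [apply Cmod_triangle|]. rewrite !Cmod_mult, !Cmod_R, Cmod_circ, !Rabs_pos_eq by lra.
      assert (T := Cmod_ge_0 W). nra. }
    assert (Dzl : forall l t, derivC (fun t => z l t) t (RtoC l * (Ci * circ r t))%C) by (intros l t; apply Dz).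
    assert (Cf : forall l t, 0 <= l <= 1 -> contC (fun t => f (z l t)) t).
    { intros l t Hl. eapply derivC_cont. apply (derivC_comp_QH f f' z0 r1 K (fun t => z l t) t _ F1 HK (Hz l t Hl) (Dzl l t)). }
    assert (Cf' : forall l t, 0 <= l <= 1 -> contC (fun t => f' (z l t)) t).
    { intros l t Hl. apply contC_eps. intros eps He.
      assert (HK1 : 0 < 2 * K + 1) by lra.
      destruct (proj1 (contC_eps _ t) (derivC_cont _ _ _ (Dzl l t)) (eps / (2 * K + 1)) (Rdiv_lt_0_compat _ _ He HK1)) as [d [Hd H]].
      exists d. split; [exact Hd|]. intros y Hy. specialize (H y Hy).
      eapply Rle_lt_trans; [apply HL; apply Hz; exact Hl|].
      apply Rle_lt_trans with ((2 * K + 1) * Cmod (z l y - z l t)).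
      - apply Rmult_le_compat_r; [apply Cmod_ge_0 | lra].
      - apply Rmult_lt_reg_l with (/ (2 * K + 1)); [apply Rinv_0_lt_compat, HK1|].
        rewrite <- Rmult_assoc, Rinv_l, Rmult_1_l by lra. unfold Rdiv in H. lra. }
    set (phi := fun l : R => IntC (fun t => f (z l t) * (circ r t / (circ r t - W)))%C 0 (2 * PI)).
    assert (Hphi : forall l, 0 <= l <= 1 ->
      intC (fun t => f (z l t) * (circ r t / (circ r t - W)))%C 0 (2 * PI) (phi l)).
    { intros l Hl. apply intC_cont. intros t _. apply contC_mult; [apply Cf, Hl | apply contC_circ_kernel; lra]. }
    (* This is the linear term of the change in [l]: there z_y - z_x = (y - x) (u - W), and u - W
       cancels the denominator of the kernel. For l <> 0 the integrand is the derivative of f along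
       the closed curve divided by i l; at l = 0 the curve is a single point and the integral of
       [circ r] itself vanishes. *)
    assert (HZ : forall l, 0 <= l <= 1 -> intC (fun t => f' (z l t) * circ r t)%C 0 (2 * PI) (RtoC 0)).
    { intros l Hl. destruct (Req_dec l 0) as [->|Hl0].
      - assert (I := intC_derive (circ r) (fun t => Ci * circ r t)%C 0 (2 * PI) (fun t _ => derivC_circ r t)
          (fun t _ => contC_mult _ _ _ (contC_const Ci t) (contC_circ r t))).
        rewrite circ_0_2PI in I.
        apply (intC_mult_l (f' (z0 + W) * (- Ci))%C) in I.
        eapply intC_eq; [eapply intC_ext; [|exact I]|]; [|ring].
        intros t _. unfold z. simpl.
        replace (z0 + (1 - 0) * W + 0 * circ r t)%C with (z0 + W)%C by ring.
        replace (f' (z0 + W) * - Ci * (Ci * circ r t))%C with (f' (z0 + W) * circ r t * (- (Ci * Ci)))%C by ring.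
        replace (- (Ci * Ci))%C with (RtoC 1) by Cparts. ring.
      - assert (Hl0' : RtoC l <> 0%C) by (intros E; apply RtoC_inj in E; contradiction).
        assert (I : intC (fun t => (RtoC l * (Ci * circ r t) * f' (z l t))%C) 0 (2 * PI) (f (z l (2 * PI)%R) - f (z l 0))%C).
        { apply (intC_derive (fun t => f (z l t))).
          - intros t _. apply (derivC_comp_QH f f' z0 r1 K (fun t => z l t) t _ F1 HK (Hz l t Hl) (Dzl l t)).
          - intros t _. apply contC_mult; [|apply Cf', Hl].
            apply contC_mult; [apply contC_const|]. apply contC_mult; [apply contC_const | apply contC_circ]. }
        replace (z l 0) with (z l (2 * PI)) in I by (unfold z; rewrite circ_0_2PI; reflexivity).
        apply (intC_mult_l (- Ci * / RtoC l)%C) in I.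
        eapply intC_eq; [eapply intC_ext; [|exact I]|]; [|ring].
        intros t _. simpl.
        replace (- Ci * / l * (l * (Ci * circ r t) * f' (z l t)))%C with (f' (z l t) * circ r t * (- (Ci * Ci)))%C by (field; exact Hl0').
        replace (- (Ci * Ci))%C with (RtoC 1) by Cparts. ring. }
    assert (H01 : phi 0 = phi 1).
    { apply quadratic_variation_const with ((2 * PI - 0) * (K * r * (2 * r))).
      intros x y Hx Hy.
      assert (I := intC_minus _ _ _ _ _ _ (intC_minus _ _ _ _ _ _ (Hphi y Hy) (Hphi x Hx))
        (intC_mult_l (RtoC (y - x)) _ _ _ _ (HZ x Hx))).
      replace (phi y - phi x)%C with (phi y - phi x - (y - x)%R * 0)%C by ring.
      rewrite Rmult_assoc. apply (intC_bound_const _ _ _ _ _ Hpi) with (2 := I).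
      intros t _. assert (Hn := circ_minus_neq_0 r t W ltac:(lra) HW).
      assert (E : (z y t - z x t)%C = (RtoC (y - x) * (circ r t - W))%C) by (unfold z; rewrite RtoC_minus; ring).
      replace (_ - _)%C with ((f (z y t) - f (z x t) - (z y t - z x t) * f' (z x t)) * (circ r t / (circ r t - W)))%C
        by (rewrite E; field; exact Hn).
      rewrite Cmod_mult, Cmod_div by exact Hn. rewrite Cmod_circ by lra.
      assert (Hp : 0 < Cmod (circ r t - W)) by (apply Cmod_gt_0; exact Hn).
      assert (Q := F1 (z x t) (z y t) (Hz x t Hx) (Hz y t Hy)). replace (Cmod (z y t - z x t)) with (Rabs (y - x) * Cmod (circ r t - W)) in Q by (rewrite E, Cmod_mult, Cmod_R; reflexivity).
      assert (Hup : Cmod (circ r t - W) <= 2 * r).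
      { unfold Cminus. eapply Rle_trans; [apply Cmod_triangle|]. rewrite Cmod_opp, Cmod_circ; lra. }
      apply Rle_trans with (K * (Rabs (y - x) * Cmod (circ r t - W)) ^ 2 * (r / Cmod (circ r t - W))).
      - apply Rmult_le_compat_r; [|exact Q]. apply Rlt_le, Rdiv_lt_0_compat; lra.
      - rewrite Rpow_mult_distr. replace (Rabs (y - x) ^ 2) with ((y - x) ^ 2) by (rewrite RPow_abs, Rabs_pos_eq; [reflexivity | apply pow2_ge_0]).
        replace (K * ((y - x) ^ 2 * Cmod (circ r t - W) ^ 2) * (r / Cmod (circ r t - W)))
          with (K * r * Cmod (circ r t - W) * (y - x) ^ 2) by (field; lra).
        apply Rmult_le_compat_r; [apply pow2_ge_0|]. apply Rmult_le_compat_l; [nra | exact Hup]. }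
    eapply intC_eq; [eapply intC_ext; [|apply (Hphi 1 ltac:(lra))]|].
    + intros t _. unfold z. simpl. f_equal. f_equal. ring.
    + rewrite <- H01. apply (intC_unique _ _ _ _ _ (Hphi 0 ltac:(lra))).
      eapply intC_eq; [eapply intC_ext; [|apply (intC_mult_l (f (z0 + W)%C)), intC_circ_kernel; [exact Hr | exact HW]]|].
      * intros t _. unfold z. simpl. f_equal. f_equal. ring.
      * ring.
Qed.

Lemma cauchy_formula_limit (fn : nat -> C -> C) (f : C -> C) (z0 : C) (r r1 : R) :
  0 < r -> r < r1 -> (forall n, cauchy_formula (fn n) z0 r) ->
  (forall eps, 0 < eps -> exists N, forall n z, (N <= n)%nat -> Cmod (z - z0) < r1 ->
     Cmod (fn n z - f z) < eps) ->
  cauchy_formula f z0 r.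
Proof.
  intros Hr Hr1 Hn Hu. assert (Hpi : 0 <= 2 * PI) by (assert (T := PI_RGT_0); lra).
  assert (Hcirc : forall t, Cmod (z0 + circ r t - z0) < r1).
  { intros t. replace (z0 + circ r t - z0)%C with (circ r t) by ring. rewrite Cmod_circ; lra. }
  repeat split.
  - intros t. apply contC_eps. intros eps He.
    destruct (Hu (eps / 3) ltac:(lra)) as [N HN].
    destruct (proj1 (contC_eps _ t) (proj1 (Hn N) t) (eps / 3) ltac:(lra)) as [d [Hd H]].
    exists d. split; [exact Hd|]. intros y Hy. specialize (H y Hy).
    assert (A1 := HN N _ (le_n N) (Hcirc y)). assert (A2 := HN N _ (le_n N) (Hcirc t)).
    assert (T1 := Cmod_dist_triangle (f (z0 + circ r y)%C) (fn N (z0 + circ r y)%C) (f (z0 + circ r t)%C)).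
    assert (T2 := Cmod_dist_triangle (fn N (z0 + circ r y)%C) (fn N (z0 + circ r t)%C) (f (z0 + circ r t)%C)).
    rewrite Cmod_minus_sym in A1. lra.
  - destruct (Hu 1 ltac:(lra)) as [N HN]. destruct (proj1 (proj2 (Hn N))) as [M HM].
    exists (M + 1). intros t. assert (A1 := HN N _ (le_n N) (Hcirc t)). specialize (HM t).
    rewrite Cmod_minus_sym in A1.
    assert (T := Cmod_triangle_inv (f (z0 + circ r t)%C) (fn N (z0 + circ r t)%C)). lra.
  - intros W HW. set (d := r - Cmod W). assert (Hd : 0 < d) by (unfold d; lra).
    destruct (intC_unif_lim (fun n t => fn n (z0 + circ r t) * (circ r t / (circ r t - W)))%C
      (fun t => f (z0 + circ r t) * (circ r t / (circ r t - W)))%C 0 (2 * PI)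
      (fun n => RtoC (2 * PI) * fn n (z0 + W))%C Hpi) as [I [HI HL]].
    + intros n. apply (proj2 (proj2 (Hn n)) W HW).
    + intros eps He. destruct (Hu (eps * (d / r))) as [N HN].
      { apply Rmult_lt_0_compat; [exact He | apply Rdiv_lt_0_compat; lra]. }
      exists N. intros n t Hnn _. specialize (HN n _ Hnn (Hcirc t)).
      replace (_ - _)%C with ((fn n (z0 + circ r t) - f (z0 + circ r t)) * (circ r t / (circ r t - W)))%C by ring.
      assert (Hne := circ_minus_neq_0 r t W ltac:(lra) HW).
      rewrite Cmod_mult, Cmod_div, Cmod_circ by (exact Hne || lra).
      assert (Hlo := circ_minus_lower r t W ltac:(lra)). fold d in Hlo.
      apply Rle_lt_trans with (Cmod (fn n (z0 + circ r t) - f (z0 + circ r t))%C * (r / d)).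
      * apply Rmult_le_compat_l; [apply Cmod_ge_0|]. apply Rmult_le_compat_l; [lra|].
        apply Rinv_le_contravar; lra.
      * apply Rlt_le_trans with (eps * (d / r) * (r / d)); [|right; field; lra].
        apply Rmult_lt_compat_r; [apply Rdiv_lt_0_compat; lra | exact HN].
    + eapply intC_eq; [exact HI|].
      apply C_eq_eps. intros eps He.
        assert (Hpp : 0 < 2 * PI) by (assert (T := PI_RGT_0); lra).
        destruct (HL (eps / 2) ltac:(lra)) as [N1 H1].
        destruct (Hu (eps / 2 / (2 * PI)) ltac:(apply Rdiv_lt_0_compat; lra)) as [N2 H2].
        specialize (H1 (N1 + N2)%nat ltac:(lia)).
        specialize (H2 (N1 + N2)%nat (z0 + W)%C ltac:(lia)).
        replace (z0 + W - z0)%C with W in H2 by ring. specialize (H2 ltac:(lra)).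
        set (n := (N1 + N2)%nat) in *.
        assert (T := Cmod_dist_triangle I (RtoC (2 * PI) * fn n (z0 + W)%C)%C (RtoC (2 * PI) * f (z0 + W)%C)%C).
        rewrite (Cmod_minus_sym I (RtoC (2 * PI) * fn n (z0 + W))%C) in T.
        replace (RtoC (2 * PI) * fn n (z0 + W) - RtoC (2 * PI) * f (z0 + W))%C
          with (RtoC (2 * PI) * (fn n (z0 + W) - f (z0 + W)))%C in T by ring.
        rewrite Cmod_mult, Cmod_R, Rabs_pos_eq in T by lra.
        assert (2 * PI * Cmod (fn n (z0 + W) - f (z0 + W))%C <= 2 * PI * (eps / 2 / (2 * PI))) by (apply Rmult_le_compat_l; lra).
        replace (2 * PI * (eps / 2 / (2 * PI))) with (eps / 2) in H by (field; lra). lra.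
Qed.

(** Only the kernel depends on the point, so its Taylor remainder u (V - W)^2 / ((u - V) (u - W)^2)
    is inserted under the integral. For [V] and [W] in the ball of half the radius the denominator
    is at least (r / 2)^3, whence the 8 / r^2. *)
Lemma cauchy_formula_QH (f : C -> C) (z0 : C) (r : R) :
  0 < r -> cauchy_formula f z0 r -> QH f z0 (r / 2).
Proof.
  intros Hr [Hc [[M HM] HI]]. assert (Hpi : 0 < 2 * PI) by (assert (T := PI_RGT_0); lra).
  assert (HM0 : 0 <= M) by (eapply Rle_trans; [apply Cmod_ge_0 | apply (HM 0)]).
  assert (Hpi0 : RtoC (2 * PI) <> 0%C) by (intros E; apply RtoC_inj in E; lra).
  exists (fun w => / RtoC (2 * PI) * IntC (fun t => f (z0 + circ r t) * (circ r t / ((circ r t - (w - z0)) * (circ r t - (w - z0)))))%C 0 (2 * PI))%C,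
    (M * 8 / r ^ 2).
  split. { apply Rmult_le_pos; [lra|]. apply Rlt_le, Rinv_0_lt_compat, pow_lt, Hr. }
  intros w v Hw Hv. set (W := (w - z0)%C) in *. set (V := (v - z0)%C) in *.
  assert (NW : forall t, (circ r t - W)%C <> 0%C) by (intros t; apply circ_minus_neq_0; lra).
  assert (NV : forall t, (circ r t - V)%C <> 0%C) by (intros t; apply circ_minus_neq_0; lra).
  assert (I0 : intC (fun t => f (z0 + circ r t) * (circ r t / ((circ r t - W) * (circ r t - W))))%C 0 (2 * PI)
     (IntC (fun t => f (z0 + circ r t) * (circ r t / ((circ r t - W) * (circ r t - W))))%C 0 (2 * PI))).
  { apply intC_cont. intros t _. apply contC_mult; [apply Hc|]. apply contC_mult; [apply contC_circ|].
    apply contC_inv; [apply Cmult_neq_0; apply NW|].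
    apply contC_mult; (apply contC_minus; [apply contC_circ | apply contC_const]). }
  assert (IV := HI V ltac:(lra)). assert (IW := HI W ltac:(lra)).
  assert (I := intC_mult_l (/ RtoC (2 * PI))%C _ _ _ _
    (intC_minus _ _ _ _ _ _ (intC_minus _ _ _ _ _ _ IV IW) (intC_mult_l (v - w)%C _ _ _ _ I0))).
  replace (z0 + V)%C with v in I by (unfold V; ring).
  replace (z0 + W)%C with w in I by (unfold W; ring).
  replace (f v - f w - _)%C with (/ RtoC (2 * PI) * (RtoC (2 * PI) * f v - RtoC (2 * PI) * f w - (v - w) *
     IntC (fun t => f (z0 + circ r t) * (circ r t / ((circ r t - W) * (circ r t - W))))%C 0 (2 * PI)))%C
     by (field; exact Hpi0).
  replace (M * 8 / r ^ 2 * Cmod (v - w) ^ 2) with ((2 * PI - 0) * (/ (2 * PI) * (M * 8 / r ^ 2 * Cmod (v - w) ^ 2)))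
    by (field; lra).
  apply (intC_bound_const _ _ _ _ _ (Rlt_le _ _ Hpi)) with (2 := I).
  intros t _. rewrite Cmod_mult, Cmod_inv by exact Hpi0. rewrite Cmod_R, Rabs_pos_eq by lra.
  apply Rmult_le_compat_l; [apply Rlt_le, Rinv_0_lt_compat, Hpi|].
  replace (v - w)%C with (V - W)%C by (unfold V, W; ring).
  replace (_ - _)%C with (f (z0 + circ r t) * (circ r t * ((V - W) * (V - W)) / ((circ r t - V) * ((circ r t - W) * (circ r t - W)))))%C
    by (field; split; [apply NW | apply NV]).
  rewrite Cmod_mult, Cmod_div by (repeat apply Cmult_neq_0; apply NW || apply NV).
  rewrite !Cmod_mult, Cmod_circ by lra.
  assert (LW := circ_minus_lower r t W ltac:(lra)). assert (LV := circ_minus_lower r t V ltac:(lra)).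
  assert (HD : (r / 2) * ((r / 2) * (r / 2)) <= Cmod (circ r t - V) * (Cmod (circ r t - W) * Cmod (circ r t - W))).
  { apply Rmult_le_compat; [lra | nra | lra | apply Rmult_le_compat; lra]. }
  set (D := Cmod (circ r t - V) * (Cmod (circ r t - W) * Cmod (circ r t - W))) in *.
  set (x := Cmod (V - W)).
  replace (M * 8 / r ^ 2 * x ^ 2) with (M * (r * (x * x) / ((r / 2) * ((r / 2) * (r / 2))))) by (field; lra).
  apply Rmult_le_compat; [apply Cmod_ge_0 | | apply HM |].
  - apply Rmult_le_pos; [apply Rmult_le_pos; [lra | apply Rle_0_sqr]|]. apply Rlt_le, Rinv_0_lt_compat.
    eapply Rlt_le_trans; [|exact HD]. repeat apply Rmult_lt_0_compat; lra.
  - apply Rmult_le_compat_l; [apply Rmult_le_pos; [lra | apply Rle_0_sqr]|].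
    apply Rinv_le_contravar; [repeat apply Rmult_lt_0_compat; lra | exact HD].
Qed.

(** The radius is halved twice: the circle of Cauchy's formula must lie inside the ball, and the
    Taylor bound is recovered only on half of its disc. This is the source of the factors 1 / 4 in
    later radii. *)
Lemma QH_uniform_limit (fn : nat -> C -> C) (f : C -> C) (z0 : C) (r : R) :
  0 < r -> (forall n, QH (fn n) z0 r) ->
  (forall eps, 0 < eps -> exists N, forall n z, (N <= n)%nat -> Cmod (z - z0) < r ->
     Cmod (fn n z - f z) < eps) ->
  QH f z0 (r / 4).
Proof.
  intros Hr Hn Hu. replace (r / 4) with (r / 2 / 2) by field.
  apply cauchy_formula_QH; [lra|].
  apply (cauchy_formula_limit fn f z0 (r / 2) r); [lra | lra | | exact Hu].
  intros n. apply QH_cauchy_formula with r; [lra | lra | apply Hn].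
Qed.

(** * Power series expansions *)

Lemma is_series_C (a : nat -> C) (l : C) :
  is_series (K := C_AbsRing) (V := C_NormedModule) a l <->
  forall eps, 0 < eps -> exists N, forall n, (N <= n)%nat ->
    Cmod (sum_n (G := C_AbelianMonoid) a n - l)%C < eps.
Proof.
  split.
  - intros H eps He. destruct (proj1 (filterlim_C eventually _ l) H eps He) as [N HN].
    exists N. exact HN.
  - intros H. apply (filterlim_C eventually). intros eps He. destruct (H eps He) as [N HN].
    exists N. exact HN.
Qed.

Lemma pow_n_Cpow (z : C) (n : nat) : pow_n (K := C_AbsRing) z n = (z ^ n)%C.
Proof.
  induction n; [reflexivity|]. rewrite Cpow_S, <- IHn. reflexivity.
Qed.

Lemma geometric_kernel (u W : C) (n : nat) : u <> 0%C -> (u - W)%C <> 0%C ->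
  (u / (u - W) - sum_n (G := C_AbelianMonoid) (fun k => (W / u) ^ k) n)%C =
  ((W / u) ^ S n * (u / (u - W)))%C.
Proof.
  intros Hu Hn. induction n.
  - rewrite sum_O. simpl. field. split; assumption.
  - rewrite sum_Sn. change (plus (G := C_AbelianMonoid)) with Cplus.
    replace (u / (u - W) - (sum_n (G := C_AbelianMonoid) (fun k => (W / u) ^ k) n + (W / u) ^ S n))%C
     with ((u / (u - W) - sum_n (G := C_AbelianMonoid) (fun k => (W / u) ^ k) n) - (W / u) ^ S n)%C by ring.
    rewrite IHn. rewrite (Cpow_S (W / u) (S n)). field. split; assumption.
Qed.

(** Cauchy's formula with the kernel u / (u - W) expanded in powers of W / u. On the disc of radius
    p / 2 the ratio is at most 1 / 2 and the kernel at most 2, so the remainder beyond the term of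
    degree n is at most 2 M / 2^(n + 1). *)
Lemma QH_analytic_at (f : C -> C) (z0 : C) (r : R) : 0 < r -> QH f z0 r -> analytic_at f z0.
Proof.
  intros Hr Hf. set (p := r / 2). assert (Hp : 0 < p) by (unfold p; lra).
  destruct (QH_cauchy_formula f z0 p r Hp ltac:(unfold p; lra) Hf) as [Hc [[M HM] HI]].
  assert (Hpi : 0 < 2 * PI) by (assert (T := PI_RGT_0); lra).
  assert (HM0 : 0 <= M) by (eapply Rle_trans; [apply Cmod_ge_0 | apply (HM 0)]).
  assert (Hpi0 : RtoC (2 * PI) <> 0%C) by (intros E; apply RtoC_inj in E; lra).
  assert (Nu : forall t, circ p t <> 0%C).
  { intros t E. assert (T := Cmod_circ p t ltac:(lra)). rewrite E, Cmod_0 in T. lra. }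
  set (a := fun n => IntC (fun t => f (z0 + circ p t) * / (circ p t) ^ n)%C 0 (2 * PI)).
  assert (Cu : forall n t, contC (fun t => (circ p t ^ n)%C) t).
  { intros n t. induction n; [apply contC_const|].
    apply (contC_ext (fun t => (circ p t * circ p t ^ n)%C)); [reflexivity|].
    apply contC_mult; [apply contC_circ | exact IHn]. }
  assert (Ha : forall n, intC (fun t => f (z0 + circ p t) * / (circ p t) ^ n)%C 0 (2 * PI) (a n)).
  { intros n. apply intC_cont. intros t _. apply contC_mult; [apply Hc|].
    apply contC_inv; [apply Cpow_nz, Nu | apply Cu]. }
  exists (fun n => / RtoC (2 * PI) * a n)%C. apply locally_C. exists (p / 2). split; [lra|].
  intros z Hz. set (W := (z - z0)%C) in *.
  assert (NW : forall t, (circ p t - W)%C <> 0%C) by (intros t; apply circ_minus_neq_0; lra).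
  apply is_series_C.
  assert (IW := HI W ltac:(lra)). replace (z0 + W)%C with z in IW by (unfold W; ring).
  assert (IS : forall n, intC (fun t => f (z0 + circ p t) * sum_n (G := C_AbelianMonoid) (fun k => (W / circ p t) ^ k) n)%C 0 (2 * PI)
     (RtoC (2 * PI) * sum_n (G := C_AbelianMonoid) (fun k => scal (K := C_AbsRing) (V := C_NormedModule) (pow_n W k) (/ RtoC (2 * PI) * a k)%C) n)%C).
  { assert (IT : forall k, intC (fun t => f (z0 + circ p t) * (W / circ p t) ^ k)%C 0 (2 * PI)
      (RtoC (2 * PI) * (W ^ k * (/ RtoC (2 * PI) * a k)))%C).
    { intros k. eapply intC_eq; [eapply intC_ext; [|apply (intC_mult_l (W ^ k)%C), (Ha k)]|].
      - intros t _. simpl. unfold Cdiv. rewrite Cpow_mult_l, Cpow_inv by apply Nu. ring.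
      - field. exact Hpi0. }
    induction n.
    - rewrite sum_O. rewrite pow_n_Cpow. eapply intC_ext; [|apply (IT 0%nat)].
      intros t _. rewrite sum_O. reflexivity.
    - rewrite sum_Sn. eapply intC_eq; [eapply intC_ext; [|apply intC_plus; [exact IHn | apply (IT (S n))]]|].
      + intros t _. simpl. rewrite sum_Sn. change (plus (G := C_AbelianMonoid)) with Cplus. simpl. ring.
      + rewrite <- (pow_n_Cpow W (S n)). symmetry.
        apply Cmult_plus_distr_l. }
  assert (Hmain : forall n, Cmod (sum_n (G := C_AbelianMonoid) (fun k => scal (K := C_AbsRing) (V := C_NormedModule) (pow_n W k) (/ RtoC (2 * PI) * a k)%C) n - f z)%C
     <= (/ 2) ^ S n * (M * 2)).
  { intros n. set (Sn := sum_n (G := C_AbelianMonoid) _ n).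
    assert (I := intC_mult_l (/ RtoC (2 * PI))%C _ _ _ _ (intC_minus _ _ _ _ _ _ IW (IS n))).
    fold Sn in I. rewrite Cmod_minus_sym.
    replace (f z - Sn)%C with (/ RtoC (2 * PI) * (RtoC (2 * PI) * f z - RtoC (2 * PI) * Sn))%C by (field; exact Hpi0).
    replace ((/ 2) ^ S n * (M * 2)) with ((2 * PI - 0) * (/ (2 * PI) * (M * ((/ 2) ^ S n * 2)))) by (field; lra).
    apply (intC_bound_const _ _ _ _ _ (Rlt_le _ _ Hpi)) with (2 := I).
    intros t _. rewrite Cmod_mult, Cmod_inv by exact Hpi0. rewrite Cmod_R, Rabs_pos_eq by lra.
    apply Rmult_le_compat_l; [apply Rlt_le, Rinv_0_lt_compat, Hpi|].
    replace (_ - _)%C with (f (z0 + circ p t) * (circ p t / (circ p t - W) - sum_n (G := C_AbelianMonoid) (fun k => (W / circ p t) ^ k) n))%C by ring.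
    rewrite geometric_kernel by (apply Nu || apply NW).
    rewrite !Cmod_mult, Cmod_pow, !Cmod_div, Cmod_circ by (apply Nu || apply NW || lra).
    apply Rmult_le_compat; [apply Cmod_ge_0 | | apply HM |].
    { apply Rmult_le_pos; [apply pow_le|]; apply Rmult_le_pos; try apply Cmod_ge_0; try lra;
      apply Rlt_le, Rinv_0_lt_compat; [lra | apply Cmod_gt_0, NW]. }
    apply Rmult_le_compat.
    - apply pow_le, Rmult_le_pos; [apply Cmod_ge_0 | apply Rlt_le, Rinv_0_lt_compat; lra].
    - apply Rmult_le_pos; [lra | apply Rlt_le, Rinv_0_lt_compat, Cmod_gt_0, NW].
    - apply pow_incr. split; [apply Rmult_le_pos; [apply Cmod_ge_0 | apply Rlt_le, Rinv_0_lt_compat; lra]|].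
      apply Rmult_le_reg_r with p; [lra|]. unfold Rdiv. rewrite Rmult_assoc, Rinv_l; lra.
    - assert (L := circ_minus_lower p t W ltac:(lra)).
      apply Rmult_le_reg_r with (Cmod (circ p t - W)); [apply Cmod_gt_0, NW|].
      unfold Rdiv. rewrite Rmult_assoc, Rinv_l by (apply Rgt_not_eq, Cmod_gt_0, NW). lra. }
  intros eps He.
  destruct (pow_lt_1_zero (/ 2) ltac:(rewrite Rabs_pos_eq; lra) (eps / (M * 2 + 1)) ltac:(apply Rdiv_lt_0_compat; lra)) as [N HN].
  exists N. intros n Hnn. eapply Rle_lt_trans; [apply Hmain|].
  specialize (HN (S n) ltac:(lia)). rewrite Rabs_pos_eq in HN by (apply pow_le; lra).
  apply Rle_lt_trans with ((/ 2) ^ S n * (M * 2 + 1)).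
  - apply Rmult_le_compat_l; [apply pow_le|]; lra.
  - apply Rlt_le_trans with (eps / (M * 2 + 1) * (M * 2 + 1)); [apply Rmult_lt_compat_r; lra | right; field; lra].
Qed.

(** * The identity theorem in a vertical strip *)

Lemma Cminus_0_r (z : C) : (z - 0)%C = z.
Proof. ring. Qed.

Lemma finite_bound (a : nat -> R) (N : nat) : exists B, 0 <= B /\ forall n, (n <= N)%nat -> a n <= B.
Proof.
  induction N as [|N [B [HB H]]].
  - exists (Rmax 0 (a 0%nat)). split; [apply Rmax_l|]. intros n Hn.
    replace n with 0%nat by lia. apply Rmax_r.
  - exists (Rmax B (a (S N))). split; [eapply Rle_trans; [exact HB | apply Rmax_l]|].
    intros n Hn. destruct (Nat.eq_dec n (S N)) as [->|Hne]; [apply Rmax_r|].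
    eapply Rle_trans; [apply H; lia | apply Rmax_l].
Qed.

Lemma is_series_C_term_bounded (a : nat -> C) (l : C) :
  is_series (K := C_AbsRing) (V := C_NormedModule) a l ->
  exists M, 0 <= M /\ forall n, Cmod (a n) <= M.
Proof.
  intros H. destruct (proj1 (is_series_C a l) H 1 ltac:(lra)) as [N HN].
  destruct (finite_bound (fun n => Cmod (a n)) N) as [B [HB HBn]].
  exists (B + 2). split; [lra|]. intros n.
  destruct (Nat.le_gt_cases n N) as [Hn|Hn]; [specialize (HBn n Hn); lra|].
  destruct n as [|n]; [lia|].
  assert (T1 := HN n ltac:(lia)). assert (T2 := HN (S n) ltac:(lia)).
  rewrite sum_Sn in T2. change (plus (G := C_AbelianMonoid)) with Cplus in T2.
  set (s := sum_n (G := C_AbelianMonoid) a n) in *.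
  assert (T := Cmod_triangle (s + a (S n) - l) (- (s - l))%C). rewrite Cmod_opp in T.
  replace (s + a (S n) - l + - (s - l))%C with (a (S n)) in T by ring. lra.
Qed.

Lemma is_pseries_C (a : nat -> C) (W l : C) :
  is_pseries (K := C_AbsRing) (V := C_NormedModule) a W l <->
  is_series (K := C_AbsRing) (V := C_NormedModule) (fun n => W ^ n * a n)%C l.
Proof.
  assert (E : forall n, scal (K := C_AbsRing) (V := C_NormedModule) (pow_n W n) (a n) = (W ^ n * a n)%C).
  { intros n. rewrite <- (pow_n_Cpow W n). reflexivity. }
  split; apply is_series_ext; intros n; [|symmetry]; apply E.
Qed.

(** If the coefficients before a_n vanish, then at a zero w = c + W the term a_n W^n is cancelled by
    the tail, which is O(|W|^(n + 1)). Dividing by |W|^n and letting w tend to c through zeros gives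
    a_n = 0. *)
Lemma analytic_at_zeros (f : C -> C) (c : C) :
  analytic_at f c ->
  (forall eps, 0 < eps -> exists w, w <> c /\ Cmod (w - c) < eps /\ f w = 0%C) ->
  exists d, 0 < d /\ forall w, Cmod (w - c) < d -> f w = 0%C.
Proof.
  intros [a Ha] Hz. apply locally_C in Ha. destruct Ha as [d [Hd Ha]].
  exists d. split; [exact Hd|].
  set (p := d / 2). assert (Hp : 0 < p) by (unfold p; lra).
  (* Convergence at the single point c + p bounds |a_k| p^k, and this growth estimate gives a
     geometric majorant on smaller discs. *)
  assert (Hs := Ha (c + RtoC p)%C). replace (c + p - c)%C with (RtoC p) in Hs by ring.
  rewrite Cmod_R, Rabs_pos_eq in Hs by lra. specialize (Hs ltac:(unfold p; lra)).
  apply is_pseries_C, is_series_C_term_bounded in Hs. destruct Hs as [M [HM HMn]].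
  assert (Hterm : forall W k, Cmod (W ^ k * a k) <= M * (Cmod W / p) ^ k).
  { intros W k. specialize (HMn k). rewrite Cmod_mult, Cmod_pow in *.
    rewrite Cmod_R, Rabs_pos_eq in HMn by lra.
    assert (Hpk : 0 < p ^ k) by (apply pow_lt, Hp).
    unfold Rdiv. rewrite Rpow_mult_distr, pow_inv.
    apply Rmult_le_reg_r with (p ^ k); [exact Hpk|].
    replace (M * (Cmod W ^ k * / p ^ k) * p ^ k) with (Cmod W ^ k * M) by (field; lra).
    replace (Cmod W ^ k * Cmod (a k) * p ^ k) with (Cmod W ^ k * (p ^ k * Cmod (a k))) by ring.
    apply Rmult_le_compat_l; [apply pow_le, Cmod_ge_0 | exact HMn]. }
  assert (Ha0 : forall n, a n = 0%C).
  { intros n. induction n as [n IH] using (well_founded_induction Wf_nat.lt_wf).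
    assert (Hest : forall w, Cmod (w - c) <= p / 2 -> f w = 0%C ->
      Cmod ((w - c) ^ n * a n) <= 2 * M * (Cmod (w - c) / p) ^ S n).
    { intros w Hw Hf0. set (W := (w - c)%C) in *. set (q := Cmod W / p).
      assert (Hq : 0 <= q <= / 2).
      { unfold q. split; [apply Rmult_le_pos; [apply Cmod_ge_0 | apply Rlt_le, Rinv_0_lt_compat, Hp]|].
        apply Rmult_le_reg_r with p; [exact Hp|]. unfold Rdiv. rewrite Rmult_assoc, Rinv_l; lra. }
      (* As q <= 1 / 2, the terms after degree n are at most M q^(n + 1) times 1, 1/2, 1/4 and so
         on; the partial sums of the latter are written as 2 (1 - (1/2)^j) for the induction. *)
      assert (Hsum : forall j, Cmod (sum_n (G := C_AbelianMonoid) (fun k => W ^ k * a k)%C (n + j) - W ^ n * a n)%C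
         <= 2 * M * q ^ S n * (1 - (/ 2) ^ j)).
      { assert (H0 : sum_n (G := C_AbelianMonoid) (fun k => W ^ k * a k)%C n = (W ^ n * a n)%C).
        { assert (Hlow : forall m, (m <= n)%nat -> sum_n (G := C_AbelianMonoid) (fun k => W ^ k * a k)%C m = if Nat.eq_dec m n then (W ^ n * a n)%C else RtoC 0).
          { induction m as [|m IHm]; intros Hm.
            - rewrite sum_O. destruct (Nat.eq_dec 0 n) as [<-|]; [reflexivity|]. rewrite (IH 0%nat) by lia. apply Cmult_0_r.
            - rewrite sum_Sn, IHm by lia. destruct (Nat.eq_dec m n); [lia|].
              change (plus (G := C_AbelianMonoid)) with Cplus.
              destruct (Nat.eq_dec (S m) n) as [<-|]; [apply Cplus_0_l|]. rewrite (IH (S m)) by lia. rewrite Cmult_0_r. apply Cplus_0_l. }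
          rewrite Hlow by lia. destruct (Nat.eq_dec n n); [reflexivity | lia]. }
        induction j.
        - rewrite Nat.add_0_r, H0. rewrite Cmod_minus_diag. simpl; lra.
        - rewrite Nat.add_succ_r, sum_Sn. change (plus (G := C_AbelianMonoid)) with Cplus.
          replace (_ - _)%C with ((sum_n (G := C_AbelianMonoid) (fun k => W ^ k * a k)%C (n + j) - W ^ n * a n) + W ^ S (n + j) * a (S (n + j)))%C by ring.
          eapply Rle_trans; [apply Cmod_triangle|].
          assert (T := Hterm W (S (n + j))). fold q in T.
          replace (S (n + j)) with (S n + j)%nat in T at 3 by lia. rewrite pow_add in T.
          assert (Hqj : q ^ j <= (/ 2) ^ j) by (apply pow_incr; lra).
          assert (Hqn : 0 <= M * q ^ S n) by (apply Rmult_le_pos; [exact HM | apply pow_le; lra]).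
          assert (M * q ^ S n * q ^ j <= M * q ^ S n * (/ 2) ^ j) by (apply Rmult_le_compat_l; assumption).
          replace ((/ 2) ^ S j) with (/ 2 * (/ 2) ^ j) by reflexivity.
          replace (2 * M * q ^ S n * (1 - / 2 * (/ 2) ^ j)) with (2 * M * q ^ S n * (1 - (/ 2) ^ j) + M * q ^ S n * (/ 2) ^ j) by field.
          lra. }
      apply le_epsilon. intros eps He.
      assert (Hser := Ha w). fold W in Hser. specialize (Hser ltac:(unfold p in *; lra)). rewrite Hf0 in Hser.
      apply is_pseries_C in Hser. destruct (proj1 (is_series_C _ _) Hser eps He) as [N HN].
      specialize (HN (n + N)%nat ltac:(lia)). specialize (Hsum N).
      set (s := sum_n (G := C_AbelianMonoid) _ _) in *.
      rewrite (Cminus_0_r s) in HN.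
      assert (T := Cmod_triangle_inv (W ^ n * a n)%C s). rewrite Cmod_minus_sym in T.
      assert (0 <= 2 * M * q ^ S n * (/ 2) ^ N).
      { apply Rmult_le_pos; [apply Rmult_le_pos; [lra | apply pow_le; lra] | apply pow_le; lra]. }
      lra. }
    apply Cmod_small_eq_0. intros eps He.
    set (B := 2 * M / p ^ S n). assert (Hpn : 0 < p ^ S n) by (apply pow_lt, Hp).
    assert (HB : 0 <= B) by (unfold B; apply Rmult_le_pos; [lra | apply Rlt_le, Rinv_0_lt_compat, Hpn]).
    destruct (Hz (Rmin (p / 2) (eps / (B + 1)))) as [w [Hwc [Hw Hf0]]].
    { apply Rmin_pos; [lra | apply Rdiv_lt_0_compat; lra]. }
    assert (T := Hest w ltac:(apply Rlt_le; eapply Rlt_le_trans; [exact Hw | apply Rmin_l]) Hf0).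
    assert (HW : 0 < Cmod (w - c)).
    { apply Cmod_gt_0. intros E. apply Hwc. replace w with (w - c + c)%C by ring. rewrite E. ring. }
    assert (Hw2 := Rlt_le_trans _ _ _ Hw (Rmin_r _ _)).
    set (x := Cmod (w - c)) in *. rewrite Cmod_mult, Cmod_pow in T. fold x in T.
    apply Rle_trans with (B * x).
    - apply Rmult_le_reg_l with (x ^ n); [apply pow_lt, HW|].
      eapply Rle_trans; [exact T|]. right. unfold B, Rdiv. rewrite Rpow_mult_distr, pow_inv. simpl. field.
      split; [apply pow_nonzero|]; lra.
    - apply Rle_trans with ((B + 1) * (eps / (B + 1))); [apply Rmult_le_compat; lra | right; field; lra]. }
  intros w Hw. apply Cmod_small_eq_0. intros eps He.
  assert (Hser := Ha w Hw). apply is_pseries_C in Hser.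
  destruct (proj1 (is_series_C _ _) Hser eps He) as [N HN]. specialize (HN N (le_n N)).
  replace (sum_n (G := C_AbelianMonoid) _ N) with (RtoC 0) in HN.
  - rewrite Cmod_minus_sym in HN. rewrite Cminus_0_r in HN. lra.
  - clear HN. induction N; [rewrite sum_O | rewrite sum_Sn, <- IHN]; rewrite Ha0;
      change (plus (G := C_AbelianMonoid)) with Cplus; rewrite Cmult_0_r; [reflexivity | symmetry; apply Cplus_0_l].
Qed.

Definition zero_near (f : C -> C) (z : C) : Prop :=
  exists d, 0 < d /\ forall w, Cmod (w - z) < d -> f w = 0%C.

(** Let T be the supremum of the parameters up to which [f] vanishes locally. Zeros accumulate at T,
    so [f] vanishes near T as well by [analytic_at_zeros]; if T < 1, this neighbourhood reaches
    beyond T, a contradiction. *)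
Lemma zero_near_segment (f : C -> C) (z e : C) :
  (forall t, 0 <= t <= 1 -> analytic_at f (z + RtoC t * e)%C) ->
  zero_near f z -> zero_near f (z + e)%C.
Proof.
  intros Han H0.
  destruct (classic (e = 0%C)) as [->|He].
  { replace (z + 0)%C with z by ring. exact H0. }
  assert (Hep : 0 < Cmod e) by (apply Cmod_gt_0, He).
  set (E := fun t => 0 <= t <= 1 /\ forall u, 0 <= u <= t -> zero_near f (z + RtoC u * e)%C).
  assert (E0 : E 0).
  { split; [lra|]. intros u Hu. replace u with 0 by lra. replace (z + 0 * e)%C with z by ring. exact H0. }
  destruct (completeness E) as [T [HT1 HT2]].
  { exists 1. intros t [Ht _]. lra. }
  { exists 0. exact E0. }
  assert (HT01 : 0 <= T <= 1).
  { split; [apply HT1, E0 | apply HT2; intros t [Ht _]; lra]. }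
  assert (Hbelow : forall u, 0 <= u < T -> zero_near f (z + RtoC u * e)%C).
  { intros u Hu. apply NNPP. intros Hn.
    assert (T <= u); [|lra]. apply HT2. intros t [Ht Htu].
    apply Rnot_lt_le. intros Hlt. apply Hn, Htu. lra. }
  assert (HTz : zero_near f (z + RtoC T * e)%C).
  { destruct (Req_dec T 0) as [->|HT0].
    { replace (z + 0 * e)%C with z by ring. exact H0. }
    apply analytic_at_zeros; [apply Han, HT01|]. intros eps Heps.
    set (h := Rmin (T / 2) (eps / 2 / Cmod e)).
    assert (Hh : 0 < h) by (apply Rmin_pos; [lra | apply Rdiv_lt_0_compat; lra]).
    assert (Hh1 : h <= T / 2) by apply Rmin_l. assert (Hh2 : h <= eps / 2 / Cmod e) by apply Rmin_r.
    exists (z + RtoC (T - h) * e)%C.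
    assert (Hdist : Cmod (z + RtoC (T - h) * e - (z + RtoC T * e)) = h * Cmod e).
    { replace (z + RtoC (T - h) * e - (z + RtoC T * e))%C with (- (RtoC h * e))%C by (rewrite RtoC_minus; ring).
      rewrite Cmod_opp, Cmod_mult, Cmod_R, Rabs_pos_eq; lra. }
    split; [|split].
    - intros Eq. rewrite Eq in Hdist. replace (z + RtoC T * e - (z + RtoC T * e))%C with (RtoC 0) in Hdist by ring.
      rewrite Cmod_0 in Hdist. nra.
    - rewrite Hdist. apply Rle_lt_trans with (eps / 2 / Cmod e * Cmod e); [apply Rmult_le_compat_r; lra|].
      replace (eps / 2 / Cmod e * Cmod e) with (eps / 2) by (field; lra). lra.
    - destruct (Hbelow (T - h)) as [d [Hd Hz]]; [lra|]. apply Hz.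
      rewrite Cmod_minus_diag. exact Hd. }
  destruct (Req_dec T 1) as [->|HT1'].
  { replace (z + e)%C with (z + 1 * e)%C by ring. exact HTz. }
  exfalso. destruct HTz as [d [Hd Hz]].
  set (h := Rmin (1 - T) (d / 2 / Cmod e)).
  assert (Hh : 0 < h) by (apply Rmin_pos; [lra | apply Rdiv_lt_0_compat; lra]).
  assert (Hh1 : h <= 1 - T) by apply Rmin_l. assert (Hh2 : h <= d / 2 / Cmod e) by apply Rmin_r.
  assert (T + h <= T); [|lra]. apply HT1. split; [lra|].
  intros u Hu. destruct (Rlt_dec u T) as [Hlt|Hge]; [apply Hbelow; lra|].
  exists (d / 2). split; [lra|]. intros w Hw. apply Hz.
  assert (Hdist : Cmod (z + RtoC u * e - (z + RtoC T * e)) <= d / 2).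
  { replace (z + RtoC u * e - (z + RtoC T * e))%C with (RtoC (u - T) * e)%C by (rewrite RtoC_minus; ring).
    rewrite Cmod_mult, Cmod_R, Rabs_pos_eq by lra.
    apply Rle_trans with (d / 2 / Cmod e * Cmod e); [apply Rmult_le_compat_r; lra|].
    right. field. lra. }
  assert (T2 := Cmod_dist_triangle w (z + RtoC u * e)%C (z + RtoC T * e)%C). lra.
Qed.

Lemma zero_near_value (f : C -> C) (z : C) : zero_near f z -> f z = 0%C.
Proof.
  intros [d [Hd H]]. apply H. rewrite Cmod_minus_diag. exact Hd.
Qed.

(* Off the horizontal line through p one reaches every point of the strip along
   a horizontal segment; a point of that line is a limit of such points. *)
Lemma identity_strip (f : C -> C) (p : C) (a b c d : R) :
  (forall s, a < Re s < b -> s <> p -> analytic_at f s) ->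
  a <= c -> c < d -> d <= b ->
  (forall s, c < Re s < d -> f s = 0%C) ->
  forall s, a < Re s < b -> s <> p -> f s = 0%C.
Proof.
  intros Han Hac Hcd Hdb H0.
  assert (Hoff : forall s, a < Re s < b -> Im s <> Im p -> f s = 0%C).
  { intros s Hs Him. apply zero_near_value.
    set (m := (c + d) / 2). set (z := (m, Im s) : C).
    replace s with (z + RtoC (Re s - m))%C by (apply C_eq; simpl; ring).
    apply zero_near_segment.
    - intros t Ht. apply Han.
      + simpl. replace (m + (t * (Re s - m) - 0 * 0)) with (t * Re s + (1 - t) * m) by ring.
        assert (Hm : a < m < b) by (unfold m; lra).
        destruct (Req_dec t 0) as [->|]; [lra|]. destruct (Req_dec t 1) as [->|]; [lra|]. split; nra.
      + intros E. apply Him. rewrite <- E. simpl. ring.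
    - exists ((d - c) / 2). split; [lra|]. intros w Hw. apply H0.
      assert (T := re_le_Cmod (w - z)%C). rewrite Re_minus in T. simpl in T.
      apply Rabs_le_between in T. unfold m in T. lra. }
  intros s Hs Hsp. destruct (Req_dec (Im s) (Im p)) as [Hi|Hi]; [|apply Hoff; assumption].
  apply zero_near_value, analytic_at_zeros; [apply Han; assumption|].
  intros eps He. exists (s + RtoC (eps / 2) * Ci)%C. split; [|split].
  - intros E. assert (T : Im (s + RtoC (eps / 2) * Ci) = Im s) by (rewrite E; reflexivity).
    simpl in T. unfold Im in T. lra.
  - replace (s + RtoC (eps / 2) * Ci - s)%C with (RtoC (eps / 2) * Ci)%C by ring.
    rewrite Cmod_mult, Cmod_Ci, Cmod_R, Rabs_pos_eq; lra.
  - apply Hoff.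
    + simpl. unfold Re in Hs. lra.
    + rewrite <- Hi. simpl. unfold Im. lra.
Qed.

Lemma analytic_at_minus (f g : C -> C) (z : C) :
  analytic_at f z -> analytic_at g z -> analytic_at (fun w => f w - g w)%C z.
Proof.
  intros [a Ha] [b Hb]. apply locally_C in Ha. apply locally_C in Hb.
  destruct Ha as [d1 [Hd1 Ha]]. destruct Hb as [d2 [Hd2 Hb]].
  exists (fun n => a n - b n)%C. apply locally_C. exists (Rmin d1 d2).
  split; [apply Rmin_pos; assumption|]. intros w Hw.
  specialize (Ha w (Rlt_le_trans _ _ _ Hw (Rmin_l _ _))). specialize (Hb w (Rlt_le_trans _ _ _ Hw (Rmin_r _ _))).
  apply (is_pseries_minus (K := C_AbsRing) (V := C_NormedModule) a b _ _ _ Ha Hb).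
Qed.

(** * Complex series and their majorants *)

Definition sumC (a : nat -> C) (n : nat) : C := sum_n (G := C_AbelianMonoid) a n.

Lemma sumC_S (a : nat -> C) (n : nat) : sumC a (S n) = (sumC a n + a (S n))%C.
Proof. exact (sum_Sn (G := C_AbelianMonoid) a n). Qed.

Lemma sumC_O (a : nat -> C) : sumC a 0 = a 0%nat.
Proof. exact (sum_O (G := C_AbelianMonoid) a). Qed.

Lemma sumC_ext (a b : nat -> C) (n : nat) :
  (forall k, (k <= n)%nat -> a k = b k) -> sumC a n = sumC b n.
Proof. intros H. exact (sum_n_ext_loc (G := C_AbelianMonoid) a b n H). Qed.

Lemma sumC_mult_l (c : C) (a : nat -> C) (n : nat) :
  sumC (fun k => c * a k)%C n = (c * sumC a n)%C.
Proof. induction n; [rewrite !sumC_O; reflexivity | rewrite !sumC_S, IHn; ring]. Qed.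


Lemma Re_sumC (a : nat -> C) (n : nat) : Re (sumC a n) = sum_n (fun k => Re (a k)) n.
Proof. induction n; [rewrite sumC_O, sum_O; reflexivity | rewrite sumC_S, sum_Sn, re_plus, IHn; reflexivity]. Qed.

Lemma Im_sumC (a : nat -> C) (n : nat) : Im (sumC a n) = sum_n (fun k => Im (a k)) n.
Proof. induction n; [rewrite sumC_O, sum_O; reflexivity | rewrite sumC_S, sum_Sn, im_plus, IHn; reflexivity]. Qed.

Lemma contC_sumC (f : nat -> R -> C) (n : nat) (x : R) : (forall k, contC (f k) x) ->
  contC (fun a => sumC (fun k => f k a) n) x.
Proof.
  intros H. induction n.
  - apply (contC_ext (f 0%nat)); [intros; rewrite sumC_O; reflexivity | apply H].
  - apply (contC_ext (fun a => sumC (fun k => f k a) n + f (S n) a)%C); [intros; rewrite sumC_S; reflexivity|].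
    apply contC_plus; [exact IHn | apply H].
Qed.

(** Built from the real [Series], hence total: it can appear in definitions before convergence is
    known. *)
Definition CSeries (a : nat -> C) : C := (Series (fun n => Re (a n)), Series (fun n => Im (a n))).

Notation is_seriesC a l := (is_series (K := C_AbsRing) (V := C_NormedModule) a l).

Lemma is_seriesC_eps (a : nat -> C) (l : C) :
  is_seriesC a l <->
  forall eps, 0 < eps -> exists N, forall n, (N <= n)%nat -> Cmod (sumC a n - l) < eps.
Proof. apply is_series_C. Qed.

Lemma is_series_R_eps (a : nat -> R) (l : R) : is_series a l <->
  forall eps, 0 < eps -> exists N, forall n, (N <= n)%nat -> Rabs (sum_n a n - l) < eps.
Proof.
  split.
  - intros H eps He. destruct (H (fun x => Rabs (x - l) < eps)) as [N HN].
    { exists (mkposreal eps He). intros y Hy. exact Hy. }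
    exists N. exact HN.
  - intros H P [e HP]. destruct (H e (cond_pos e)) as [N HN]. exists N. intros n Hn.
    apply HP, HN, Hn.
Qed.

Lemma is_seriesC_unique (a : nat -> C) (l m : C) : is_seriesC a l -> is_seriesC a m -> l = m.
Proof.
  intros Hl Hm.
  apply C_eq_eps. intros eps He.
    destruct (proj1 (is_seriesC_eps a l) Hl (eps / 2) ltac:(lra)) as [N1 H1].
    destruct (proj1 (is_seriesC_eps a m) Hm (eps / 2) ltac:(lra)) as [N2 H2].
    specialize (H1 (N1 + N2)%nat ltac:(lia)). specialize (H2 (N1 + N2)%nat ltac:(lia)).
    assert (T := Cmod_dist_triangle l (sumC a (N1 + N2)) m).
    rewrite (Cmod_minus_sym l (sumC a (N1 + N2))) in T. lra.
Qed.

Lemma is_seriesC_CSeries (a : nat -> C) (b : nat -> R) :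
  (forall n, Cmod (a n) <= b n) -> ex_series b -> is_seriesC a (CSeries a).
Proof.
  intros H Hb. apply is_seriesC_eps. intros eps He.
  assert (HR : ex_series (fun n => Re (a n))).
  { apply (ex_series_le (V := R_CompleteNormedModule) _ b); [|exact Hb].
    intros n. eapply Rle_trans; [apply re_le_Cmod | apply H]. }
  assert (HI : ex_series (fun n => Im (a n))).
  { apply (ex_series_le (V := R_CompleteNormedModule) _ b); [|exact Hb].
    intros n. eapply Rle_trans; [apply im_le_Cmod | apply H]. }
  apply Series_correct in HR. apply Series_correct in HI.
  destruct (proj1 (is_series_R_eps _ _) HR (eps / 2) ltac:(lra)) as [N1 H1].
  destruct (proj1 (is_series_R_eps _ _) HI (eps / 2) ltac:(lra)) as [N2 H2].
  exists (N1 + N2)%nat. intros n Hn.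
  specialize (H1 n ltac:(lia)). specialize (H2 n ltac:(lia)).
  eapply Rle_lt_trans; [apply Cmod_le_sum|].
  rewrite Re_minus, Im_minus, Re_sumC, Im_sumC. unfold CSeries. simpl. lra.
Qed.


(** Weierstrass' test with its rate. The error depends on the majorant only, so convergence is
    uniform in every parameter that the majorant does not see. *)
Lemma CSeries_tail (a : nat -> C) (b : nat -> R) (n : nat) :
  (forall k, Cmod (a k) <= b k) -> ex_series b ->
  Cmod (sumC a n - CSeries a) <= Series b - sum_n b n.
Proof.
  intros H Hb. assert (Ha := proj1 (is_seriesC_eps _ _) (is_seriesC_CSeries a b H Hb)).
  assert (Hb' := proj1 (is_series_R_eps _ _) (Series_correct _ Hb)).
  assert (Hinc : forall j, Cmod (sumC a n - sumC a (n + j))%C <= sum_n b (n + j) - sum_n b n).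
  { induction j.
    - rewrite Nat.add_0_r. replace (sumC a n - sumC a n)%C with (RtoC 0) by (symmetry; apply Cplus_opp_r). rewrite Cmod_0. lra.
    - rewrite Nat.add_succ_r, sumC_S, sum_Sn.
      assert (T := Cmod_dist_triangle (sumC a n) (sumC a (n + j)) (sumC a (n + j) + a (S (n + j)))%C).
      replace (sumC a (n + j) - (sumC a (n + j) + a (S (n + j))))%C with (- a (S (n + j)))%C in T by ring.
      rewrite Cmod_opp in T. specialize (H (S (n + j))).
      change (plus (sum_n b (n + j)) (b (S (n + j)))) with (sum_n b (n + j) + b (S (n + j))). lra. }
  apply le_epsilon. intros eps He.
  destruct (Ha (eps / 2) ltac:(lra)) as [N1 H1]. destruct (Hb' (eps / 2) ltac:(lra)) as [N2 H2].
  specialize (H1 (n + (N1 + N2))%nat ltac:(lia)). specialize (H2 (n + (N1 + N2))%nat ltac:(lia)).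
  specialize (Hinc (N1 + N2)%nat).
  assert (T := Cmod_dist_triangle (sumC a n) (sumC a (n + (N1 + N2))) (CSeries a)).
  apply Rabs_def2 in H2. lra.
Qed.

Lemma series_tail_small (b : nat -> R) : ex_series b ->
  forall eps, 0 < eps -> exists N, forall n, (N <= n)%nat -> Series b - sum_n b n < eps.
Proof.
  intros Hb eps He. destruct (proj1 (is_series_R_eps _ _) (Series_correct _ Hb) eps He) as [N HN].
  exists N. intros n Hn. specialize (HN n Hn). apply Rabs_def2 in HN. lra.
Qed.

(** * Estimates for real powers *)

Lemma Rpower_lt_small (p eps : R) : 0 < p -> 0 < eps ->
  exists x0, 0 < x0 /\ forall x, x0 <= x -> Rpower x (- p) < eps.
Proof.
  intros Hp He. set (x0 := exp (Rmax 0 (- ln eps / p) + 1)).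
  exists x0. split; [apply exp_pos|]. intros x Hx.
  assert (Hx0 : 0 < x) by (eapply Rlt_le_trans; [apply exp_pos | exact Hx]).
  unfold Rpower. rewrite <- (exp_ln eps He) at 1. apply exp_increasing.
  assert (Hl : Rmax 0 (- ln eps / p) + 1 <= ln x).
  { rewrite <- (ln_exp (Rmax 0 (- ln eps / p) + 1)).
    destruct Hx as [Hx| <-]; [left; apply ln_increasing; [apply exp_pos | exact Hx] | right; reflexivity]. }
  assert (T := Rmax_r 0 (- ln eps / p)).
  assert (p * (- ln eps / p) < p * ln x) by (apply Rmult_lt_compat_l; lra).
  replace (p * (- ln eps / p)) with (- ln eps) in H by (field; lra). lra.
Qed.

Lemma Rpower_lt_small_nat (p eps : R) : 0 < p -> 0 < eps ->
  exists N, forall n x, (N <= n)%nat -> 0 <= x -> Rpower (INR n + x) (- p) < eps.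
Proof.
  intros Hp He. destruct (Rpower_lt_small p eps Hp He) as [x0 [Hx0 H]].
  destruct (INR_unbounded x0) as [N HN]. exists N. intros n x Hn Hx. apply H.
  apply le_INR in Hn. lra.
Qed.

Lemma Rpower_le_anti (x y p : R) : 0 < x -> x <= y -> p <= 0 -> Rpower y p <= Rpower x p.
Proof.
  intros Hx Hxy Hp. unfold Rpower. apply exp_le.
  assert (ln x <= ln y) by (destruct Hxy as [H|<-]; [left; apply ln_increasing; assumption | right; reflexivity]).
  nra.
Qed.

Lemma Rpower_le_exp (x p q : R) : 1 <= x -> p <= q -> Rpower x p <= Rpower x q.
Proof. intros Hx Hpq. apply Rle_Rpower; assumption. Qed.

Lemma Rpower_step (p x : R) : 0 < p -> 0 < x ->
  p * Rpower (x + 1) (- (p + 1)) <= Rpower x (- p) - Rpower (x + 1) (- p).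
Proof.
  intros Hp Hx.
  destruct (MVT_gen (fun t => Rpower t (- p)) x (x + 1) (fun t => - p * Rpower t (- p - 1))) as [c [Hc E]].
  - intros t Ht. rewrite Rmin_left in Ht by lra. apply is_derive_Reals, derivable_pt_lim_power. lra.
  - intros t Ht. rewrite Rmin_left, Rmax_right in Ht by lra.
    apply derivable_continuous_pt. exists (- p * Rpower t (- p - 1)). apply derivable_pt_lim_power. lra.
  - rewrite Rmin_left, Rmax_right in Hc by lra.
    assert (T : Rpower (x + 1) (- p - 1) <= Rpower c (- p - 1)) by (apply Rpower_le_anti; lra).
    replace (- (p + 1)) with (- p - 1) by ring. nra.
Qed.

(** The integral test in telescoping form: by [Rpower_step] each term after the first is at most a
    difference of consecutive values of y^(-(p - 1)) / (p - 1), so the partial sums are bounded. *)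
Lemma ex_series_Rpower (p x : R) : 1 < p -> 0 < x -> ex_series (fun n => Rpower (INR n + x) (- p)).
Proof.
  intros Hp Hx.
  assert (Hb : forall n, sum_n (fun n => Rpower (INR n + x) (- p)) n <=
     Rpower x (- p) + / (p - 1) * (Rpower x (- (p - 1)) - Rpower (INR n + x) (- (p - 1)))).
  { induction n.
    - rewrite sum_O. simpl. rewrite Rplus_0_l. lra.
    - rewrite sum_Sn. change (plus ?a ?b) with (a + b).
      assert (Hn := pos_INR n).
      assert (T := Rpower_step (p - 1) (INR n + x) ltac:(lra) ltac:(lra)).
      replace (p - 1 + 1) with p in T by ring. rewrite S_INR.
      replace (INR n + 1 + x) with (INR n + x + 1) by ring.
      apply (Rmult_le_compat_l (/ (p - 1))) in T; [|apply Rlt_le, Rinv_0_lt_compat; lra].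
      rewrite <- Rmult_assoc, Rinv_l, Rmult_1_l in T by lra. lra. }
  assert (Hlim : ex_finite_lim_seq (sum_n (fun n => Rpower (INR n + x) (- p)))).
  { apply (ex_finite_lim_seq_incr _ (Rpower x (- p) + / (p - 1) * Rpower x (- (p - 1)))).
    - intros n. rewrite sum_Sn. change (plus ?a ?b) with (a + b).
      assert (T := Rpower_pos (INR (S n) + x) (- p)). lra.
    - intros n. eapply Rle_trans; [apply Hb|].
      assert (T := Rpower_pos (INR n + x) (- (p - 1))).
      assert (0 < / (p - 1)) by (apply Rinv_0_lt_compat; lra). nra. }
  destruct Hlim as [l Hl]. exists l. exact Hl.
Qed.

(** * Continuation by the trapezoidal rule *)

(** The error of the trapezoidal rule for [x ^ (- s)] on [[x, x + 1]]. *)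
Definition trap (s : C) (x : R) : C :=
  ((Rcpow x (- s) + Rcpow (x + 1) (- s)) / 2 +
   (Rcpow x (1 - s) - Rcpow (x + 1) (1 - s)) / (1 - s))%C.

(** The zeta function for [Re s > -1], by first-order Euler-Maclaurin summation
    of all terms but the first. *)
Definition zeta_em (s : C) (alpha : R) : C :=
  (Rcpow alpha (- s) + Rcpow (alpha + 1) (- s) / 2 + Rcpow (alpha + 1) (1 - s) / (s - 1) +
   CSeries (fun n => trap s (INR n + (alpha + 1))))%C.

Definition zeta_em_partial (N : nat) (s : C) (alpha : R) : C :=
  (Rcpow alpha (- s) + Rcpow (alpha + 1) (- s) / 2 + Rcpow (alpha + 1) (1 - s) / (s - 1) +
   sumC (fun n => trap s (INR n + (alpha + 1))%R) N)%C.

Lemma C_1_minus_neq_0 (s : C) : s <> 1%C -> (1 - s)%C <> 0%C.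
Proof. intros H E. apply H. replace s with (1 - (1 - s))%C by ring. rewrite E. ring. Qed.

Lemma C_minus_1_neq_0 (s : C) : s <> 1%C -> (s - 1)%C <> 0%C.
Proof. intros H E. apply H. replace s with (s - 1 + 1)%C by ring. rewrite E. ring. Qed.

Lemma derivC_Rcpow_shift (s : C) (x u : R) : 0 < x + u ->
  derivC (fun t => Rcpow (x + t) s) u (s * Rcpow (x + u) (s - 1))%C.
Proof.
  intros H. eapply derivC_eq.
  - apply (derivC_comp (fun y => Rcpow y s) (fun t => x + t) u (s * Rcpow (x + u) (s - 1))%C 1).
    + apply derivC_Rcpow, H.
    + auto_derive; [exact I | ring].
  - ring.
Qed.

Lemma contC_Rcpow_shift (s : C) (x u : R) : 0 < x + u -> contC (fun t => Rcpow (x + t) s) u.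
Proof. intros H. eapply derivC_cont, derivC_Rcpow_shift, H. Qed.

Lemma derivC_id (x : R) : derivC (fun t => RtoC t) x (RtoC 1).
Proof. apply derivC_RtoC, (is_derive_id (K := R_AbsRing)). Qed.

Ltac deriv_step :=
  match goal with
  | |- is_derive (fun _ => ?c) _ _ => apply derivC_const
  | |- is_derive (fun t => RtoC t) _ _ => apply derivC_id
  | |- is_derive RtoC _ _ => apply derivC_id
  | |- is_derive (fun t => (_ - _)%C) _ _ => apply derivC_minus
  | |- is_derive (fun t => (_ + _)%C) _ _ => apply derivC_plus
  | |- is_derive (fun t => (_ / _)%C) _ _ => apply derivC_mult
  | |- is_derive (fun t => (_ * _)%C) _ _ => apply derivC_mult
  | |- is_derive (fun t => Rcpow (_ + t) _) _ _ => apply derivC_Rcpow_shift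
  end.

(** Peano's form of the trapezoidal error. Integrating by parts twice against the kernel u (1 - u) /
    2, which vanishes at both ends, turns the second derivative of x^(-s) into the error of the
    rule. *)
Lemma trap_integral (s : C) (x : R) : 0 < x -> s <> 1%C ->
  intC (fun u => / 2 * (RtoC u * (1 - RtoC u)) * (s * (s + 1)) * Rcpow (x + u) (- s - 1 - 1))%C 0 1 (trap s x).
Proof.
  intros Hx Hs. assert (Hs' := C_1_minus_neq_0 s Hs).
  assert (H2 : RtoC 2 <> 0%C) by (intros E; apply RtoC_inj in E; lra).
  eapply intC_eq.
  - apply (intC_derive (fun u => / 2 * (RtoC u * (1 - RtoC u)) * (- s * Rcpow (x + u) (- s - 1)) -
       / 2 * (1 - 2 * RtoC u) * Rcpow (x + u) (- s) - Rcpow (x + u) (1 - s) / (1 - s))%C).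
    + intros u Hu. rewrite Rmin_left, Rmax_right in Hu by lra.
      assert (Hxu : 0 < x + u) by lra.
      eapply derivC_eq.
      * repeat deriv_step; exact Hxu.
      * cbv beta. replace (1 - s - 1)%C with (- s)%C by ring. field; repeat split; assumption.
    + intros u Hu. rewrite Rmin_left, Rmax_right in Hu by lra.
      apply contC_mult; [|apply contC_Rcpow_shift; lra].
      apply contC_mult; [|apply contC_const].
      apply contC_mult; [apply contC_const|].
      eapply derivC_cont. apply derivC_mult; [apply derivC_id|]. apply derivC_minus; [apply derivC_const | apply derivC_id].
  - cbv beta. unfold trap. rewrite Rplus_0_r. field; repeat split; assumption.
Qed.

(** The two powers of [x] gained over x^(-s) are what makes the errors summable for Re s > -1. *)
Lemma Cmod_trap (s : C) (x : R) : 0 < x -> s <> 1%C -> - 2 <= Re s ->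
  Cmod (trap s x) <= Cmod s * Cmod (s + 1) * Rpower x (- Re s - 2).
Proof.
  intros Hx Hs Hre. assert (I := trap_integral s x Hx Hs).
  replace (Cmod s * Cmod (s + 1) * Rpower x (- Re s - 2))
    with ((1 - 0) * (Cmod s * Cmod (s + 1) * Rpower x (- Re s - 2))) by ring.
  apply (intC_bound_const _ _ _ _ _ Rle_0_1) with (2 := I).
  intros u Hu. rewrite !Cmod_mult, Cmod_Rcpow.
  assert (E1 : Cmod (/ 2) * (Cmod (RtoC u) * Cmod (1 - RtoC u)) <= 1).
  { rewrite <- RtoC_minus, <- RtoC_inv, !Cmod_R by lra. rewrite !Rabs_pos_eq by lra. nra. }
  assert (E2 : Rpower (x + u) (Re (- s - 1 - 1)) <= Rpower x (- Re s - 2)).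
  { replace (Re (- s - 1 - 1)) with (- Re s - 2) by (simpl; unfold Re; ring).
    apply Rpower_le_anti; lra. }
  assert (P1 := Cmod_ge_0 s). assert (P2 := Cmod_ge_0 (s + 1)%C).
  assert (P3 : 0 <= Cmod s * Cmod (s + 1)) by (apply Rmult_le_pos; assumption).
  apply Rmult_le_compat; [| apply Rlt_le, Rpower_pos | | exact E2].
  - repeat apply Rmult_le_pos; try apply Cmod_ge_0.
  - replace (Cmod s * Cmod (s + 1)) with (1 * (Cmod s * Cmod (s + 1))) at 2 by ring.
    apply Rmult_le_compat_r; assumption.
Qed.

(** Since [zeta_em] keeps the first term alpha^(-s) apart, the errors are taken at points beyond
    [INR n + 1]. The majorant is therefore independent of [alpha], even as [alpha] tends to 0, and
    of [s] in a bounded part of a half-plane. *)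
Lemma Cmod_trap_shift (s : C) (alpha s0 B : R) (n : nat) :
  0 < alpha -> s <> 1%C -> s0 <= Re s -> - 1 < s0 -> Cmod s <= B ->
  Cmod (trap s (INR n + (alpha + 1))) <= B * (B + 1) * Rpower (INR n + 1) (- (s0 + 2)).
Proof.
  intros Ha Hs Hre Hs0 HB. assert (Hn := pos_INR n). assert (HB0 := Cmod_ge_0 s).
  eapply Rle_trans; [apply Cmod_trap; [lra | exact Hs | lra]|].
  apply Rmult_le_compat.
  - apply Rmult_le_pos; apply Cmod_ge_0.
  - apply Rlt_le, Rpower_pos.
  - apply Rmult_le_compat; [apply Cmod_ge_0 | apply Cmod_ge_0 | exact HB|].
    eapply Rle_trans; [apply Cmod_triangle|]. rewrite Cmod_1. lra.
  - apply Rle_trans with (Rpower (INR n + 1) (- Re s - 2)); [apply Rpower_le_anti; lra|].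
    apply Rpower_le_exp; lra.
Qed.

Lemma ex_series_trap_bound (s0 B : R) : - 1 < s0 ->
  ex_series (fun n => B * (B + 1) * Rpower (INR n + 1) (- (s0 + 2))).
Proof.
  intros H. apply (ex_series_scal_l (K := R_AbsRing) (B * (B + 1)) (fun n => Rpower (INR n + 1) (- (s0 + 2)))).
  apply ex_series_Rpower; lra.
Qed.

(** Uniformity in [s] yields analyticity. Uniformity in [alpha] yields continuity and, because it
    extends down to alpha = 0, limits under integrals over (0, 1). *)
Lemma zeta_em_partial_uniform (s0 B eps : R) : - 1 < s0 -> 0 < eps ->
  exists N0, forall N (s : C) alpha, (N0 <= N)%nat -> 0 < alpha -> s <> 1%C -> s0 <= Re s -> Cmod s <= B ->
    Cmod (zeta_em_partial N s alpha - zeta_em s alpha) < eps.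
Proof.
  intros Hs0 He.
  destruct (series_tail_small _ (ex_series_trap_bound s0 B Hs0) eps He) as [N0 HN].
  exists N0. intros N s alpha Hn Ha Hs Hre HB.
  unfold zeta_em_partial, zeta_em.
  replace (_ - _)%C with (sumC (fun n => trap s (INR n + (alpha + 1))%R) N - CSeries (fun n => trap s (INR n + (alpha + 1))%R))%C by ring.
  eapply Rle_lt_trans; [|apply (HN N Hn)].
  apply CSeries_tail; [|apply ex_series_trap_bound, Hs0].
  intros k. apply Cmod_trap_shift; assumption.
Qed.

(** The integrals telescope and every inner node collects two halves. The trapezoids of index 0 to
    [N] end at the node N + 2 + alpha, so the terms 0 to N + 1 appear in full and the next one by
    half. *)
Lemma zeta_em_partial_eq (N : nat) (s : C) (alpha : R) : s <> 1%C ->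
  zeta_em_partial N s alpha =
  (sumC (fun n => Rcpow (INR n + alpha) (- s)) (S N) + Rcpow (INR N + 2 + alpha) (- s) / 2
   - Rcpow (INR N + 2 + alpha) (1 - s) / (1 - s))%C.
Proof.
  intros Hs. assert (Hs1 := C_1_minus_neq_0 s Hs). assert (Hs2 := C_minus_1_neq_0 s Hs).
  assert (H2 : RtoC 2 <> 0%C) by (intros E; apply RtoC_inj in E; lra).
  unfold zeta_em_partial. induction N.
  - rewrite sumC_S, !sumC_O. unfold trap. simpl.
    replace (0 + alpha) with alpha by ring. replace (0 + (alpha + 1)) with (alpha + 1) by ring.
    replace (1 + alpha) with (alpha + 1) by ring. replace (0 + 2 + alpha) with (alpha + 1 + 1) by ring.
    field. repeat split; assumption.
  - rewrite sumC_S. rewrite (sumC_S _ (S N)).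
    rewrite Cplus_assoc, IHN. unfold trap. rewrite !S_INR.
    replace (INR N + 1 + (alpha + 1)) with (INR N + 2 + alpha) by ring.
    replace (INR N + 1 + 1 + alpha) with (INR N + 2 + alpha) by ring.
    replace (INR N + 1 + 2 + alpha) with (INR N + 2 + alpha + 1) by ring.
    field. repeat split; assumption.
Qed.


(** By the closed form, the partial expressions differ from the partial sums of the Dirichlet series
    by two boundary terms, which tend to 0 for Re s > 1. *)
Lemma zeta_em_series (s : C) (alpha : R) : 0 < alpha -> 1 < Re s ->
  is_seriesC (fun n => Rcpow (INR n + alpha) (- s)) (zeta_em s alpha).
Proof.
  intros Ha Hs. assert (Hs1 : s <> 1%C) by (intros ->; simpl in Hs; lra).
  assert (Hn1 := C_1_minus_neq_0 s Hs1).
  apply is_seriesC_eps. intros eps He.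
  set (c := Cmod (/ (1 - s)) + 1). assert (Hc : 0 < c) by (unfold c; assert (T := Cmod_ge_0 (/ (1 - s))%C); lra).
  destruct (zeta_em_partial_uniform 0 (Cmod s) (eps / 3)) as [N1 H1]; [lra | lra |].
  destruct (Rpower_lt_small_nat (Re s) (eps / 3)) as [N2 H2]; [lra | lra |].
  destruct (Rpower_lt_small_nat (Re s - 1) (eps / 3 / c)) as [N3 H3]; [lra | apply Rdiv_lt_0_compat; lra |].
  exists (S (N1 + N2 + N3)). intros n Hn. destruct n as [|n]; [lia|].
  specialize (H1 n s alpha ltac:(lia) Ha Hs1 ltac:(lra) ltac:(lra)).
  specialize (H2 n (2 + alpha) ltac:(lia) ltac:(lra)). specialize (H3 n (2 + alpha) ltac:(lia) ltac:(lra)).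
  rewrite zeta_em_partial_eq in H1 by exact Hs1.
  rewrite <- Rplus_assoc in H2, H3.
  set (S0 := sumC _ _) in *. set (y := INR n + 2 + alpha) in *.
  set (A := (Rcpow y (- s) / 2)%C) in *. set (D := (Rcpow y (1 - s) / (1 - s))%C) in *.
  assert (HA : Cmod A < eps / 3).
  { unfold A. rewrite Cmod_div by (intros E; apply RtoC_inj in E; lra).
    rewrite Cmod_Rcpow, re_opp, Cmod_R, Rabs_pos_eq by lra.
    assert (T := Rpower_pos y (- Re s)). lra. }
  assert (HD : Cmod D < eps / 3).
  { unfold D, Cdiv. rewrite Cmod_mult, Cmod_Rcpow.
    replace (Re (1 - s)) with (- (Re s - 1)) by (rewrite Re_minus; simpl; ring).
    apply Rle_lt_trans with (Rpower y (- (Re s - 1)) * c).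
    - apply Rmult_le_compat_l; [apply Rlt_le, Rpower_pos | unfold c; lra].
    - apply Rlt_le_trans with (eps / 3 / c * c); [apply Rmult_lt_compat_r; assumption | right; field; lra]. }
  assert (T1 := Cmod_triangle (S0 + A - D - zeta_em s alpha)%C (D - A)%C).
  assert (T2 := Cmod_triangle D (- A)%C). rewrite Cmod_opp in T2.
  replace (S0 + A - D - zeta_em s alpha + (D - A))%C with (S0 - zeta_em s alpha)%C in T1 by ring.
  unfold Cminus in *. lra.
Qed.

Lemma QH_Rcpow_minus (x : R) (c z0 : C) (r : R) : QH (fun s => Rcpow x (c - s)%C) z0 r.
Proof. apply (QH_reflect (fun s => Rcpow x s)), QH_Rcpow. Qed.

Lemma QH_Rcpow_opp (x : R) (z0 : C) (r : R) : QH (fun s => Rcpow x (- s)%C) z0 r.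
Proof.
  apply (QH_ext (fun s => Rcpow x (0 - s)%C)); [|apply QH_Rcpow_minus].
  intros s _. f_equal. ring.
Qed.

Lemma QH_inv_minus_1 (z0 : C) (r : R) : r < Cmod (z0 - 1) -> QH (fun s => / (s - 1))%C z0 r.
Proof. apply QH_inv. Qed.

Lemma QH_inv_1_minus (z0 : C) (r : R) : 0 < r -> r < Cmod (z0 - 1) -> QH (fun s => / (1 - s))%C z0 r.
Proof.
  intros H0 H. apply (QH_ext (fun s => - / (s - 1))%C); [|apply QH_opp, QH_inv, H].
  intros s Hs. field. split.
  - apply C_1_minus_neq_0. intros ->. rewrite Cmod_minus_sym in Hs. lra.
  - apply C_minus_1_neq_0. intros ->. rewrite Cmod_minus_sym in Hs. lra.
Qed.

Lemma QH_zeta_em_partial (N : nat) (alpha : R) (z0 : C) (r : R) :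
  0 < r -> r < Cmod (z0 - 1) -> QH (fun s => zeta_em_partial N s alpha) z0 r.
Proof.
  intros H0 H. unfold zeta_em_partial.
  assert (H1 := QH_inv_minus_1 z0 r H). assert (H2 := QH_inv_1_minus z0 r H0 H).
  apply QH_plus; [apply QH_plus; [apply QH_plus|]|].
  - apply QH_Rcpow_opp.
  - apply QH_mult; [apply QH_Rcpow_opp | apply QH_const].
  - apply QH_mult; [apply QH_Rcpow_minus | exact H1].
  - unfold sumC. apply (QH_sum_n (fun n s => trap s (INR n + (alpha + 1)))). intros k. unfold trap.
    apply QH_plus; apply QH_mult; [| apply QH_const | | exact H2].
    + apply QH_plus; apply QH_Rcpow_opp.
    + apply QH_minus; apply QH_Rcpow_minus.
Qed.

(** Half the smaller of the distances to the line Re s = -1 and to the pole. *)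
Definition em_radius (z0 : C) : R := Rmin ((Re z0 + 1) / 2) (Cmod (z0 - 1) / 2).

Lemma em_radius_spec (z0 : C) : - 1 < Re z0 -> z0 <> 1%C ->
  0 < em_radius z0 /\ em_radius z0 < Cmod (z0 - 1) /\
  forall z, Cmod (z - z0) < em_radius z0 ->
    (Re z0 - 1) / 2 <= Re z /\ Cmod z <= Cmod z0 + em_radius z0 /\ z <> 1%C.
Proof.
  intros Hre H1. assert (Hc : 0 < Cmod (z0 - 1)) by (apply Cmod_gt_0, C_minus_1_neq_0, H1).
  assert (L := Rmin_l ((Re z0 + 1) / 2) (Cmod (z0 - 1) / 2)).
  assert (R := Rmin_r ((Re z0 + 1) / 2) (Cmod (z0 - 1) / 2)). fold (em_radius z0) in L, R.
  split; [apply Rmin_pos; lra|]. split; [lra|].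
  intros z Hz. split; [|split].
  - assert (T := re_le_Cmod (z - z0)%C). rewrite Re_minus in T. apply Rabs_le_between in T. lra.
  - assert (T := Cmod_triangle_inv z z0). lra.
  - intros ->. rewrite Cmod_minus_sym in Hz. lra.
Qed.

Lemma QH_zeta_em (alpha : R) (z0 : C) : 0 < alpha -> - 1 < Re z0 -> z0 <> 1%C ->
  QH (fun s => zeta_em s alpha) z0 (em_radius z0 / 4).
Proof.
  intros Ha Hre H1. destruct (em_radius_spec z0 Hre H1) as [Hr [Hr1 Hz]].
  apply (QH_uniform_limit (fun N s => zeta_em_partial N s alpha)); [exact Hr | |].
  - intros N. apply QH_zeta_em_partial; assumption.
  - intros eps He.
    destruct (zeta_em_partial_uniform ((Re z0 - 1) / 2) (Cmod z0 + em_radius z0) eps ltac:(lra) He) as [N HN].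
    exists N. intros n z Hn Hzz. destruct (Hz z Hzz) as [A1 [A2 A3]]. apply HN; assumption.
Qed.

Lemma contC_zeta_em_partial (N : nat) (s : C) (alpha : R) : 0 < alpha ->
  contC (fun a => zeta_em_partial N s a) alpha.
Proof.
  intros Ha. unfold zeta_em_partial.
  assert (Hsh : forall (p : C) (y : R), 0 < y + alpha -> contC (fun a => Rcpow (y + a) p) alpha)
    by (intros; apply contC_Rcpow_shift; assumption).
  assert (Hsh1 : forall (p : C), contC (fun a => Rcpow (a + 1) p) alpha).
  { intros p. apply (contC_ext (fun a => Rcpow (1 + a) p)); [intros; f_equal; ring | apply Hsh; lra]. }
  apply contC_plus; [apply contC_plus; [apply contC_plus|]|].
  - apply contC_Rcpow, Ha.
  - apply contC_mult; [apply Hsh1 | apply contC_const].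
  - apply contC_mult; [apply Hsh1 | apply contC_const].
  - assert (Ht : forall k, contC (fun a => trap s (INR k + (a + 1))) alpha).
    { intros k. assert (Hk := pos_INR k).
      assert (Hx1 : forall p, contC (fun a => Rcpow (INR k + (a + 1)) p) alpha).
      { intros p. apply (contC_ext (fun a => Rcpow ((INR k + 1) + a) p)); [intros; f_equal; ring | apply Hsh; lra]. }
      assert (Hx2 : forall p, contC (fun a => Rcpow (INR k + (a + 1) + 1) p) alpha).
      { intros p. apply (contC_ext (fun a => Rcpow ((INR k + 2) + a) p)); [intros; f_equal; ring | apply Hsh; lra]. }
      apply contC_plus; apply contC_mult; try apply contC_const; [apply contC_plus | apply contC_minus]; auto. }
    apply (contC_sumC (fun k a => trap s (INR k + (a + 1)))), Ht.
Qed.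

Lemma contC_uniform_limit (fn : nat -> R -> C) (f : R -> C) (x r : R) : 0 < r ->
  (forall n, contC (fn n) x) ->
  (forall eps, 0 < eps -> exists N, forall n y, (N <= n)%nat -> Rabs (y - x) < r -> Cmod (fn n y - f y) < eps) ->
  contC f x.
Proof.
  intros Hr Hc Hu. apply contC_eps. intros eps He.
  destruct (Hu (eps / 3) ltac:(lra)) as [N HN].
  destruct (proj1 (contC_eps _ _) (Hc N) (eps / 3) ltac:(lra)) as [d [Hd H]].
  exists (Rmin d r). split; [apply Rmin_pos; assumption|]. intros y Hy.
  assert (Hy1 := Rlt_le_trans _ _ _ Hy (Rmin_l _ _)). assert (Hy2 := Rlt_le_trans _ _ _ Hy (Rmin_r _ _)).
  assert (A1 := HN N y (le_n N) Hy2).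
  assert (A2 := HN N x (le_n N)). rewrite Rminus_diag, Rabs_R0 in A2. specialize (A2 Hr).
  specialize (H y Hy1).
  assert (T1 := Cmod_dist_triangle (f y) (fn N y) (f x)).
  assert (T2 := Cmod_dist_triangle (fn N y) (fn N x) (f x)).
  rewrite (Cmod_minus_sym (f y) (fn N y)) in T1. lra.
Qed.

Lemma contC_zeta_em (s : C) (alpha : R) : 0 < alpha -> - 1 < Re s -> s <> 1%C ->
  contC (fun a => zeta_em s a) alpha.
Proof.
  intros Ha Hre Hs. apply (contC_uniform_limit (fun N a => zeta_em_partial N s a) _ _ alpha Ha).
  - intros n. apply contC_zeta_em_partial, Ha.
  - intros eps He.
    destruct (zeta_em_partial_uniform (Re s) (Cmod s) eps Hre He) as [N HN].
    exists N. intros n y Hn Hy. apply HN; try assumption; try lra.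
    apply Rabs_def2 in Hy. lra.
Qed.

(** * The Gamma function *)

(** The limit inherits the rate [e]. This gives the improper integrals below explicit error bounds,
    as uniformity in parameters requires. *)
Lemma C_cauchy_limit (u : nat -> C) (e : nat -> R) :
  (forall n m, (n <= m)%nat -> Cmod (u m - u n) <= e n) ->
  (forall eps, 0 < eps -> exists N, forall n, (N <= n)%nat -> e n < eps) ->
  exists l, forall n, Cmod (u n - l) <= e n.
Proof.
  intros Hu He.
  assert (HC : forall g : C -> R, (forall z w, Rabs (g z - g w) <= Cmod (z - w)) ->
     exists l, forall eps, 0 < eps -> exists N, forall n, (N <= n)%nat -> Rabs (g (u n) - l) < eps).
  { intros g Hg.
    assert (Hcau : Cauchy_crit (fun n => g (u n))).
    { intros eps Heps. destruct (He (eps / 2) ltac:(lra)) as [N HN]. exists N.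
      intros n m Hn Hm. unfold Rdist.
      assert (A1 := Hu N n Hn). assert (A2 := Hu N m Hm). assert (A3 := HN N (le_n N)).
      assert (T := Cmod_dist_triangle (u n) (u N) (u m)). rewrite (Cmod_minus_sym (u N) (u m)) in T.
      eapply Rle_lt_trans; [apply Hg|]. lra. }
    destruct (Rcomplete.R_complete _ Hcau) as [l Hl]. exists l. intros eps Heps.
    destruct (Hl eps Heps) as [N HN]. exists N. intros n Hn. apply HN, Hn. }
  destruct (HC Re) as [lr Hlr]. { intros z w. rewrite <- Re_minus. apply re_le_Cmod. }
  destruct (HC Im) as [li Hli]. { intros z w. rewrite <- Im_minus. apply im_le_Cmod. }
  exists (lr, li). intros n. apply le_epsilon. intros eps Heps.
  destruct (Hlr (eps / 2) ltac:(lra)) as [N1 H1]. destruct (Hli (eps / 2) ltac:(lra)) as [N2 H2].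
  set (m := (n + (N1 + N2))%nat).
  specialize (H1 m ltac:(unfold m; lia)). specialize (H2 m ltac:(unfold m; lia)).
  assert (A1 := Hu n m ltac:(unfold m; lia)). rewrite Cmod_minus_sym in A1.
  assert (T := Cmod_dist_triangle (u n) (u m) (lr, li)).
  assert (T2 := Cmod_le_sum (u m - (lr, li))%C). rewrite Re_minus, Im_minus in T2. simpl in T2.
  simpl in *. lra.
Qed.

Lemma is_RInt_Rpower (tau a b : R) : tau <> 1 -> 0 < a -> a <= b ->
  is_RInt (fun t => Rpower t (- tau)) a b ((Rpower b (1 - tau) - Rpower a (1 - tau)) / (1 - tau)).
Proof.
  intros Ht Ha Hab.
  replace ((Rpower b (1 - tau) - Rpower a (1 - tau)) / (1 - tau)) with
    (minus (/ (1 - tau) * Rpower b (1 - tau)) (/ (1 - tau) * Rpower a (1 - tau)))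
    by (unfold minus, plus, opp; simpl; field; lra).
  apply (is_RInt_derive (V := R_CompleteNormedModule) (fun t => / (1 - tau) * Rpower t (1 - tau))).
  - intros x Hx. rewrite Rmin_left, Rmax_right in Hx by exact Hab.
    replace (Rpower x (- tau)) with (/ (1 - tau) * ((1 - tau) * Rpower x (1 - tau - 1))).
    + apply is_derive_scal. apply is_derive_Reals, derivable_pt_lim_power. lra.
    + replace (1 - tau - 1) with (- tau) by ring. field. lra.
  - intros x Hx. rewrite Rmin_left, Rmax_right in Hx by exact Hab.
    apply (ex_derive_continuous (V := R_NormedModule)). exists (- tau * Rpower x (- tau - 1)).
    apply is_derive_Reals, derivable_pt_lim_power. lra.
Qed.

Lemma Rpower_small_at_0 (p eps : R) : 0 < p -> 0 < eps ->
  exists d, 0 < d /\ forall x, 0 < x -> x <= d -> Rpower x p < eps.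
Proof.
  intros Hp He. destruct (Rpower_lt_small p eps Hp He) as [x0 [Hx0 H]].
  exists (/ x0). split; [apply Rinv_0_lt_compat, Hx0|]. intros x Hx Hxd.
  replace (Rpower x p) with (Rpower (/ x) (- p)).
  - apply H. rewrite <- (Rinv_inv x0). apply Rinv_le_contravar; assumption.
  - unfold Rpower. rewrite ln_Rinv by exact Hx. f_equal. ring.
Qed.

(** The majorant A t^(-tau) has integral A e^(1 - tau) / (1 - tau) over (0, e). This is both the
    Cauchy rate along e = 1 / (n + 1) and the final error. *)
Lemma improper_at_0 (f : R -> C) (A tau : R) : 0 <= A -> tau < 1 ->
  (forall t, 0 < t <= 1 -> contC f t) ->
  (forall t, 0 < t <= 1 -> Cmod (f t) <= A * Rpower t (- tau)) ->
  exists I, forall e, 0 < e <= 1 ->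
    Cmod (IntC f e 1 - I) <= A * Rpower e (1 - tau) / (1 - tau).
Proof.
  intros HA Htau Hc Hb.
  assert (Hint : forall x y, 0 < x -> x <= y -> y <= 1 -> intC f x y (IntC f x y)).
  { intros x y Hx Hxy Hy. apply intC_cont. intros t Ht. rewrite Rmin_left, Rmax_right in Ht by lra. apply Hc; lra. }
  assert (Hdiff : forall x y, 0 < x -> x <= y -> y <= 1 ->
    Cmod (IntC f x 1 - IntC f y 1) <= A * Rpower y (1 - tau) / (1 - tau)).
  { intros x y Hx Hxy Hy.
    assert (I1 := intC_Chasles f x y 1 _ _ (Hint x y Hx Hxy Hy) (Hint y 1 ltac:(lra) Hy ltac:(lra))).
    rewrite (intC_unique _ _ _ _ _ (Hint x 1 Hx ltac:(lra) ltac:(lra)) I1).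
    replace (IntC f x y + IntC f y 1 - IntC f y 1)%C with (IntC f x y) by ring.
    assert (B1 : Cmod (IntC f x y) <= A * ((Rpower y (1 - tau) - Rpower x (1 - tau)) / (1 - tau))).
    { apply (intC_bound f (fun t => A * Rpower t (- tau)) x y _ _ Hxy).
      - intros t Ht. apply Hb. lra.
      - apply Hint; assumption.
      - apply (is_RInt_scal (V := R_NormedModule)). apply is_RInt_Rpower; lra. }
    eapply Rle_trans; [exact B1|]. unfold Rdiv. rewrite Rmult_assoc. apply Rmult_le_compat_l; [exact HA|].
    apply Rmult_le_compat_r; [apply Rlt_le, Rinv_0_lt_compat; lra|].
    assert (T := Rpower_pos x (1 - tau)). lra. }
  assert (Hn : forall n, 0 < / (INR n + 1) <= 1).
  { intros n. assert (T := pos_INR n). split; [apply Rinv_0_lt_compat; lra|].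
    rewrite <- Rinv_1 at 2. apply Rinv_le_contravar; lra. }
  assert (Hsm : forall eps, 0 < eps -> exists N, forall n, (N <= n)%nat ->
     A * Rpower (/ (INR n + 1)) (1 - tau) / (1 - tau) < eps).
  { intros eps He.
    destruct (Rpower_lt_small_nat (1 - tau) (eps * (1 - tau) / (A + 1))) as [N HN]; [lra | |].
    { apply Rdiv_lt_0_compat; [apply Rmult_lt_0_compat|]; lra. }
    exists N. intros n Hnn. specialize (HN n 1 Hnn ltac:(lra)).
    assert (T := pos_INR n).
    replace (Rpower (/ (INR n + 1)) (1 - tau)) with (Rpower (INR n + 1) (- (1 - tau)))
      by (unfold Rpower; rewrite ln_Rinv by lra; f_equal; ring).
    set (x := Rpower (INR n + 1) (- (1 - tau))) in *. assert (Hx : 0 < x) by apply Rpower_pos.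
    apply Rmult_lt_reg_r with (1 - tau); [lra|].
    replace (A * x / (1 - tau) * (1 - tau)) with (A * x) by (field; lra).
    apply Rle_lt_trans with ((A + 1) * x); [nra|].
    apply (Rmult_lt_compat_l (A + 1)) in HN; [|lra].
    replace ((A + 1) * (eps * (1 - tau) / (A + 1))) with (eps * (1 - tau)) in HN by (field; lra). exact HN. }
  destruct (C_cauchy_limit (fun n => IntC f (/ (INR n + 1)) 1) (fun n => A * Rpower (/ (INR n + 1)) (1 - tau) / (1 - tau))) as [I HI].
  - intros n m Hnm. apply Hdiff; try apply Hn.
    assert (T := pos_INR n). apply le_INR in Hnm. apply Rinv_le_contravar; lra.
  - exact Hsm.
  - exists I. intros e He. apply le_epsilon. intros eps Heps.
    destruct (Hsm eps Heps) as [N1 H1].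
    destruct (INR_unbounded (/ e)) as [N2 HN2].
    set (n := (N1 + N2)%nat). specialize (H1 n ltac:(unfold n; lia)). specialize (HI n).
    assert (Hne : / (INR n + 1) <= e).
    { rewrite <- (Rinv_inv e). apply Rinv_le_contravar; [apply Rinv_0_lt_compat; lra|].
      assert (INR N2 <= INR n) by (apply le_INR; unfold n; lia). lra. }
    assert (A1 := Hdiff (/ (INR n + 1)) e (proj1 (Hn n)) Hne (proj2 He)).
    assert (T := Cmod_dist_triangle (IntC f e 1) (IntC f (/ (INR n + 1)) 1) I).
    rewrite (Cmod_minus_sym (IntC f e 1) (IntC f (/ (INR n + 1)) 1)) in T. lra.
Qed.

Lemma is_RInt_exp_half (a b : R) :
  is_RInt (fun t => exp (- t / 2)) a b (2 * exp (- a / 2) - 2 * exp (- b / 2)).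
Proof.
  replace (2 * exp (- a / 2) - 2 * exp (- b / 2)) with
    (minus (- 2 * exp (- b / 2)) (- 2 * exp (- a / 2))) by (unfold minus, plus, opp; simpl; ring).
  apply (is_RInt_derive (V := R_CompleteNormedModule) (fun t => - 2 * exp (- t / 2))).
  - intros x _. auto_derive; [exact I | unfold Rdiv; field].
  - intros x _. apply (ex_derive_continuous (V := R_NormedModule)). auto_derive. exact I.
Qed.

Lemma exp_neg_small (eps : R) : 0 < eps -> exists x0, 1 <= x0 /\ forall x, x0 <= x -> exp (- x / 2) < eps.
Proof.
  intros He. exists (Rmax 1 (1 - 2 * ln eps)). split; [apply Rmax_l|]. intros x Hx.
  assert (T := Rmax_r 1 (1 - 2 * ln eps)). rewrite <- (exp_ln eps He). apply exp_increasing. lra.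
Qed.

Lemma improper_at_infinity (f : R -> C) (B : R) : 0 <= B ->
  (forall t, 1 <= t -> contC f t) -> (forall t, 1 <= t -> Cmod (f t) <= B * exp (- t / 2)) ->
  exists I, forall x, 1 <= x -> Cmod (IntC f 1 x - I) <= 2 * B * exp (- x / 2).
Proof.
  intros HB Hc Hb.
  assert (Hint : forall x y, 1 <= x -> x <= y -> intC f x y (IntC f x y)).
  { intros x y Hx Hxy. apply intC_cont. intros t Ht. rewrite Rmin_left, Rmax_right in Ht by lra. apply Hc; lra. }
  assert (Hdiff : forall x y, 1 <= x -> x <= y ->
    Cmod (IntC f 1 y - IntC f 1 x) <= 2 * B * exp (- x / 2)).
  { intros x y Hx Hxy.
    assert (I1 := intC_Chasles f 1 x y _ _ (Hint 1 x ltac:(lra) Hx) (Hint x y Hx Hxy)).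
    rewrite (intC_unique _ _ _ _ _ (Hint 1 y ltac:(lra) ltac:(lra)) I1).
    replace (IntC f 1 x + IntC f x y - IntC f 1 x)%C with (IntC f x y) by ring.
    assert (B1 : Cmod (IntC f x y) <= B * (2 * exp (- x / 2) - 2 * exp (- y / 2))).
    { apply (intC_bound f (fun t => B * exp (- t / 2)) x y _ _ Hxy).
      - intros t Ht. apply Hb. lra.
      - apply Hint; assumption.
      - apply (is_RInt_scal (V := R_NormedModule)), is_RInt_exp_half. }
    assert (T := exp_pos (- y / 2)). nra. }
  assert (Hsm : forall eps, 0 < eps -> exists N, forall n, (N <= n)%nat -> 2 * B * exp (- (INR n + 1) / 2) < eps).
  { intros eps He. destruct (exp_neg_small (eps / (2 * B + 1))) as [x0 [Hx0 H]]; [apply Rdiv_lt_0_compat; lra|].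
    destruct (INR_unbounded x0) as [N HN]. exists N. intros n Hn. apply le_INR in Hn.
    specialize (H (INR n + 1) ltac:(lra)). assert (T := exp_pos (- (INR n + 1) / 2)).
    apply Rle_lt_trans with ((2 * B + 1) * exp (- (INR n + 1) / 2)); [nra|].
    apply (Rmult_lt_compat_l (2 * B + 1)) in H; [|lra].
    replace ((2 * B + 1) * (eps / (2 * B + 1))) with eps in H by (field; lra). exact H. }
  destruct (C_cauchy_limit (fun n => IntC f 1 (INR n + 1)) (fun n => 2 * B * exp (- (INR n + 1) / 2))) as [I HI].
  - intros n m Hnm. apply le_INR in Hnm. assert (T := pos_INR n). apply Hdiff; lra.
  - exact Hsm.
  - exists I. intros x Hx. apply le_epsilon. intros eps Heps.
    destruct (Hsm eps Heps) as [N1 H1]. destruct (INR_unbounded x) as [N2 HN2].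
    set (n := (N1 + N2)%nat). specialize (H1 n ltac:(unfold n; lia)). specialize (HI n).
    assert (INR N2 <= INR n) by (apply le_INR; unfold n; lia).
    assert (A1 := Hdiff x (INR n + 1) Hx ltac:(lra)).
    assert (T := Cmod_dist_triangle (IntC f 1 x) (IntC f 1 (INR n + 1)) I).
    rewrite (Cmod_minus_sym (IntC f 1 x) (IntC f 1 (INR n + 1))) in T. lra.
Qed.

Definition gamma_integrand (p : C) (t : R) : C := (Rcpow t (p - 1) * RtoC (exp (- t)))%C.

Lemma contC_gamma_integrand (p : C) (t : R) : 0 < t -> contC (gamma_integrand p) t.
Proof.
  intros Ht. apply contC_mult; [apply contC_Rcpow, Ht|]. apply contC_RtoC.
  apply (ex_derive_continuous (V := R_NormedModule)). auto_derive. exact I.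
Qed.

(** From ln q <= q with q = t / (2 a): half of the exponential absorbs the power. *)
Lemma Rpower_exp_bound (a t : R) : 0 < a -> 0 < t ->
  Rpower t a * exp (- t) <= Rpower (2 * a) a * exp (- t / 2).
Proof.
  intros Ha Ht. unfold Rpower. rewrite <- !exp_plus. apply exp_le.
  assert (H : ln t <= ln (2 * a) + t / (2 * a)).
  { replace t with (2 * a * (t / (2 * a))) at 1 by (field; lra).
    assert (Hq : 0 < t / (2 * a)) by (apply Rdiv_lt_0_compat; lra).
    rewrite ln_mult by lra. apply Rplus_le_compat_l.
    assert (T := exp_ineq1_le (ln (t / (2 * a)))). rewrite exp_ln in T by exact Hq. lra. }
  apply (Rmult_le_compat_l a) in H; [|lra].
  replace (a * (ln (2 * a) + t / (2 * a))) with (a * ln (2 * a) + t / 2) in H by (field; lra). lra.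
Qed.

Lemma gamma_integrand_bound_0 (p : C) (t : R) : 0 < t ->
  Cmod (gamma_integrand p t) <= 1 * Rpower t (- (1 - Re p)).
Proof.
  intros Ht. unfold gamma_integrand. rewrite Cmod_mult, Cmod_Rcpow, Cmod_R, Rabs_pos_eq by (apply Rlt_le, exp_pos).
  rewrite Re_minus. simpl (Re 1). replace (- (1 - Re p)) with (Re p - 1) by ring. rewrite Rmult_comm.
  apply Rmult_le_compat_r; [apply Rlt_le, Rpower_pos|].
  rewrite <- exp_0. apply exp_le. lra.
Qed.

Lemma gamma_integrand_bound_infinity (p : C) (a t : R) : 0 < a -> Re p - 1 <= a -> 1 <= t ->
  Cmod (gamma_integrand p t) <= Rpower (2 * a) a * exp (- t / 2).
Proof.
  intros Ha Hp Ht. unfold gamma_integrand. rewrite Cmod_mult, Cmod_Rcpow, Cmod_R, Rabs_pos_eq by (apply Rlt_le, exp_pos).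
  eapply Rle_trans; [|apply Rpower_exp_bound; lra].
  apply Rmult_le_compat_r; [apply Rlt_le, exp_pos|]. apply Rpower_le_exp; [exact Ht|].
  rewrite Re_minus. simpl. exact Hp.
Qed.

Lemma intC_gamma_integrand (p : C) (e x : R) : 0 < e -> e <= x ->
  intC (gamma_integrand p) e x (IntC (gamma_integrand p) e x).
Proof.
  intros He Hx. apply intC_cont. intros t Ht. rewrite Rmin_left in Ht by exact Hx.
  apply contC_gamma_integrand. lra.
Qed.

(** The only place where Euler's integral is opened: once its limit is identified, all later
    arguments work with truncated integrals and this error bound, which is explicit enough to be
    uniform in [p]. *)
Lemma CGamma_approx (p : C) (a e x : R) : 0 < Re p -> 0 < a -> Re p - 1 <= a -> 0 < e <= 1 -> 1 <= x ->
  Cmod (IntC (gamma_integrand p) e x - CGamma p)%C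
  <= Rpower e (Re p) / Re p + 2 * Rpower (2 * a) a * exp (- x / 2).
Proof.
  intros Hp Ha Hpa. revert e x.
  set (B := Rpower (2 * a) a). assert (HB : 0 <= B) by apply Rlt_le, Rpower_pos.
  destruct (improper_at_0 (gamma_integrand p) 1 (1 - Re p)) as [I0 H0]; [lra | lra | | |].
  { intros t Ht. apply contC_gamma_integrand; lra. }
  { intros t Ht. apply gamma_integrand_bound_0; lra. }
  destruct (improper_at_infinity (gamma_integrand p) B HB) as [I1 H1].
  { intros t Ht. apply contC_gamma_integrand; lra. }
  { intros t Ht. apply gamma_integrand_bound_infinity; assumption. }
  assert (Happ : forall e x, 0 < e <= 1 -> 1 <= x -> Cmod (IntC (gamma_integrand p) e x - (I0 + I1))%C
     <= Rpower e (Re p) / Re p + 2 * B * exp (- x / 2)).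
  { intros e x He Hx. specialize (H0 e He). specialize (H1 x Hx).
    assert (Ic := intC_Chasles _ _ _ _ _ _ (intC_gamma_integrand p e 1 (proj1 He) (proj2 He)) (intC_gamma_integrand p 1 x ltac:(lra) Hx)).
    rewrite (intC_unique _ _ _ _ _ (intC_gamma_integrand p e x (proj1 He) ltac:(lra)) Ic).
    replace (_ - _)%C with ((IntC (gamma_integrand p) e 1 - I0) + (IntC (gamma_integrand p) 1 x - I1))%C by ring.
    eapply Rle_trans; [apply Cmod_triangle|]. replace (1 - (1 - Re p)) with (Re p) in H0 by ring. lra. }
  assert (HG : CGamma p = (I0 + I1)%C).
  { unfold CGamma. apply (is_RInt_gen_unique (V := C_R_CompleteNormedModule)).
    intros P HP. apply locally_C in HP. destruct HP as [d [Hd HP]].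
    destruct (Rpower_small_at_0 (Re p) (d / 2 * Re p)) as [e0 [He0 Hsm]]; [exact Hp | apply Rmult_lt_0_compat; lra|].
    destruct (exp_neg_small (d / 2 / (2 * B + 1))) as [x0 [Hx0 Hsx]]; [apply Rdiv_lt_0_compat; lra|].
    apply Filter_prod with (fun e => 0 < e < Rmin 1 e0) (fun x => x0 < x).
    - assert (Hm : 0 < Rmin 1 e0) by (apply Rmin_pos; lra).
      exists (mkposreal _ Hm). intros y Hy Hy0. change (Rabs (y - 0) < Rmin 1 e0) in Hy.
      rewrite Rminus_0_r in Hy. apply Rabs_def2 in Hy. lra.
    - exists x0. intros y Hy. exact Hy.
    - intros e y [He1 He2] Hy. simpl.
      assert (m1 := Rmin_l 1 e0). assert (m2 := Rmin_r 1 e0).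
      exists (IntC (gamma_integrand p) e y). split; [apply intC_gamma_integrand; lra|].
      apply HP. eapply Rle_lt_trans; [apply Happ; lra|].
      specialize (Hsm e He1 ltac:(lra)). specialize (Hsx y ltac:(lra)).
      assert (Rpower e (Re p) / Re p < d / 2).
      { apply Rmult_lt_reg_r with (Re p); [exact Hp|]. unfold Rdiv at 1. rewrite Rmult_assoc, Rinv_l; lra. }
      assert (2 * B * exp (- y / 2) < d / 2).
      { assert (Te := exp_pos (- y / 2)).
        apply Rle_lt_trans with ((2 * B + 1) * exp (- y / 2)); [nra|].
        apply (Rmult_lt_compat_l (2 * B + 1)) in Hsx; [|lra].
        replace ((2 * B + 1) * (d / 2 / (2 * B + 1))) with (d / 2) in Hsx by (field; lra). exact Hsx. }
      lra. }
  rewrite HG. exact Happ.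
Qed.

Definition gamma_cut (n : nat) (p : C) : C := IntC (gamma_integrand p) (/ (INR n + 1)) (INR n + 1).

Lemma gamma_cut_uniform (s0 s1 eps : R) : 0 < s0 -> 0 < eps ->
  exists N, forall n (p : C), (N <= n)%nat -> s0 <= Re p <= s1 -> Cmod (gamma_cut n p - CGamma p) < eps.
Proof.
  intros Hs0 He. set (a := Rabs s1 + 1). assert (Ha : 0 < a) by (unfold a; assert (T := Rabs_pos s1); lra).
  set (B := Rpower (2 * a) a). assert (HB : 0 < B) by apply Rpower_pos.
  destruct (Rpower_lt_small_nat s0 (eps / 2 * s0)) as [N1 H1]; [exact Hs0 | apply Rmult_lt_0_compat; lra |].
  destruct (exp_neg_small (eps / 2 / (2 * B))) as [x0 [Hx0 H2]]; [apply Rdiv_lt_0_compat; lra|].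
  destruct (INR_unbounded x0) as [N2 HN2].
  exists (N1 + N2)%nat. intros n p Hn Hp. assert (Tn := pos_INR n).
  assert (Hn2 : INR N2 <= INR n) by (apply le_INR; lia).
  specialize (H1 n 1 ltac:(lia) ltac:(lra)). specialize (H2 (INR n + 1) ltac:(lra)).
  assert (He1 : 0 < / (INR n + 1) <= 1).
  { split; [apply Rinv_0_lt_compat; lra|]. rewrite <- Rinv_1 at 2. apply Rinv_le_contravar; lra. }
  eapply Rle_lt_trans; [apply (CGamma_approx p a); try lra|].
  { unfold a. assert (T := Rle_abs s1). lra. }
  fold B.
  assert (E1 : Rpower (/ (INR n + 1)) (Re p) / Re p < eps / 2).
  { replace (Rpower (/ (INR n + 1)) (Re p)) with (Rpower (INR n + 1) (- Re p))
      by (unfold Rpower; rewrite ln_Rinv by lra; f_equal; ring).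
    assert (Rpower (INR n + 1) (- Re p) <= Rpower (INR n + 1) (- s0)) by (apply Rpower_le_exp; lra).
    apply Rmult_lt_reg_r with (Re p); [lra|]. unfold Rdiv at 1. rewrite Rmult_assoc, Rinv_l by lra. nra. }
  apply (Rmult_lt_compat_l (2 * B)) in H2; [|lra].
  replace (2 * B * (eps / 2 / (2 * B))) with (eps / 2) in H2 by (field; lra). lra.
Qed.

(** On the ball of radius Re z0 / 2 the real part stays between Re z0 / 2 and 2 Re z0, where the
    truncations converge uniformly. The further factor 1 / 4 is that of [QH_uniform_limit]. *)
Lemma QH_CGamma (z0 : C) : 0 < Re z0 -> QH CGamma z0 (Re z0 / 2 / 4).
Proof.
  intros Hz. apply (QH_uniform_limit gamma_cut); [lra | |].
  - intros n. assert (Tn := pos_INR n).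
    assert (He1 : 0 < / (INR n + 1) <= INR n + 1).
    { split; [apply Rinv_0_lt_compat; lra|]. apply Rle_trans with 1; [|lra].
      rewrite <- Rinv_1. apply Rinv_le_contravar; lra. }
    apply (QH_integral ln (fun t => Cexp (- RtoC (ln t)) * RtoC (exp (- t)))%C (/ (INR n + 1)) (INR n + 1)); [lra | lra | | |].
    + intros t Ht. apply continuous_ln_pos; lra.
    + intros t Ht. apply contC_mult.
      * apply contC_Cexp, contC_opp, contC_RtoC, continuous_ln_pos; lra.
      * apply contC_RtoC, (ex_derive_continuous (V := R_NormedModule)). auto_derive. exact I.
    + intros z _. apply (intC_ext (gamma_integrand z)); [|apply intC_gamma_integrand; lra].
      intros t _. unfold gamma_integrand, Rcpow. rewrite Cmult_assoc. f_equal.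
      rewrite <- Cexp_plus. f_equal. ring.
  - intros eps He. destruct (gamma_cut_uniform (Re z0 / 2) (2 * Re z0) eps ltac:(lra) He) as [N HN].
    exists N. intros n z Hn Hzz. apply HN; [exact Hn|].
    assert (T := re_le_Cmod (z - z0)%C). rewrite Re_minus in T. apply Rabs_le_between in T. lra.
Qed.

(** Integration by parts on the truncated integrals; both boundary terms vanish in the limit. *)
Lemma CGamma_plus_1 (p : C) : 0 < Re p -> CGamma (p + 1) = (p * CGamma p)%C.
Proof.
  intros Hp.
  assert (Hparts : forall n, gamma_cut n (p + 1)%C = (p * gamma_cut n p -
     (Rcpow (INR n + 1) p * RtoC (exp (- (INR n + 1))) - Rcpow (/ (INR n + 1)) p * RtoC (exp (- / (INR n + 1)))))%C).
  { intros n. assert (Tn := pos_INR n).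
    assert (He1 : 0 < / (INR n + 1) <= INR n + 1).
    { split; [apply Rinv_0_lt_compat; lra|]. apply Rle_trans with 1; [|lra].
      rewrite <- Rinv_1. apply Rinv_le_contravar; lra. }
    assert (D : forall t, 0 < t -> derivC (fun t => Rcpow t p * RtoC (exp (- t)))%C t
       (p * gamma_integrand p t - gamma_integrand (p + 1) t)%C).
    { intros t Ht. eapply derivC_eq.
      - apply derivC_mult; [apply derivC_Rcpow, Ht|].
        apply (derivC_RtoC (fun t => exp (- t)) t (- exp (- t))). auto_derive; [exact I | ring].
      - unfold gamma_integrand. replace (p + 1 - 1)%C with p by ring. rewrite RtoC_opp. ring. }
    assert (I := intC_derive (fun t => Rcpow t p * RtoC (exp (- t)))%C
      (fun t => p * gamma_integrand p t - gamma_integrand (p + 1) t)%C (/ (INR n + 1)) (INR n + 1)).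
    assert (I' := intC_minus _ _ _ _ _ _ (intC_mult_l p _ _ _ _ (intC_gamma_integrand p _ _ (proj1 He1) (proj2 He1)))
      (intC_gamma_integrand (p + 1)%C _ _ (proj1 He1) (proj2 He1))).

    assert (E := fun A B => intC_unique _ _ _ _ _ (I A B) I').
    unfold gamma_cut. rewrite E; [ring | |].
    - intros t Ht. rewrite Rmin_left in Ht by lra. apply D. lra.
    - intros t Ht. rewrite Rmin_left in Ht by lra.
      apply contC_minus; [apply contC_mult; [apply contC_const|]|]; apply contC_gamma_integrand; lra. }
  apply C_eq_eps. intros eps He.
  set (c := Cmod p + 1). assert (Hc : 0 < c) by (unfold c; assert (T := Cmod_ge_0 p); lra).
  destruct (gamma_cut_uniform (Re p) (Re p + 1) (eps / 4) Hp ltac:(lra)) as [N1 H1].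
  destruct (gamma_cut_uniform (Re p) (Re p + 1) (eps / 4 / c) Hp ltac:(apply Rdiv_lt_0_compat; lra)) as [N2 H2].
  destruct (Rpower_lt_small_nat (Re p) (eps / 4) Hp ltac:(lra)) as [N3 H3].
  set (B := Rpower (2 * Re p) (Re p)). assert (HB : 0 < B) by apply Rpower_pos.
  destruct (exp_neg_small (eps / 4 / B)) as [x0 [Hx0 H4]]; [apply Rdiv_lt_0_compat; lra|].
  destruct (INR_unbounded x0) as [N4 HN4].
  set (n := (N1 + N2 + N3 + N4)%nat). assert (Tn := pos_INR n).
  assert (INR N4 <= INR n) by (apply le_INR; unfold n; lia).
  specialize (H1 n (p + 1)%C ltac:(unfold n; lia)). specialize (H2 n p ltac:(unfold n; lia)).
  specialize (H3 n 1 ltac:(unfold n; lia) ltac:(lra)). specialize (H4 (INR n + 1) ltac:(lra)).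
  rewrite re_plus in H1. simpl (Re 1) in H1. specialize (H1 ltac:(lra)). specialize (H2 ltac:(lra)).
  rewrite Hparts in H1.
  set (b1 := (Rcpow (INR n + 1) p * RtoC (exp (- (INR n + 1))))%C) in *.
  set (b0 := (Rcpow (/ (INR n + 1)) p * RtoC (exp (- / (INR n + 1))))%C) in *.
  assert (Hb1 : Cmod b1 <= eps / 4).
  { unfold b1. rewrite Cmod_mult, Cmod_Rcpow, Cmod_R, Rabs_pos_eq by (apply Rlt_le, exp_pos).
    eapply Rle_trans; [apply Rpower_exp_bound; lra|]. fold B.
    apply (Rmult_lt_compat_l B) in H4; [|lra]. replace (B * (eps / 4 / B)) with (eps / 4) in H4 by (field; lra). lra. }
  assert (Hb0 : Cmod b0 <= eps / 4).
  { unfold b0. rewrite Cmod_mult, Cmod_Rcpow, Cmod_R, Rabs_pos_eq by (apply Rlt_le, exp_pos).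
    replace (Rpower (/ (INR n + 1)) (Re p)) with (Rpower (INR n + 1) (- Re p))
      by (unfold Rpower; rewrite ln_Rinv by lra; f_equal; ring).
    assert (exp (- / (INR n + 1)) <= 1).
    { apply Rle_trans with (exp 0); [apply exp_le|right; apply exp_0]. assert (0 < / (INR n + 1)) by (apply Rinv_0_lt_compat; lra). lra. }
    assert (T := Rpower_pos (INR n + 1) (- Re p)). assert (T2 := exp_pos (- / (INR n + 1))). nra. }
  assert (Hpg : Cmod (p * (gamma_cut n p - CGamma p)) <= eps / 4).
  { rewrite Cmod_mult. apply Rle_trans with (c * (eps / 4 / c)); [apply Rmult_le_compat; unfold c in *; try apply Cmod_ge_0; lra|].
    right; field; lra. }
  replace (CGamma (p + 1) - p * CGamma p)%C with
    (- (p * gamma_cut n p - (b1 - b0) - CGamma (p + 1)) + p * (gamma_cut n p - CGamma p) + - b1 + b0)%C by ring.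
  eapply Rle_trans; [apply Cmod_triangle|]. eapply Rle_trans; [apply Rplus_le_compat_r, Cmod_triangle|].
  eapply Rle_trans; [apply Rplus_le_compat_r, Rplus_le_compat_r, Cmod_triangle|].
  rewrite !Cmod_opp. lra.
Qed.

(** * Oscillatory Mellin integrals *)

(* Cauchy's theorem for the parallelogram spanned by [a, b] and D th0. *)
Lemma integral_segment_shift (E : C -> C) (D : C) (a b th0 : R) :
  a <= b -> 0 <= th0 -> Cmod D = 1 -> (forall r, 0 < r -> QH E 0 r) ->
  intC (fun th => D * (E (RtoC b + D * RtoC th) - E (RtoC a + D * RtoC th)))%C 0 th0
   (IntC (fun x => E (RtoC x + D * RtoC th0)%C) a b - IntC (fun x => E (RtoC x + D * RtoC 0)%C) a b)%C.
Proof.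
  intros Hab Hth HD HE.
  set (r := Rabs a + Rabs b + th0 + 4).
  assert (Hr : 0 < r) by (unfold r; assert (T1 := Rabs_pos a); assert (T2 := Rabs_pos b); lra).
  destruct (HE r Hr) as [E' [K [HK F1]]].
  assert (HL := QH_deriv_Lipschitz E E' 0 r K F1).
  assert (Hin : forall x th, a - 1 < x < b + 1 -> -1 < th < th0 + 1 -> Cmod (RtoC x + D * RtoC th - 0) < r).
  { intros x th Hx Ht. rewrite Cminus_0_r. eapply Rle_lt_trans; [apply Cmod_triangle|].
    rewrite Cmod_mult, HD, !Cmod_R, Rmult_1_l. unfold r.
    assert (Rabs x < Rabs a + Rabs b + 1) by (unfold Rabs; repeat destruct Rcase_abs; lra).
    assert (Rabs th < th0 + 2) by (apply Rabs_def1; lra). lra. }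
  assert (Dx : forall th x, a <= x <= b -> -1 < th < th0 + 1 ->
    derivC (fun x => E (RtoC x + D * RtoC th)%C) x (E' (RtoC x + D * RtoC th)%C)).
  { intros th x Hx Ht. eapply derivC_eq.
    - apply (derivC_comp_QH E E' 0 r K (fun x => RtoC x + D * RtoC th)%C x 1%C F1 HK (Hin x th ltac:(lra) Ht)).
      eapply derivC_eq; [apply derivC_plus; [apply derivC_id | apply derivC_const] | ring].
    - ring. }
  assert (Dth : forall th x, a <= x <= b -> -1 < th < th0 + 1 ->
    derivC (fun th => E (RtoC x + D * RtoC th)%C) th (D * E' (RtoC x + D * RtoC th))%C).
  { intros th x Hx Ht. apply (derivC_comp_QH E E' 0 r K (fun th => RtoC x + D * RtoC th)%C th D F1 HK (Hin x th ltac:(lra) Ht)).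
    eapply derivC_eq; [apply derivC_plus; [apply derivC_const | apply derivC_mult; [apply derivC_const | apply derivC_id]] | ].
    cbv beta. ring. }
  assert (CE : forall th x, a <= x <= b -> -1 < th < th0 + 1 -> contC (fun x => E' (RtoC x + D * RtoC th)%C) x).
  { intros th x Hx Ht. apply contC_eps. intros eps He.
    exists (Rmin 1 (eps / (2 * K + 1))). split; [apply Rmin_pos; [lra | apply Rdiv_lt_0_compat; lra]|].
    intros y Hy. assert (Hy1 := Rlt_le_trans _ _ _ Hy (Rmin_l _ _)). assert (Hyx := Rlt_le_trans _ _ _ Hy (Rmin_r _ _)).
    apply Rabs_def2 in Hy1.
    eapply Rle_lt_trans; [apply HL; apply Hin; lra|].
    replace (RtoC y + D * RtoC th - (RtoC x + D * RtoC th))%C with (RtoC (y - x)) by (rewrite RtoC_minus; ring).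
    rewrite Cmod_R. apply Rle_lt_trans with ((2 * K + 1) * Rabs (y - x)); [assert (T := Rabs_pos (y - x)); nra|].
    apply (Rmult_lt_compat_l (2 * K + 1)) in Hyx; [|lra].
    replace ((2 * K + 1) * (eps / (2 * K + 1))) with eps in Hyx by (field; lra). exact Hyx. }
  assert (IE : forall th, -1 < th < th0 + 1 -> intC (fun x => E (RtoC x + D * RtoC th)%C) a b (IntC (fun x => E (RtoC x + D * RtoC th)%C) a b)).
  { intros th Ht. apply intC_cont. intros x Hx. rewrite Rmin_left, Rmax_right in Hx by exact Hab.
    eapply derivC_cont. apply Dx; assumption. }
  assert (IG : forall th, -1 < th < th0 + 1 -> intC (fun x => E' (RtoC x + D * RtoC th)%C) a b (E (RtoC b + D * RtoC th) - E (RtoC a + D * RtoC th))%C).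
  { intros th Ht. apply (intC_derive (fun x => E (RtoC x + D * RtoC th)%C)).
    - intros x Hx. rewrite Rmin_left, Rmax_right in Hx by exact Hab. apply Dx; assumption.
    - intros x Hx. rewrite Rmin_left, Rmax_right in Hx by exact Hab. apply CE; assumption. }
  (* The integral over the side at height [th] is differentiated in [th]. The derivative is D times
     the integral of E' along that side, that is, D times the difference of [E] at its ends. *)
  apply (intC_derive (fun th => IntC (fun x => E (RtoC x + D * RtoC th)%C) a b)).
  - intros th Ht. rewrite Rmin_left, Rmax_right in Ht by exact Hth.
    apply derivC_of_quadratic with ((b - a) * K) 1; [lra|].
    intros h Hh. apply Rabs_def2 in Hh.
    assert (I := intC_minus _ _ _ _ _ _ (intC_minus _ _ _ _ _ _ (IE (th + h) ltac:(lra)) (IE th ltac:(lra)))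
      (intC_mult_l (RtoC h * D)%C _ _ _ _ (IG th ltac:(lra)))).
    rewrite <- Cmult_assoc in I.
    rewrite Rmult_assoc. apply (intC_bound_const _ _ _ _ _ Hab) with (2 := I).
    intros x Hx.
    assert (Q := F1 (RtoC x + D * RtoC th)%C (RtoC x + D * RtoC (th + h))%C (Hin x th ltac:(lra) ltac:(lra)) (Hin x (th + h) ltac:(lra) ltac:(lra))).
    replace (RtoC x + D * RtoC (th + h) - (RtoC x + D * RtoC th))%C with (RtoC h * D)%C in Q by (rewrite RtoC_plus; ring).
    rewrite (Cmod_mult (RtoC h) D), HD, Cmod_R, Rmult_1_r, RPow_abs, Rabs_pos_eq in Q by apply pow2_ge_0.
    exact Q.
  - intros th Ht. rewrite Rmin_left, Rmax_right in Ht by exact Hth.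
    apply contC_mult; [apply contC_const|]. apply contC_minus; eapply derivC_cont; apply Dth; lra.
Qed.

(** With t = exp z the form t^(p - 1) exp (-t) dt becomes exp (p z - exp z) dz, with an entire
    integrand. Rotating the ray of integration is then a vertical translation of the real line, and
    no branch of the power has to be chosen. *)
Lemma QH_mellin_exponential (p : C) (r : R) : 0 < r -> QH (fun z => Cexp (p * z - Cexp z))%C 0 r.
Proof.
  intros Hr.
  assert (HC : forall z0 r, QH Cexp z0 r).
  { intros z0 r1. apply (QH_ext (fun z => Cexp (z * 1))%C); [intros; f_equal; ring | apply QH_Cexp_mult]. }
  assert (Hi : QH (fun z => p * z - Cexp z)%C 0 r).
  { apply QH_minus; [apply QH_mult; [apply QH_const | apply QH_id] | apply HC]. }
  destruct (QH_bounds _ _ _ Hr Hi) as [f' [K [B [HK [HB [_ [_ [F3 _]]]]]]]].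
  apply (QH_comp _ Cexp 0 0 r (B + 1)); [exact Hr | lra | exact Hi | apply HC|].
  intros z Hz. rewrite Cminus_0_r. specialize (F3 z Hz). simpl in F3. lra.
Qed.

Definition osc_integrand (k p : C) (t : R) : C := (Rcpow t (p - 1) * Cexp (- (k * RtoC t)))%C.

Lemma contC_osc_integrand (k p : C) (t : R) : 0 < t -> contC (osc_integrand k p) t.
Proof.
  intros Ht. apply contC_mult; [apply contC_Rcpow, Ht|]. apply contC_Cexp, contC_opp, contC_mult; [apply contC_const|].
  eapply derivC_cont, derivC_id.
Qed.

Lemma intC_osc_integrand (k p : C) (e x : R) : 0 < e -> e <= x ->
  intC (osc_integrand k p) e x (IntC (osc_integrand k p) e x).
Proof.
  intros He Hx. apply intC_cont. intros t Ht. rewrite Rmin_left in Ht by exact Hx.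
  apply contC_osc_integrand. lra.
Qed.

Lemma osc_exp_substitution (k p : C) (a b : R) : a <= b ->
  intC (fun x => Cexp (p * RtoC x - k * RtoC (exp x)))%C a b (IntC (osc_integrand k p) (exp a) (exp b)).
Proof.
  intros Hab.
  apply (intC_ext (fun y => scal (V := C_R_NormedModule) (exp y) (osc_integrand k p (exp y)))).
  - intros x _. unfold osc_integrand, Rcpow. rewrite ln_exp.
    replace (p * x - k * exp x)%C with (RtoC x + (p - 1) * x + - (k * exp x))%C by ring.
    rewrite !Cexp_plus, Cexp_RtoC. rewrite <- Cmult_assoc. Cparts.
  - apply (is_RInt_comp (V := C_R_CompleteNormedModule) (osc_integrand k p) exp exp).
    + intros x _. apply contC_osc_integrand, exp_pos.
    + intros x _. split; [apply is_derive_exp | apply continuous_exp].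
Qed.

(** A weak form of Jordan's inequality. Up to pi / 6 the derivative cos is at least 1 / 2; beyond
    that sin x itself is at least 1 / 2, while x <= pi / 2 <= 2. *)
Lemma sin_ge_quarter (x : R) : 0 <= x -> x <= PI / 2 -> x / 4 <= sin x.
Proof.
  intros H0 H1. assert (Hp := PI_RGT_0). assert (Hp4 := PI_4).
  destruct (Rle_dec x (PI / 6)) as [Hx|Hx].
  - destruct (MVT_gen sin 0 x cos) as [c [Hc E]].
    + intros t _. apply is_derive_sin.
    + intros t _. apply continuity_sin.
    + rewrite Rmin_left, Rmax_right in Hc by exact H0. rewrite sin_0 in E.
      assert (T : 1 / 2 <= cos c).
      { rewrite <- cos_PI3. apply cos_decr_1; lra. }
      nra.
  - assert (T : 1 / 2 <= sin x); [|lra].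
    rewrite <- sin_PI6. apply sin_incr_1; lra.
Qed.

Lemma is_RInt_jordan (x : R) : 0 < x ->
  exists v, is_RInt (fun th => exp (- x * ((PI / 2 - th) / 4))) 0 (PI / 2) v /\ v <= 4 / x.
Proof.
  intros Hx.
  exists (4 / x * exp (- x * ((PI / 2 - PI / 2) / 4)) - 4 / x * exp (- x * ((PI / 2 - 0) / 4))).
  split.
  - apply (is_RInt_derive (V := R_CompleteNormedModule) (fun th => 4 / x * exp (- x * ((PI / 2 - th) / 4)))).
    + intros th _. auto_derive; [exact I|]. unfold Rdiv, Rminus. field. lra.
    + intros th _. apply (ex_derive_continuous (V := R_NormedModule)). auto_derive. exact I.
  - replace (- x * ((PI / 2 - PI / 2) / 4)) with 0 by field. rewrite exp_0.
    assert (T := exp_pos (- x * ((PI / 2 - 0) / 4))).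
    assert (0 < 4 / x) by (apply Rdiv_lt_0_compat; lra). nra.
Qed.

(** The two error terms are the vertical sides of the rectangle, that is, the arcs of a quarter
    sector; [d] selects the upper or the lower quadrant. On the outer arc exp (-x cos theta)
    integrates to at most 4 / x by Jordan's inequality, and the inner arc is O(e^(Re p)). Since pi /
    2 <= 2, the factor exp (2 |Im p|) bounds |exp (i d theta p)|. *)
Lemma mellin_rotation (p : C) (d e x : R) : d = 1 \/ d = -1 -> 0 < Re p -> 0 < e -> e <= 1 -> 1 <= x ->
  Cmod (Cexp (Ci * RtoC (d * (PI / 2)) * p) * IntC (osc_integrand (Ci * RtoC d) p) e x
        - IntC (gamma_integrand p) e x)%C
  <= exp (Rabs (Im p) * 2) * (4 * Rpower x (Re p - 1) + 2 * Rpower e (Re p)).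
Proof.
  intros Hd Hp He He1 Hx. assert (Hpi := PI_RGT_0). assert (Hpi4 := PI_4).
  set (a := ln e). set (b := ln x). set (D := (Ci * RtoC d)%C).
  assert (Ea : exp a = e) by (apply exp_ln; lra). assert (Eb : exp b = x) by (apply exp_ln; lra).
  assert (Hab : a <= b).
  { unfold a, b. destruct (Rle_lt_or_eq_dec e x ltac:(lra)) as [H|H]; [left; apply ln_increasing; lra | right; f_equal; exact H]. }
  assert (HD : Cmod D = 1).
  { unfold D. rewrite Cmod_mult, Cmod_Ci, Cmod_R. destruct Hd as [-> | ->]; unfold Rabs; destruct Rcase_abs; lra. }
  set (E := fun z => Cexp (p * z - Cexp z)).
  assert (I := integral_segment_shift E D a b (PI / 2) Hab ltac:(lra) HD (QH_mellin_exponential p)).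
  assert (HE : forall t th, E (RtoC t + D * RtoC th)%C =
     (Cexp (D * RtoC th * p) * Cexp (p * RtoC t - Cexp (D * RtoC th) * RtoC (exp t)))%C).
  { intros t th. unfold E. rewrite <- Cexp_plus. f_equal. rewrite Cexp_plus, Cexp_RtoC. ring. }
  assert (Hend : forall th, IntC (fun t => E (RtoC t + D * RtoC th)%C) a b =
     (Cexp (D * RtoC th * p) * IntC (osc_integrand (Cexp (D * RtoC th)) p) e x)%C).
  { intros th. apply (is_RInt_unique (V := C_R_CompleteNormedModule)).
    assert (O := intC_mult_l (Cexp (D * RtoC th * p)) _ _ _ _ (osc_exp_substitution (Cexp (D * RtoC th)) p a b Hab)).
    rewrite Ea, Eb in O. eapply intC_ext; [|exact O]. intros t _. simpl. symmetry. apply HE. }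
  rewrite !Hend in I.
  replace (Cexp (D * RtoC (PI / 2))) with D in I.
  2:{ unfold D. replace (Ci * d * RtoC (PI / 2))%C with (Ci * RtoC (d * (PI / 2)))%C by (rewrite RtoC_mult; ring).
      rewrite Cexp_Ci. destruct Hd as [-> | ->].
      - rewrite Rmult_1_l, cos_PI2, sin_PI2. Cparts.
      - replace (-1 * (PI / 2)) with (- (PI / 2)) by ring. rewrite cos_neg, sin_neg, cos_PI2, sin_PI2. Cparts. }
  replace (D * RtoC (PI / 2) * p)%C with (Ci * RtoC (d * (PI / 2)) * p)%C in I by (unfold D; rewrite RtoC_mult; ring).
  replace (D * RtoC 0 * p)%C with (RtoC 0) in I by ring. replace (D * RtoC 0)%C with (RtoC 0) in I by ring.
  rewrite Cexp_0, Cmult_1_l in I.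
  replace (IntC (osc_integrand 1 p) e x) with (IntC (gamma_integrand p) e x) in I.
  2:{ symmetry. apply (is_RInt_unique (V := C_R_CompleteNormedModule)).
      apply (intC_ext (gamma_integrand p)); [|apply intC_gamma_integrand; lra].
      intros t _. unfold gamma_integrand, osc_integrand. f_equal. rewrite Cmult_1_l, <- RtoC_opp, Cexp_RtoC. reflexivity. }
  fold D.
  set (c := exp (Rabs (Im p) * 2)).
  assert (Hc : 0 < c) by apply exp_pos.
  assert (HB : forall t th, 0 <= th <= PI / 2 -> Cmod (E (RtoC t + D * RtoC th)%C) <= c * (Rpower (exp t) (Re p) * exp (- exp t * cos th))).
  { intros t th Hth. rewrite HE, Cmod_mult, !Cmod_Cexp. unfold c, Rpower. rewrite ln_exp, <- !exp_plus.
    apply exp_le. rewrite Re_minus.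
    replace (D * RtoC th)%C with (Ci * RtoC (d * th))%C by (unfold D; rewrite RtoC_mult; ring).
    rewrite Cexp_Ci.
    replace (cos (d * th)) with (cos th).
    2:{ destruct Hd as [-> | ->]; [f_equal; ring|]. replace (-1 * th) with (- th) by ring. symmetry; apply cos_neg. }
    rewrite !re_mult. simpl.
    assert (T : - (d * th * Im p) <= Rabs (Im p) * 2).
    { eapply Rle_trans; [apply Rle_abs|]. rewrite Rabs_Ropp, !Rabs_mult, (Rabs_pos_eq th) by lra.
      replace (Rabs d) with 1 by (destruct Hd as [-> | ->]; unfold Rabs; destruct Rcase_abs; lra).
      assert (T2 := Rabs_pos (Im p)). nra. }
    unfold Re, Im in *. lra. }
  destruct (is_RInt_jordan x ltac:(lra)) as [v [Hv Hv4]].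
  assert (Hfin : Cmod (Cexp (Ci * RtoC (d * (PI / 2)) * p) * IntC (osc_integrand D p) e x - IntC (gamma_integrand p) e x)%C
     <= c * Rpower x (Re p) * v + (PI / 2 - 0) * (c * Rpower e (Re p))).
  { apply (intC_bound _ (fun th => c * Rpower x (Re p) * exp (- x * ((PI / 2 - th) / 4)) + c * Rpower e (Re p)) 0 (PI / 2) _ _ ltac:(lra)) with (2 := I).
    - intros th Hth. rewrite Cmod_mult, HD, Rmult_1_l. unfold Cminus.
      eapply Rle_trans; [apply Cmod_triangle|]. rewrite Cmod_opp.
      assert (B1 := HB b th Hth). assert (B2 := HB a th Hth). rewrite Ea in B2. rewrite Eb in B1.
      assert (Hcos : (PI / 2 - th) / 4 <= cos th).
      { rewrite <- sin_shift. apply sin_ge_quarter; lra. }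
      apply Rplus_le_compat.
      + eapply Rle_trans; [exact B1|]. rewrite <- Rmult_assoc.
        apply Rmult_le_compat_l; [apply Rmult_le_pos; [lra | apply Rlt_le, Rpower_pos]|].
        apply exp_le. nra.
      + eapply Rle_trans; [exact B2|]. apply Rmult_le_compat_l; [lra|].
        rewrite <- (Rmult_1_r (Rpower e (Re p))) at 2.
        apply Rmult_le_compat_l; [apply Rlt_le, Rpower_pos|].
        rewrite <- exp_0. apply exp_le. assert (0 <= (PI / 2 - th) / 4) by lra. nra.
    - apply (is_RInt_plus (V := R_NormedModule)).
      + apply (is_RInt_scal (V := R_NormedModule)), Hv.
      + apply (is_RInt_const (V := R_NormedModule)). }
  eapply Rle_trans; [exact Hfin|].
  assert (Hx1 : Rpower x (Re p) * (4 / x) = 4 * Rpower x (Re p - 1)).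
  { unfold Rminus. rewrite Rpower_plus, Rpower_Ropp, Rpower_1 by lra. field. lra. }
  assert (T1 := Rpower_pos x (Re p)). assert (T2 := Rpower_pos e (Re p)).
  assert (Rpower x (Re p) * v <= 4 * Rpower x (Re p - 1)).
  { rewrite <- Hx1. apply Rmult_le_compat_l; lra. }
  assert (c * (Rpower x (Re p) * v) <= c * (4 * Rpower x (Re p - 1))) by (apply Rmult_le_compat_l; lra).
  assert ((PI / 2 - 0) * (c * Rpower e (Re p)) <= 2 * (c * Rpower e (Re p))).
  { apply Rmult_le_compat_r; [|lra]. apply Rmult_le_pos; lra. }
  lra.
Qed.

(** The outer arc dies because Re p < 1, the inner one because Re p > 0. The limit is (i d)^(-p)
    Gamma (p). *)
Lemma osc_integral_limit (p : C) (d eps : R) : d = 1 \/ d = -1 -> 0 < Re p < 1 -> 0 < eps ->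
  exists e0 x0, 0 < e0 <= 1 /\ 1 <= x0 /\ forall e x, 0 < e <= e0 -> x0 <= x ->
    Cmod (IntC (osc_integrand (Ci * RtoC d) p) e x - Cexp (- (Ci * RtoC (d * (PI / 2)) * p)) * CGamma p)%C < eps.
Proof.
  intros Hd Hp He.
  set (k := Cmod (Cexp (- (Ci * RtoC (d * (PI / 2)) * p)))).
  assert (Hk : 0 < k) by (unfold k; rewrite Cmod_Cexp; apply exp_pos).
  set (c := exp (Rabs (Im p) * 2)). assert (Hc : 0 < c) by apply exp_pos.
  set (B := Rpower (2 * 1) 1). assert (HB : 0 < B) by apply Rpower_pos.
  set (q := eps / k / 4). assert (Hq : 0 < q) by (unfold q; repeat apply Rdiv_lt_0_compat; lra).
  destruct (Rpower_small_at_0 (Re p) (q / (2 * c + / Re p))) as [e0 [He0 H1]]; [lra | |].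
  { apply Rdiv_lt_0_compat; [exact Hq|]. assert (0 < / Re p) by (apply Rinv_0_lt_compat; lra). lra. }
  destruct (Rpower_lt_small (1 - Re p) (q / (4 * c))) as [x1 [Hx1 H2]]; [lra | apply Rdiv_lt_0_compat; lra|].
  destruct (exp_neg_small (q / (2 * B))) as [x2 [Hx2 H3]]; [apply Rdiv_lt_0_compat; lra|].
  exists (Rmin 1 e0), (Rmax x1 x2).
  split; [split; [apply Rmin_pos; lra | apply Rmin_l]|].
  split; [eapply Rle_trans; [exact Hx2 | apply Rmax_r]|].
  intros e x [Hee He2] Hx.
  assert (m1 := Rmin_l 1 e0). assert (m2 := Rmin_r 1 e0). assert (M1 := Rmax_l x1 x2). assert (M2 := Rmax_r x1 x2).
  specialize (H1 e Hee ltac:(lra)). specialize (H2 x ltac:(lra)). specialize (H3 x ltac:(lra)).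
  assert (A1 := mellin_rotation p d e x Hd ltac:(lra) Hee ltac:(lra) ltac:(lra)).
  assert (A2 := CGamma_approx p 1 e x ltac:(lra) ltac:(lra) ltac:(lra) ltac:(lra) ltac:(lra)).
  fold c in A1. fold B in A2.
  set (u := Cexp (Ci * RtoC (d * (PI / 2)) * p)) in *.
  set (J := IntC (osc_integrand (Ci * RtoC d) p) e x) in *.
  assert (Hu : (Cexp (- (Ci * RtoC (d * (PI / 2)) * p)) * u)%C = 1%C).
  { unfold u. rewrite <- Cexp_plus. replace (- _ + _)%C with (RtoC 0) by ring. apply Cexp_0. }
  set (u' := Cexp (- (Ci * RtoC (d * (PI / 2)) * p))) in *.
  replace (J - u' * CGamma p)%C with (u' * (u * J - CGamma p))%C.
  2:{ replace (u' * (u * J - CGamma p))%C with ((u' * u) * J - u' * CGamma p)%C by ring. rewrite Hu. ring. }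
  rewrite Cmod_mult. fold k.
  assert (T := Cmod_dist_triangle (u * J) (IntC (gamma_integrand p) e x) (CGamma p)).
  replace (Re p - 1) with (- (1 - Re p)) in A1 by ring.
  set (P := Rpower e (Re p)) in *. set (Q := Rpower x (- (1 - Re p))) in *. set (F := exp (- x / 2)) in *.
  assert (HP : (2 * c + / Re p) * P < q).
  { assert (0 < / Re p) by (apply Rinv_0_lt_compat; lra).
    apply (Rmult_lt_compat_l (2 * c + / Re p)) in H1; [|lra].
    replace ((2 * c + / Re p) * (q / (2 * c + / Re p))) with q in H1 by (field; split; [lra|]; 
      assert (0 < Re p * (2 * c)) by (apply Rmult_lt_0_compat; lra); lra). exact H1. }
  assert (HQ : 4 * c * Q < q).
  { apply (Rmult_lt_compat_l (4 * c)) in H2; [|lra]. replace (4 * c * (q / (4 * c))) with q in H2 by (field; lra). exact H2. }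
  assert (HF : 2 * B * F < q).
  { apply (Rmult_lt_compat_l (2 * B)) in H3; [|lra]. replace (2 * B * (q / (2 * B))) with q in H3 by (field; lra). exact H3. }
  assert (Hall : Cmod (u * J - CGamma p) < 4 * q) by (unfold Rdiv in A2; lra).
  apply Rlt_le_trans with (k * (4 * q)); [apply Rmult_lt_compat_l; assumption|].
  unfold q. right. field. lra.
Qed.

(** * Fourier coefficients of the Hurwitz zeta function *)

(** [Rcpow] with the value at [0] corrected, continuous for [Re c > 0]. *)
Definition pw (x : R) (c : C) : C := if Rlt_dec 0 x then Rcpow x c else RtoC 0.

Lemma pw_pos (x : R) (c : C) : 0 < x -> pw x c = Rcpow x c.
Proof. intros H. unfold pw. destruct (Rlt_dec 0 x); [reflexivity | contradiction]. Qed.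

Lemma pw_0 (c : C) : pw 0 c = RtoC 0.
Proof. unfold pw. destruct (Rlt_dec 0 0); [lra | reflexivity]. Qed.

Lemma contC_pw (x : R) (c : C) : 0 < Re c -> contC (fun t => pw t c) x.
Proof.
  intros Hc. destruct (Rtotal_order x 0) as [Hx|[->|Hx]].
  - apply contC_eps. intros eps He. exists (- x). split; [lra|]. intros y Hy. apply Rabs_def2 in Hy.
    unfold pw. destruct (Rlt_dec 0 y); [lra|]. destruct (Rlt_dec 0 x); [lra|].
    rewrite Cminus_0_r, Cmod_0. exact He.
  - apply contC_eps. intros eps He. destruct (Rpower_small_at_0 (Re c) eps Hc He) as [d [Hd H]].
    exists d. split; [exact Hd|]. intros y Hy. rewrite Rminus_0_r in Hy. apply Rabs_def2 in Hy.
    rewrite pw_0, Cminus_0_r. unfold pw. destruct (Rlt_dec 0 y) as [Hy0|]; [|rewrite Cmod_0; exact He].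
    rewrite Cmod_Rcpow. apply H; lra.
  - apply contC_eps. intros eps He.
    destruct (proj1 (contC_eps _ _) (contC_Rcpow c x Hx) eps He) as [d [Hd H]].
    exists (Rmin d x). split; [apply Rmin_pos; assumption|]. intros y Hy.
    assert (H1 := Rlt_le_trans _ _ _ Hy (Rmin_l _ _)). assert (H2 := Rlt_le_trans _ _ _ Hy (Rmin_r _ _)).
    apply Rabs_def2 in H2. rewrite !pw_pos by lra. apply H, H1.
Qed.

(** At 0 the two-sided derivative is 0, since |h^c| is o(|h|) for Re c > 1. Thus a multiple of x^(1
    - s) serves as a primitive on an interval starting at 0. *)
Lemma derivC_pw (x : R) (c : C) : 0 <= x -> 1 < Re c -> derivC (fun t => pw t c) x (c * pw x (c - 1))%C.
Proof.
  intros [Hx|<-] Hc.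
  - rewrite pw_pos by exact Hx. apply (is_derive_ext_loc (K := R_AbsRing) (V := C_R_NormedModule) (fun t => Rcpow t c)).
    + exists (mkposreal x Hx). intros y Hy. change (Rabs (y - x) < x) in Hy. apply Rabs_def2 in Hy.
      symmetry. apply pw_pos. lra.
    + apply derivC_Rcpow, Hx.
  - apply derivC_eps. intros eps He.
    destruct (Rpower_small_at_0 (Re c - 1) eps ltac:(lra) He) as [d [Hd H]].
    exists d. split; [exact Hd|]. intros h Hh. rewrite Rplus_0_l, !pw_0.
    replace (_ - _ - _)%C with (pw h c) by ring. unfold pw.
    destruct (Rlt_dec 0 h) as [Hh0|]; [|rewrite Cmod_0; apply Rmult_le_pos; [lra | apply Rabs_pos]].
    rewrite Rabs_pos_eq in * by lra. rewrite Cmod_Rcpow.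
    replace (Re c) with (Re c - 1 + 1) by ring. rewrite Rpower_plus, Rpower_1 by exact Hh0.
    apply Rmult_le_compat_r; [lra|]. apply Rlt_le, H; lra.
Qed.

(** Partial sums of [zeta_em] with the boundary terms linearised in [a], so that
    their Fourier coefficients are explicit. *)
Definition em_approx (s : C) (M : nat) (a : R) : C :=
  (sumC (fun n => pw (INR n + a) (- s)) (pred M) +
   (Rcpow (INR M) (- s) / 2 - Rcpow (INR M) (1 - s) / (1 - s) - RtoC a * Rcpow (INR M) (- s)))%C.

Lemma Cdiv_2_le (z : C) (e : R) : Cmod z <= e -> Cmod (z / 2) <= e.
Proof.
  intros H. rewrite Cmod_div by (intros E; apply RtoC_inj in E; lra).
  rewrite Cmod_R, Rabs_pos_eq by lra. assert (T := Cmod_ge_0 z). lra.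
Qed.

(** Freezing (x + a)^(-s) at a = 0 and replacing (x + a)^(1 - s) / (1 - s) by its tangent there
    costs O(x^(-Re s - 1)), which tends to 0 because Re s > -1. The second estimate integrates the
    first: the derivative in [a] of its difference is (x + a)^(-s) - x^(-s). *)
Lemma em_endpoint_estimate (s : C) (x a : R) : - 1 < Re s -> s <> 1%C -> 1 <= x -> 0 <= a <= 1 ->
  Cmod ((Rcpow (x + a) (- s) / 2 - Rcpow (x + a) (1 - s) / (1 - s)) -
        (Rcpow x (- s) / 2 - Rcpow x (1 - s) / (1 - s) - RtoC a * Rcpow x (- s)))%C
  <= 2 * (Cmod s * Rpower x (- (Re s + 1))).
Proof.
  intros Hre Hs Hx Ha. set (eta := Cmod s * Rpower x (- (Re s + 1))).
  assert (Heta : 0 <= eta) by (apply Rmult_le_pos; [apply Cmod_ge_0 | apply Rlt_le, Rpower_pos]).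
  assert (Hs' := C_1_minus_neq_0 s Hs).
  assert (R1 : forall u, 0 <= u <= 1 -> Cmod (Rcpow (x + u) (- s) - Rcpow x (- s))%C <= eta).
  { intros u Hu.
    assert (I := intC_derive (fun t => Rcpow (x + t) (- s)) (fun t => (- s * Rcpow (x + t) (- s - 1))%C) 0 u).
    cbv beta in I. rewrite Rplus_0_r in I.
    apply Rle_trans with ((u - 0) * eta); [|nra].
    apply (intC_bound_const _ _ _ _ _ (proj1 Hu)) with (2 := I ltac:(
      intros t Ht; rewrite Rmin_left in Ht by lra; apply derivC_Rcpow_shift; lra) ltac:(
      intros t Ht; rewrite Rmin_left in Ht by lra; apply contC_mult; [apply contC_const | apply contC_Rcpow_shift; lra])).
    intros t Ht. rewrite Cmod_mult, Cmod_opp, Cmod_Rcpow. apply Rmult_le_compat_l; [apply Cmod_ge_0|].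
    replace (Re (- s - 1)) with (- (Re s + 1)) by (rewrite Re_minus, re_opp; simpl; ring).
    apply Rpower_le_anti; lra. }
  assert (R2 : Cmod (Rcpow (x + a) (1 - s) / (1 - s) - Rcpow x (1 - s) / (1 - s) - RtoC a * Rcpow x (- s))%C <= eta).
  { assert (I := intC_derive (fun t => Rcpow (x + t) (1 - s) / (1 - s) - RtoC t * Rcpow x (- s))%C
      (fun t => Rcpow (x + t) (- s) - Rcpow x (- s))%C 0 a).
    cbv beta in I. rewrite Rplus_0_r in I.
    replace (_ - _ - _)%C with (Rcpow (x + a) (1 - s) / (1 - s) - a * Rcpow x (- s) - (Rcpow x (1 - s) / (1 - s) - 0 * Rcpow x (- s)))%C by ring.
    apply Rle_trans with ((a - 0) * eta); [|nra].
    apply (intC_bound_const _ _ _ _ _ (proj1 Ha)) with (2 := I ltac:(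
      intros t Ht; rewrite Rmin_left in Ht by lra; eapply derivC_eq;
      [apply derivC_minus; apply derivC_mult; [apply derivC_Rcpow_shift; lra | apply derivC_const | apply derivC_id | apply derivC_const]
      | cbv beta; replace (1 - s - 1)%C with (- s)%C by ring; field; exact Hs']) ltac:(
      intros t Ht; rewrite Rmin_left in Ht by lra; apply contC_minus; [apply contC_Rcpow_shift; lra | apply contC_const])).
    intros t Ht. apply R1. lra. }
  replace (_ - _)%C with ((Rcpow (x + a) (- s) - Rcpow x (- s)) / 2 -
    (Rcpow (x + a) (1 - s) / (1 - s) - Rcpow x (1 - s) / (1 - s) - RtoC a * Rcpow x (- s)))%C.
  2:{ assert (H2 : RtoC 2 <> 0%C) by (intros E; apply RtoC_inj in E; lra). field. exact Hs'. }
  unfold Cminus at 1. eapply Rle_trans; [apply Cmod_triangle|]. rewrite Cmod_opp.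
  assert (T := Cdiv_2_le _ _ (R1 a Ha)). lra.
Qed.

Lemma em_approx_uniform (s : C) (eps : R) : - 1 < Re s -> s <> 1%C -> 0 < eps ->
  exists N, forall M a, (N <= M)%nat -> 0 < a < 1 -> Cmod (em_approx s M a - zeta_em s a) < eps.
Proof.
  intros Hre Hs He.
  destruct (zeta_em_partial_uniform (Re s) (Cmod s) (eps / 2) Hre ltac:(lra)) as [N1 H1].
  set (c := 2 * (Cmod s + 1)). assert (Hc : 0 < c) by (unfold c; assert (T := Cmod_ge_0 s); lra).
  destruct (Rpower_lt_small_nat (Re s + 1) (eps / 2 / c)) as [N2 H2]; [lra | apply Rdiv_lt_0_compat; lra|].
  exists (N1 + N2 + 2)%nat. intros M a HM Ha.
  destruct M as [|[|N]]; [lia | lia|].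
  specialize (H1 N s a ltac:(lia) ltac:(lra) Hs ltac:(lra) ltac:(lra)).
  specialize (H2 (S (S N)) 0 ltac:(lia) ltac:(lra)). rewrite Rplus_0_r in H2.
  rewrite zeta_em_partial_eq in H1 by exact Hs.
  assert (Hx : INR (S (S N)) = INR N + 2) by (rewrite !S_INR; ring).
  assert (TN := pos_INR N).
  assert (H3 := em_endpoint_estimate s (INR (S (S N))) a Hre Hs ltac:(lra) ltac:(lra)).
  unfold em_approx. simpl pred.
  rewrite (sumC_ext (fun n => pw (INR n + a) (- s)) (fun n => Rcpow (INR n + a) (- s))) 
    by (intros k _; apply pw_pos; assert (T := pos_INR k); lra).
  rewrite <- Hx in H1. set (x := INR (S (S N))) in *. set (S0 := sumC _ _) in *.
  set (U := (Rcpow (x + a) (- s) / 2 - Rcpow (x + a) (1 - s) / (1 - s))%C) in *.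
  set (V := (Rcpow x (- s) / 2 - Rcpow x (1 - s) / (1 - s) - a * Rcpow x (- s))%C) in *.
  assert (T := Cmod_dist_triangle (S0 + V) (S0 + U) (zeta_em s a)).
  replace (S0 + V - (S0 + U))%C with (- (U - V))%C in T by ring. rewrite Cmod_opp in T.
  replace (S0 + Rcpow (x + a) (- s) / 2 - Rcpow (x + a) (1 - s) / (1 - s))%C with (S0 + U)%C in H1 by (unfold U; ring).
  assert (Hy := Rpower_pos x (- (Re s + 1))).
  apply (Rmult_lt_compat_l c) in H2; [|exact Hc].
  replace (c * (eps / 2 / c)) with (eps / 2) in H2 by (field; lra).
  assert (2 * (Cmod s * Rpower x (- (Re s + 1))) <= c * Rpower x (- (Re s + 1))) by (unfold c; nra).
  lra.
Qed.

Lemma intC_comp_shift (f : R -> C) (c a b : R) (l : C) :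
  intC f (c + a) (c + b) l -> intC (fun t => f (c + t)) a b l.
Proof.
  intros H.
  apply (intC_ext (fun y => scal (V := C_R_NormedModule) 1 (f (1 * y + c)))).
  - intros x _. replace (1 * x + c) with (c + x) by ring. Cparts.
  - apply (is_RInt_comp_lin (V := C_R_NormedModule) f 1 c a b).
    replace (1 * a + c) with (c + a) by ring. replace (1 * b + c) with (c + b) by ring. exact H.
Qed.

(** exp (-2 pi i d k x). The sign d = 1 or d = -1 treats the frequencies k and -k together and is
    also the direction in which the contour is rotated. *)
Definition wave (d : R) (k : nat) (x : R) : C := Cexp (- (Ci * RtoC d * RtoC (2 * PI * INR k * x))).

Lemma wave_period (d : R) (k n : nat) (x : R) : d = 1 \/ d = -1 -> wave d k (INR n + x) = wave d k x.
Proof.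
  intros Hd. unfold wave.
  replace (- (Ci * d * RtoC (2 * PI * INR k * (INR n + x))))%C with
    (- (Ci * d * RtoC (2 * PI * INR k * x)) + - (Ci * RtoC (d * (2 * PI * INR (k * n)))))%C.
  2:{ rewrite mult_INR, !RtoC_mult, RtoC_plus. ring. }
  rewrite Cexp_plus, !Cexp_opp.
  replace (Cexp (Ci * RtoC (d * (2 * PI * INR (k * n))))) with (RtoC 1); [field; apply Cexp_neq_0|].
  destruct Hd as [-> | ->].
  - rewrite Rmult_1_l. symmetry. apply Cexp_2PI_nat.
  - replace (Ci * RtoC (-1 * (2 * PI * INR (k * n))))%C with (- (Ci * RtoC (2 * PI * INR (k * n))))%C
      by (rewrite (RtoC_mult (-1)); change (RtoC (-1)) with (RtoC (Ropp 1)); rewrite RtoC_opp; ring).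
    rewrite Cexp_opp, Cexp_2PI_nat. field.
Qed.

Lemma wave_0_r (d : R) (k : nat) : wave d k 0 = RtoC 1.
Proof. unfold wave. rewrite Rmult_0_r. replace (- (Ci * d * 0))%C with (RtoC 0) by ring. apply Cexp_0. Qed.

Lemma wave_nat (d : R) (k n : nat) : d = 1 \/ d = -1 -> wave d k (INR n) = RtoC 1.
Proof. intros Hd. rewrite <- (Rplus_0_r (INR n)), wave_period by exact Hd. apply wave_0_r. Qed.

Lemma wave_1_r (d : R) (k : nat) : d = 1 \/ d = -1 -> wave d k 1 = RtoC 1.
Proof. intros Hd. apply (wave_nat d k 1 Hd). Qed.

Lemma Cmod_wave (d : R) (k : nat) (x : R) : Cmod (wave d k x) = 1.
Proof.
  unfold wave. replace (- (Ci * d * RtoC (2 * PI * INR k * x)))%C with (Ci * RtoC (- d * (2 * PI * INR k * x)))%C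
    by (rewrite (RtoC_mult (- d)), RtoC_opp; ring). apply Cmod_Cexp_Ci.
Qed.

Lemma derivC_wave (d : R) (k : nat) (x : R) :
  derivC (wave d k) x (- (Ci * RtoC d * RtoC (2 * PI * INR k)) * wave d k x)%C.
Proof.
  unfold wave. eapply derivC_eq.
  - apply derivC_Cexp. apply (derivC_ext (fun t => - (Ci * RtoC d * RtoC (2 * PI * INR k)) * RtoC t)%C).
    + intros t. rewrite (RtoC_mult _ t). ring.
    + apply derivC_mult; [apply derivC_const | apply derivC_id].
  - cbv beta. ring.
Qed.

Lemma contC_wave (d : R) (k : nat) (x : R) : contC (wave d k) x.
Proof. eapply derivC_cont, derivC_wave. Qed.

Lemma intC_sum (f : nat -> R -> C) (a b : R) (l : nat -> C) (n : nat) :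
  (forall k, intC (f k) a b (l k)) -> intC (fun x => sumC (fun k => f k x) n) a b (sumC l n).
Proof.
  intros H. induction n.
  - rewrite sumC_O. apply (intC_ext (f 0%nat)); [intros; rewrite sumC_O; reflexivity | apply H].
  - rewrite sumC_S. apply (intC_ext (fun x => sumC (fun k => f k x) n + f (S n) x)%C).
    + intros; rewrite sumC_S; reflexivity.
    + apply intC_plus; [exact IHn | apply H].
Qed.

(** Periodicity of [g] glues the integrals over consecutive unit intervals into a single one over a
    long interval. *)
Lemma intC_unfold (f g : R -> C) (M : nat) : (forall x, contC f x) -> (forall x, contC g x) ->
  (forall n x, g (INR n + x) = g x) ->
  intC (fun a => sumC (fun n => f (INR n + a)%R * g a)%C M) 0 1 (IntC (fun x => f x * g x)%C 0 (INR (S M))).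
Proof.
  intros Hf Hg Hper.
  assert (Hfg : forall a b, intC (fun x => f x * g x)%C a b (IntC (fun x => f x * g x)%C a b)).
  { intros a b. apply intC_cont. intros x _. apply contC_mult; auto. }
  assert (H1 : forall n, intC (fun a => f (INR n + a)%R * g a)%C 0 1 (IntC (fun x => f x * g x)%C (INR n) (INR (S n)))).
  { intros n. apply (intC_ext (fun a => f (INR n + a)%R * g (INR n + a)%R)%C); [intros; rewrite Hper; reflexivity|].
    apply (intC_comp_shift (fun x => f x * g x)%C (INR n) 0 1). rewrite Rplus_0_r, <- S_INR. apply Hfg. }
  eapply intC_eq; [apply (intC_sum (fun n a => f (INR n + a)%R * g a)%C), H1|].
  induction M.
  - rewrite sumC_O. reflexivity.
  - rewrite sumC_S, IHM. symmetry. apply (intC_unique _ _ _ _ _ (Hfg _ _)). eapply intC_Chasles; apply Hfg.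
Qed.

Lemma Rpower_le_1 (x p : R) : 0 < x <= 1 -> 0 <= p -> Rpower x p <= 1.
Proof.
  intros Hx Hp. unfold Rpower. apply Rle_trans with (exp 0); [apply exp_le | right; apply exp_0].
  assert (ln x <= 0).
  { rewrite <- ln_1. destruct (proj2 Hx) as [H| ->]; [left; apply ln_increasing; lra | right; reflexivity]. }
  nra.
Qed.

Lemma contC_line (c0 c1 : C) (x : R) : contC (fun a => (c0 - RtoC a * c1)%C) x.
Proof.
  apply contC_minus; [apply contC_const|]. apply contC_mult; [|apply contC_const].
  eapply derivC_cont, derivC_id.
Qed.

Lemma intC_em_approx (s : C) (M : nat) (g : R -> C) (q : C) : (0 < M)%nat -> Re s < 0 ->
  (forall x, contC g x) -> (forall n x, g (INR n + x) = g x) ->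
  intC (fun a => (Rcpow (INR M) (- s) / 2 - Rcpow (INR M) (1 - s) / (1 - s) - RtoC a * Rcpow (INR M) (- s)) * g a)%C 0 1 q ->
  intC (fun a => em_approx s M a * g a)%C 0 1 (IntC (fun x => pw x (- s) * g x)%C 0 (INR M) + q)%C.
Proof.
  intros HM Hs Hg Hper Hq. destruct M as [|M]; [lia|].
  eapply intC_ext; [|apply intC_plus; [apply (intC_unfold (fun x => pw x (- s)) g M) | exact Hq]].
  - intros a _. cbv beta. unfold em_approx. simpl pred.
    replace (sumC (fun n => pw (INR n + a) (- s) * g a)%C M) with (sumC (fun n => pw (INR n + a) (- s)) M * g a)%C.
    + ring.
    + clear. induction M; [rewrite !sumC_O; reflexivity | rewrite !sumC_S, <- IHM; ring].
  - intros x. apply contC_pw. rewrite re_opp. lra.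
  - exact Hg.
  - exact Hper.
Qed.

Lemma Cmod_pw_le_1 (s : C) (x : R) : Re s < 0 -> 0 <= x <= 1 -> Cmod (pw x (- s)) <= 1.
Proof.
  intros Hs Hx. destruct (Req_dec x 0) as [->|Hx0].
  - rewrite pw_0, Cmod_0. lra.
  - rewrite pw_pos by lra. rewrite Cmod_Rcpow, re_opp. apply Rpower_le_1; lra.
Qed.

Lemma Re_not_1 (s : C) : Re s < 1 -> s <> 1%C.
Proof. intros H ->. simpl in H. lra. Qed.

(** Every approximant has mean exactly 0. With x the number of terms, the unfolded integral of
    t^(-s) is x^(1 - s) / (1 - s); among the boundary terms the halves of x^(-s) cancel, and what is
    left is the negative of that value. *)
Lemma zeta_em_mean (s : C) : - 1 < Re s < 0 -> intC (fun a => zeta_em s a) 0 1 (RtoC 0).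
Proof.
  intros Hs. assert (Hs1 : s <> 1%C) by (apply Re_not_1; lra).
  assert (Hn1 := C_1_minus_neq_0 s Hs1).
  assert (Hv : forall M, intC (em_approx s (S M)) 0 1 (RtoC 0)).
  { intros M. set (x := INR (S M)). assert (Hx : 0 < x) by (unfold x; apply lt_0_INR; lia).
    set (c0 := (Rcpow x (- s) / 2 - Rcpow x (1 - s) / (1 - s))%C). set (c1 := Rcpow x (- s)).
    assert (Hq : intC (fun a => (c0 - RtoC a * c1) * 1)%C 0 1 (c0 - c1 / 2)%C).
    { assert (I := intC_derive (fun a => RtoC a * c0 - RtoC a * RtoC a * (c1 / 2))%C (fun a => c0 - RtoC a * c1)%C 0 1).
      eapply intC_eq; [eapply intC_ext; [|apply I]|].
      - intros a _. cbv beta. ring.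
      - intros a _. eapply derivC_eq.
        + repeat deriv_step.
        + cbv beta. field.
      - intros a _. apply contC_line.
      - cbv beta. field. }
    assert (H := intC_em_approx s (S M) (fun _ => RtoC 1) _ ltac:(lia) (proj2 Hs) (fun y => contC_const 1 y) (fun _ _ => eq_refl) Hq).
    eapply intC_eq; [eapply intC_ext; [|exact H]|].
    - intros a _. cbv beta. ring.
    - assert (E : IntC (fun x => pw x (- s) * 1)%C 0 (INR (S M)) = (Rcpow x (1 - s) / (1 - s))%C).
      { assert (I := intC_derive (fun t => pw t (1 - s) * / (1 - s))%C (fun t => pw t (- s) * 1)%C 0 x).
        replace (Rcpow x (1 - s) / (1 - s))%C with (pw x (1 - s) * / (1 - s) - pw 0 (1 - s) * / (1 - s))%C
          by (rewrite pw_0, pw_pos by exact Hx; unfold Cdiv; ring).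
        apply (is_RInt_unique (V := C_R_CompleteNormedModule)), I; intros t Ht; rewrite Rmin_left in Ht by lra.
        - eapply derivC_eq.
          + apply derivC_mult; [apply derivC_pw; [lra | rewrite Re_minus; simpl (Re 1); lra] | apply derivC_const].
          + cbv beta. replace (1 - s - 1)%C with (- s)%C by ring. field. exact Hn1.
        - apply contC_mult; [apply contC_pw; rewrite re_opp; lra | apply contC_const]. }
      cbv beta. rewrite E. unfold c0, c1. field. exact Hn1. }
  destruct (intC_unif_lim (fun M => em_approx s (S M)) (fun a => zeta_em s a) 0 1 (fun _ => RtoC 0) Rle_0_1 Hv) as [I [HI HL]].
  - intros eps He. destruct (em_approx_uniform s eps ltac:(lra) Hs1 He) as [N HN].
    exists N. intros n x Hn Hx. apply HN; [lia | exact Hx].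
  - eapply intC_eq; [exact HI|]. apply Cmod_small_eq_0. intros eps He.
    destruct (HL eps He) as [N HN]. specialize (HN N (le_n N)). rewrite Cmod_minus_sym, Cminus_0_r in HN. lra.
Qed.

(** The constant part is orthogonal to the wave; only the slope contributes. *)
Lemma wave_moments (d : R) (k : nat) (c0 c1 : C) : d = 1 \/ d = -1 -> (0 < k)%nat ->
  intC (fun a => (c0 - RtoC a * c1) * wave d k a)%C 0 1 (c1 / (Ci * RtoC d * RtoC (2 * PI * INR k)))%C.
Proof.
  intros Hd Hk. set (w := (Ci * RtoC d * RtoC (2 * PI * INR k))%C).
  assert (Hw : w <> 0%C).
  { assert (Hpi := PI_RGT_0). assert (0 < INR k) by (apply lt_0_INR; lia).
    unfold w. repeat apply Cmult_neq_0.
    - intros E. apply (f_equal Cmod) in E. rewrite Cmod_Ci, Cmod_0 in E. lra.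
    - intros E. apply RtoC_inj in E. lra.
    - intros E. apply RtoC_inj in E. nra. }
  assert (I := intC_derive (fun a => - (c0 - RtoC a * c1) * / w * wave d k a + c1 * / (w * w) * wave d k a)%C
    (fun a => (c0 - RtoC a * c1) * wave d k a)%C 0 1).
  eapply intC_eq; [apply I|].
  - intros a _. eapply derivC_eq.
    + apply derivC_plus; [apply derivC_mult; [apply derivC_mult; [|apply derivC_const]|apply derivC_wave]
        |apply derivC_mult; [apply derivC_const | apply derivC_wave]].
      apply (derivC_ext (fun a => RtoC a * c1 - c0)%C); [intros; ring|]. repeat deriv_step.
    + cbv beta. fold w. field. exact Hw.
  - intros a _. apply contC_mult; [apply contC_line | apply contC_wave].
  - cbv beta. rewrite wave_0_r, wave_1_r by exact Hd. field. exact Hw.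
Qed.

Lemma osc_scaled (s : C) (d w e x : R) : 0 < w -> 0 < e -> e <= x ->
  intC (fun t => Rcpow t (- s - 1) * Cexp (- (Ci * RtoC d * RtoC (w * t))))%C e x
    (Rcpow w s * IntC (osc_integrand (Ci * RtoC d) (- s)) (w * e) (w * x))%C.
Proof.
  intros Hw He Hx.
  assert (H0 : intC (osc_integrand (Ci * RtoC d) (- s)) (w * e + 0) (w * x + 0)
     (IntC (osc_integrand (Ci * RtoC d) (- s)) (w * e) (w * x))).
  { rewrite !Rplus_0_r. apply intC_osc_integrand; [apply Rmult_lt_0_compat; assumption | apply Rmult_le_compat_l; lra]. }
  assert (H := is_RInt_comp_lin (V := C_R_NormedModule) _ w 0 e x _ H0).
  apply (intC_mult_l (Rcpow w s)) in H. eapply intC_ext; [|exact H].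
  intros t Ht. rewrite Rmin_left in Ht by exact Hx. cbv beta. rewrite Rplus_0_r. unfold osc_integrand.
  rewrite Rcpow_mult by lra.
  match goal with |- context [@scal ?K0 ?V0 w ?z] => replace (@scal K0 V0 w z) with (RtoC w * z)%C by Cparts end.
  replace (Rcpow w s * (w * (Rcpow w (- s - 1) * Rcpow t (- s - 1) * Cexp (- (Ci * d * RtoC (w * t))))))%C
   with ((Rcpow w s * (Rcpow w (- s - 1) * RtoC w)) * (Rcpow t (- s - 1) * Cexp (- (Ci * d * RtoC (w * t)))))%C by ring.
  rewrite <- Rcpow_S_r, <- Rcpow_plus by exact Hw.
  replace (s + (- s - 1 + 1))%C with (RtoC 0) by ring. rewrite Rcpow_0_r. ring.
Qed.

(** This is Gamma (1 - s) (2 pi i d k)^(s - 1), the power of i d being written as an exponential. It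
    is the integral against [wave d k], hence the coefficient of the opposite wave. *)
Definition fourier_coef (s : C) (d : R) (k : nat) : C :=
  (CGamma (1 - s) * Rcpow (2 * PI * INR k) (s - 1) * Cexp (Ci * RtoC (d * (PI / 2)) * (s - 1)))%C.

Lemma Cexp_quarter_turn (d : R) : d = 1 \/ d = -1 -> Cexp (Ci * RtoC (d * (PI / 2))) = (Ci * RtoC d)%C.
Proof.
  intros Hd. rewrite Cexp_Ci. destruct Hd as [-> | ->].
  - rewrite Rmult_1_l, cos_PI2, sin_PI2. Cparts.
  - replace (-1 * (PI / 2)) with (- (PI / 2)) by ring. rewrite cos_neg, sin_neg, cos_PI2, sin_PI2. Cparts.
Qed.

(** Brings the coefficient to the shape that an integration by parts produces. For -1 < Re s < 0 the
    exponent -s is admissible in [osc_integral_limit], whereas 1 - s is not. *)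
Lemma fourier_coef_eq (s : C) (d : R) (k : nat) : d = 1 \/ d = -1 -> (0 < k)%nat -> Re s < 0 ->
  (Ci * RtoC d * RtoC (2 * PI * INR k) * fourier_coef s d k)%C =
  (- s * (Rcpow (2 * PI * INR k) s * (Cexp (- (Ci * RtoC (d * (PI / 2)) * - s)) * CGamma (- s))))%C.
Proof.
  intros Hd Hk Hs. assert (Hpi := PI_RGT_0). assert (Hk' : 0 < INR k) by (apply lt_0_INR; lia).
  unfold fourier_coef. replace (1 - s)%C with (- s + 1)%C by ring.
  rewrite CGamma_plus_1 by (rewrite re_opp; lra).
  replace (Ci * RtoC (d * (PI / 2)) * (s - 1))%C with (- (Ci * RtoC (d * (PI / 2)) * - s) + - (Ci * RtoC (d * (PI / 2))))%C by ring.
  rewrite Cexp_plus, (Cexp_opp (Ci * RtoC (d * (PI / 2)))), Cexp_quarter_turn by exact Hd.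
  replace (Rcpow (2 * PI * INR k) s) with (Rcpow (2 * PI * INR k) (s - 1) * RtoC (2 * PI * INR k))%C.
  - field. split.
    + intros E. apply RtoC_inj in E. lra.
    + intros E. apply (f_equal Cmod) in E. rewrite Cmod_Ci, Cmod_0 in E. lra.
  - rewrite <- Rcpow_S_r by nra. f_equal. ring.
Qed.

(** Integrating t^(-s) [wave d k t] by parts up to x = [INR (S M)] leaves the boundary term x^(-s),
    which the linearised endpoint terms cancel exactly. Hence [Dw * v M] is -s times an oscillatory
    integral, up to a loss near 0. *)
Lemma zeta_em_fourier (s : C) (d : R) (k : nat) : d = 1 \/ d = -1 -> (0 < k)%nat -> - 1 < Re s < 0 ->
  intC (fun a => zeta_em s a * wave d k a)%C 0 1 (fourier_coef s d k).
Proof.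
  intros Hd Hk Hs. assert (Hs1 : s <> 1%C) by (apply Re_not_1; lra).
  assert (Hpi := PI_RGT_0). assert (Hk' : 0 < INR k) by (apply lt_0_INR; lia).
  set (w := 2 * PI * INR k). assert (Hw : 0 < w) by (unfold w; nra).
  set (Dw := (Ci * RtoC d * RtoC w)%C).
  assert (HDw : Cmod Dw = w).
  { unfold Dw. rewrite !Cmod_mult, Cmod_Ci, !Cmod_R, (Rabs_pos_eq w) by lra.
    destruct Hd as [-> | ->]; unfold Rabs; destruct Rcase_abs; lra. }
  assert (HDw0 : Dw <> 0%C) by (intros E; rewrite E, Cmod_0 in HDw; lra).
  set (f := fun x => (pw x (- s) * wave d k x)%C).
  assert (Hf : forall a b, intC f a b (IntC f a b)).
  { intros a b. apply intC_cont. intros y _. apply contC_mult; [apply contC_pw; rewrite re_opp; lra | apply contC_wave]. }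
  set (v := fun M => (IntC f 0 (INR (S M)) + Rcpow (INR (S M)) (- s) / Dw)%C).
  assert (Hv : forall M, intC (fun a => em_approx s (S M) a * wave d k a)%C 0 1 (v M)).
  { intros M. apply (intC_em_approx s (S M) (wave d k)); [lia | lra | apply contC_wave | |].
    - intros n x. apply wave_period, Hd.
    - apply wave_moments; assumption. }
  set (K := fun e x => (Rcpow w s * IntC (osc_integrand (Ci * RtoC d) (- s)) (w * e) (w * x))%C).
  (* The factor t^(-s-1) is unbounded at 0, so the integration by parts runs over [e, x]. The loss
     is the integral over [0, e] and the boundary term e^(-s), of sizes w e and e^(-Re s). *)
  assert (Hparts : forall M e, 0 < e <= 1 ->
    Cmod (Dw * v M - - s * K e (INR (S M)))%C <= w * e + Rpower e (- Re s)).
  { intros M e He. set (x := INR (S M)). assert (Hx : 1 <= x) by (unfold x; rewrite S_INR; assert (T := pos_INR M); lra).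
    assert (I1 : intC (fun t => - Dw * f t + - s * (Rcpow t (- s - 1) * Cexp (- (Ci * RtoC d * RtoC (w * t)))))%C e x
      (Rcpow x (- s) - Rcpow e (- s) * wave d k e)%C).
    { assert (I := intC_derive (fun t => Rcpow t (- s) * wave d k t)%C (fun t => - s * Rcpow t (- s - 1) * wave d k t + Rcpow t (- s) * (- Dw * wave d k t))%C e x).
      cbv beta in I. assert (Ewx : wave d k x = RtoC 1) by (apply wave_nat, Hd). rewrite Ewx, Cmult_1_r in I.
      eapply intC_ext; [|apply I].
      - intros t Ht. rewrite Rmin_left in Ht by lra. unfold f. rewrite pw_pos by lra. unfold wave. fold w. ring.
      - intros t Ht. rewrite Rmin_left in Ht by lra. apply derivC_mult; [apply derivC_Rcpow; lra | apply derivC_wave].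
      - intros t Ht. rewrite Rmin_left in Ht by lra.
        apply contC_plus; apply contC_mult.
        + apply contC_mult; [apply contC_const | apply contC_Rcpow; lra].
        + apply contC_wave.
        + apply contC_Rcpow; lra.
        + apply contC_mult; [apply contC_const | apply contC_wave]. }
    assert (I2 := intC_plus _ _ _ _ _ _ (intC_mult_l (- Dw)%C _ _ _ _ (Hf e x)) (intC_mult_l (- s)%C _ _ _ _ (osc_scaled s d w e x Hw (proj1 He) ltac:(lra)))).
    assert (EQ := intC_unique _ _ _ _ _ I2 I1). fold (K e x) in EQ.
    assert (Hsplit := intC_unique _ _ _ _ _ (Hf 0 x) (intC_Chasles _ _ _ _ _ _ (Hf 0 e) (Hf e x))).
    unfold v. fold x. rewrite Hsplit.
    replace (Dw * (IntC f 0 e + IntC f e x + Rcpow x (- s) / Dw) - - s * K e x)%C with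
      (Dw * IntC f 0 e + Rcpow x (- s) - (- Dw * IntC f e x + - s * K e x))%C by (field; exact HDw0).
    rewrite EQ.
    replace (_ - _)%C with (Dw * IntC f 0 e + Rcpow e (- s) * wave d k e)%C by ring.
    eapply Rle_trans; [apply Cmod_triangle|]. rewrite !Cmod_mult, HDw, Cmod_wave, Cmod_Rcpow, re_opp, Rmult_1_r.
    apply Rplus_le_compat_r. apply Rmult_le_compat_l; [lra|].
    replace e with ((e - 0) * 1) at 2 by ring.
    apply (intC_bound_const _ _ _ _ _ (Rlt_le _ _ (proj1 He))) with (2 := Hf 0 e).
    intros t Ht. unfold f. rewrite Cmod_mult, Cmod_wave, Rmult_1_r. apply Cmod_pw_le_1; lra. }
  destruct (intC_unif_lim (fun M a => em_approx s (S M) a * wave d k a)%C (fun a => zeta_em s a * wave d k a)%C 0 1 v Rle_0_1 Hv) as [I [HI HL]].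
  - intros eps He. destruct (em_approx_uniform s eps ltac:(lra) Hs1 He) as [N HN].
    exists N. intros n x Hn Hx.
    replace (_ - _)%C with ((em_approx s (S n) x - zeta_em s x) * wave d k x)%C by ring.
    rewrite Cmod_mult, Cmod_wave, Rmult_1_r. apply HN; [lia | exact Hx].
  - eapply intC_eq; [exact HI|].
    apply C_eq_of_minus.
    replace (I - fourier_coef s d k)%C with (/ Dw * (Dw * (I - fourier_coef s d k)))%C by (field; exact HDw0).
    enough (Z : (Dw * (I - fourier_coef s d k))%C = 0%C) by (rewrite Z; ring).
    apply Cmod_small_eq_0. intros eps He.
    set (c := Cmod (- s * Rcpow w s) + 1). assert (Hc : 0 < c) by (unfold c; assert (T := Cmod_ge_0 (- s * Rcpow w s)%C); lra).
    destruct (osc_integral_limit (- s) d (eps / 4 / c) Hd) as [e0 [x0 [He0 [Hx0 Hosc]]]].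
    { rewrite re_opp. lra. }
    { apply Rdiv_lt_0_compat; lra. }
    destruct (Rpower_small_at_0 (- Re s) (eps / 4)) as [e1 [He1 Hp1]]; [lra | lra|].
    set (e := Rmin (Rmin 1 e1) (Rmin (e0 / w) (eps / 4 / w))).
    assert (He' : 0 < e) by (unfold e; repeat apply Rmin_pos; try lra; apply Rdiv_lt_0_compat; lra).
    assert (n1 := Rmin_l (Rmin 1 e1) (Rmin (e0 / w) (eps / 4 / w))). assert (n2 := Rmin_r (Rmin 1 e1) (Rmin (e0 / w) (eps / 4 / w))). fold e in n1, n2.
    assert (n3 := Rmin_l (e0 / w) (eps / 4 / w)). assert (n4 := Rmin_r (e0 / w) (eps / 4 / w)).
    assert (n5 := Rmin_l 1 e1). assert (n6 := Rmin_r 1 e1).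
    destruct (HL (eps / 4 / w)) as [N1 HN1]; [apply Rdiv_lt_0_compat; lra|].
    destruct (INR_unbounded (x0 / w)) as [N2 HN2].
    set (M := (N1 + N2)%nat). specialize (HN1 M ltac:(unfold M; lia)).
    assert (HM : INR N2 <= INR (S M)) by (apply le_INR; unfold M; lia).
    specialize (Hparts M e ltac:(lra)). specialize (Hp1 e He' ltac:(lra)).
    assert (Hwe : w * e <= e0).
    { apply Rle_trans with (w * (e0 / w)); [apply Rmult_le_compat_l; lra | right; field; lra]. }
    assert (Hwe2 : w * e <= eps / 4).
    { apply Rle_trans with (w * (eps / 4 / w)); [apply Rmult_le_compat_l; lra | right; field; lra]. }
    assert (Hwx : x0 <= w * INR (S M)).
    { apply Rle_trans with (w * (x0 / w)); [right; field; lra | apply Rmult_le_compat_l; lra]. }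
    specialize (Hosc (w * e) (w * INR (S M)) (conj (Rmult_lt_0_compat _ _ Hw He') Hwe) Hwx).
    assert (FC := fourier_coef_eq s d k Hd Hk (proj2 Hs)). fold w in FC. fold Dw in FC.
    set (L := (Cexp (- (Ci * RtoC (d * (PI / 2)) * - s)) * CGamma (- s))%C) in *.
    set (J := IntC (osc_integrand (Ci * RtoC d) (- s)) (w * e) (w * INR (S M))) in *.
    replace (Dw * (I - fourier_coef s d k))%C with (Dw * I - Dw * fourier_coef s d k)%C by ring.
    rewrite FC. unfold K in Hparts. fold J in Hparts.
    replace (Dw * I - - s * (Rcpow w s * L))%C with
      (- (Dw * (v M - I)) + (Dw * v M - - s * (Rcpow w s * J)) + (- s * Rcpow w s) * (J - L))%C by ring.
    eapply Rle_trans; [apply Cmod_triangle|]. eapply Rle_trans; [apply Rplus_le_compat_r, Cmod_triangle|].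
    rewrite Cmod_opp, (Cmod_mult Dw), HDw, (Cmod_mult (- s * Rcpow w s)).
    assert (B1 : w * Cmod (v M - I) <= eps / 4).
    { apply Rle_trans with (w * (eps / 4 / w)); [apply Rmult_le_compat_l; lra | right; field; lra]. }
    assert (B2 : Cmod (- s * Rcpow w s) * Cmod (J - L) <= eps / 4).
    { apply Rle_trans with (c * (eps / 4 / c)); [|right; field; lra].
      apply Rmult_le_compat; [apply Cmod_ge_0 | apply Cmod_ge_0 | unfold c; lra | lra]. }
    lra.
Qed.

(** * Uniqueness of Fourier coefficients *)

(** Frequencies are indexed by Z here, so that multiplication by [peak] shifts them by 1 or -1
    without a case distinction at 0. *)
Definition expZ (m : Z) (x : R) : C := Cexp (Ci * RtoC (2 * PI * IZR m * x)).

Lemma expZ_plus (m n : Z) (x : R) : expZ (m + n) x = (expZ m x * expZ n x)%C.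
Proof.
  unfold expZ. rewrite <- Cexp_plus. f_equal. rewrite plus_IZR.
  replace (2 * PI * (IZR m + IZR n) * x) with (2 * PI * IZR m * x + 2 * PI * IZR n * x) by ring.
  rewrite RtoC_plus. ring.
Qed.

Lemma expZ_0 (x : R) : expZ 0 x = 1%C.
Proof. unfold expZ. replace (2 * PI * 0 * x) with 0 by ring. rewrite Cmult_0_r. apply Cexp_0. Qed.


Lemma wave_expZ (d : R) (k : nat) (x : R) : d = 1 \/ d = -1 ->
  wave d k x = expZ (if Req_dec_T d 1 then - Z.of_nat k else Z.of_nat k) x.
Proof.
  intros Hd. unfold wave, expZ. f_equal. rewrite INR_IZR_INZ.
  destruct Hd as [-> | ->]; destruct Req_dec_T; try lra.
  - rewrite opp_IZR. replace (2 * PI * - IZR (Z.of_nat k) * x) with (- (2 * PI * IZR (Z.of_nat k) * x)) by ring.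
    rewrite RtoC_opp. ring.
  - change (RtoC (-1)) with (RtoC (Ropp 1)). rewrite RtoC_opp. ring.
Qed.

Definition peak (x0 x : R) : R := (1 + cos (2 * PI * (x - x0))) / 2.

Lemma peak_expZ (x0 x : R) :
  RtoC (peak x0 x) = (/ 2 + / 4 * expZ (-1) x0 * expZ 1 x + / 4 * expZ 1 x0 * expZ (-1) x)%C.
Proof.
  unfold peak. unfold expZ. rewrite !Cexp_Ci.
  replace (2 * PI * (x - x0)) with (2 * PI * 1 * x - 2 * PI * 1 * x0) by ring.
  rewrite cos_minus.
  replace (2 * PI * -1 * x) with (- (2 * PI * 1 * x)) by ring.
  replace (2 * PI * -1 * x0) with (- (2 * PI * 1 * x0)) by ring.
  rewrite !cos_neg, !sin_neg.
  rewrite <- !RtoC_inv by lra.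
  apply C_eq; simpl; field.
Qed.

Lemma peak_range (x0 x : R) : 0 <= peak x0 x <= 1.
Proof. unfold peak. assert (T := COS_bound (2 * PI * (x - x0))). lra. Qed.

(** The condition on [x0] gives |x - x0| <= 1 - d, so that [x] also keeps its distance from the
    neighbouring maxima x0 - 1 and x0 + 1. *)
Lemma peak_far (x0 x d : R) : 0 < d -> d <= x0 <= 1 - d -> 0 <= x <= 1 -> d <= Rabs (x - x0) ->
  peak x0 x <= (1 + cos (2 * PI * d)) / 2.
Proof.
  intros Hd H0 Hx Hfar. unfold peak. assert (Hpi := PI_RGT_0).
  assert (Hu : Rabs (x - x0) <= 1 - d) by (unfold Rabs; destruct Rcase_abs; lra).
  assert (E : cos (2 * PI * (x - x0)) = cos (2 * PI * Rabs (x - x0))).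
  { unfold Rabs; destruct Rcase_abs; [|reflexivity]. rewrite <- cos_neg. f_equal. ring. }
  rewrite E. set (t := Rabs (x - x0)) in *.
  assert (Hcos : cos (2 * PI * t) <= cos (2 * PI * d)); [|lra].
  assert (HD : d <= / 2) by lra.
  destruct (Rle_dec t (/ 2)) as [Ht|Ht].
  - apply cos_decr_1; nra.
  - replace (cos (2 * PI * t)) with (cos (2 * PI * (1 - t))).
    + apply cos_decr_1; nra.
    + replace (2 * PI * (1 - t)) with (- (2 * PI * t) + 2 * 1 * PI) by ring.
      rewrite <- (cos_neg (2 * PI * t)). apply (cos_period _ 1).
Qed.

Lemma peak_near (x0 x d : R) : 0 < d -> d <= 1 / 2 -> Rabs (x - x0) <= d ->
  (1 + cos (2 * PI * d)) / 2 <= peak x0 x.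
Proof.
  intros Hd Hd2 Hx. unfold peak. assert (Hpi := PI_RGT_0).
  assert (E : cos (2 * PI * (x - x0)) = cos (2 * PI * Rabs (x - x0))).
  { unfold Rabs; destruct Rcase_abs; [|reflexivity]. rewrite <- cos_neg. f_equal. ring. }
  rewrite E. assert (Tp := Rabs_pos (x - x0)). set (t := Rabs (x - x0)) in *.
  assert (Hcos : cos (2 * PI * d) <= cos (2 * PI * t)); [|lra].
  apply cos_decr_1; nra.
Qed.

Lemma is_RInt_lower (g : R -> R) (a b v c : R) : a <= b -> is_RInt g a b v ->
  (forall x, a < x < b -> c <= g x) -> (b - a) * c <= v.
Proof.
  intros Hab Hg Hc. apply (is_RInt_le (fun _ => c) g a b); [exact Hab | | exact Hg | exact Hc].
  apply (is_RInt_const (V := R_NormedModule)).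
Qed.

(* The powers of the peak concentrate at x0 and are trigonometric polynomials,
   hence orthogonal to h. *)
Lemma fourier_uniqueness (h : R -> C) (B x0 : R) : 0 < x0 < 1 ->
  (forall m, intC (fun x => h x * expZ m x)%C 0 1 (RtoC 0)) ->
  (forall x, 0 < x < 1 -> Cmod (h x) <= B) ->
  contC h x0 -> h x0 = 0%C.
Proof.
  intros H0 Hm HB Hc. apply NNPP. intros Hne.
  set (H := Cmod (h x0)). assert (HH : 0 < H) by (apply Cmod_gt_0; exact Hne).
  assert (HBp : 0 < B) by (assert (T := HB x0 H0); fold H in T; lra).
  destruct (proj1 (contC_eps h x0) Hc (H / 2) ltac:(lra)) as [d0 [Hd0 Hnear]].
  set (d := Rmin (d0 / 2) (Rmin (x0 / 2) ((1 - x0) / 2))).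
  assert (Hd : 0 < d) by (unfold d; repeat apply Rmin_pos; lra).
  assert (n1 := Rmin_l (d0 / 2) (Rmin (x0 / 2) ((1 - x0) / 2))). assert (n2 := Rmin_r (d0 / 2) (Rmin (x0 / 2) ((1 - x0) / 2))).
  fold d in n1, n2. assert (n3 := Rmin_l (x0 / 2) ((1 - x0) / 2)). assert (n4 := Rmin_r (x0 / 2) ((1 - x0) / 2)).
  (* [rho] bounds the peak from above at distance at least [d] from [x0], and [rho1] bounds it from
     below within d / 2. The contradiction will come from rho < rho1. *)
  set (rho := (1 + cos (2 * PI * d)) / 2). set (rho1 := (1 + cos (2 * PI * (d / 2))) / 2).
  assert (Hpi := PI_RGT_0).
  assert (Hrho : rho < rho1).
  { unfold rho, rho1. assert (cos (2 * PI * d) < cos (2 * PI * (d / 2))); [|lra]. apply cos_decreasing_1; nra. }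
  assert (Hrho0 : 0 <= rho) by (unfold rho; assert (T := COS_bound (2 * PI * d)); lra).
  assert (Hk : forall k m, intC (fun x => h x * (RtoC (peak x0 x ^ k) * expZ m x))%C 0 1 (RtoC 0)).
  { induction k; intros m.
    - eapply intC_ext; [|apply (Hm m)]. intros x _. simpl. ring.
    - assert (I := intC_plus _ _ _ _ _ _ (intC_plus _ _ _ _ _ _ (intC_mult_l (/ 2)%C _ _ _ _ (IHk m))
        (intC_mult_l (/ 4 * expZ (-1) x0)%C _ _ _ _ (IHk (1 + m)%Z))) (intC_mult_l (/ 4 * expZ 1 x0)%C _ _ _ _ (IHk (-1 + m)%Z))).
      eapply intC_eq; [eapply intC_ext; [|exact I]|]; [|ring].
      intros x _. cbv beta. rewrite !expZ_plus. simpl pow. rewrite RtoC_mult, peak_expZ. ring. }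
  (* Multiplying by the conjugate of h(x0) and taking the real part gives a real integrand that is
     positive near [x0]. *)
  set (g := fun k x => Re (Cconj (h x0) * h x)%C * peak x0 x ^ k).
  assert (Hg : forall k, is_RInt (g k) 0 1 0).
  { intros k. assert (I := intC_mult_l (Cconj (h x0)) _ _ _ _ (Hk k 0%Z)).
    apply (is_RInt_fct_extend_fst (U := R_NormedModule) (V := R_NormedModule)) in I.
    replace 0 with (fst (Cconj (h x0) * RtoC 0)%C) at 2 by (simpl; ring).
    eapply is_RInt_ext; [|exact I]. intros x _. cbv beta. rewrite expZ_0. unfold g.
    simpl. unfold Re, Im. ring. }
  assert (Hgl : forall k x, 0 < x < 1 -> d <= Rabs (x - x0) -> - (H * B * rho ^ k) <= g k x).
  { intros k x Hx Hfar. unfold g.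
    assert (P1 := peak_far x0 x d Hd ltac:(lra) ltac:(lra) Hfar). fold rho in P1.
    assert (P2 := peak_range x0 x).
    assert (P3 : peak x0 x ^ k <= rho ^ k) by (apply pow_incr; lra).
    assert (P4 : 0 <= peak x0 x ^ k) by (apply pow_le; lra).
    assert (T : Rabs (Re (Cconj (h x0) * h x)%C) <= H * B).
    { eapply Rle_trans; [apply re_le_Cmod|]. rewrite Cmod_mult, Cmod_conj. fold H.
      apply Rmult_le_compat_l; [lra | apply HB, Hx]. }
    apply Rabs_le_between in T. set (y := Re (Cconj (h x0) * h x)%C) in *.
    assert (0 <= H * B) by nra. assert (0 <= (y + H * B) * peak x0 x ^ k) by (apply Rmult_le_pos; lra).
    assert (H * B * peak x0 x ^ k <= H * B * rho ^ k) by (apply Rmult_le_compat_l; assumption). lra. }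
  assert (Hre : forall x, Rabs (x - x0) <= d -> H ^ 2 / 2 <= Re (Cconj (h x0) * h x)%C).
  { intros x Hx. assert (T := Hnear x ltac:(lra)).
    replace (Cconj (h x0) * h x)%C with (Cconj (h x0) * h x0 + Cconj (h x0) * (h x - h x0))%C by ring.
    rewrite re_plus. assert (E : Re (Cconj (h x0) * h x0)%C = H ^ 2).
    { unfold H. rewrite Cmod2_alt. simpl. unfold Re, Im. ring. }
    rewrite E. assert (T2 := re_le_Cmod (Cconj (h x0) * (h x - h x0))%C).
    rewrite Cmod_mult, Cmod_conj in T2. fold H in T2. apply Rabs_le_between in T2.
    assert (H * Cmod (h x - h x0) <= H * (H / 2)) by (apply Rmult_le_compat_l; lra). lra. }
  (* The integral over (0, 1) is 0. The middle piece has length d and integrand at least H^2 / 2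
     rho1^k, the two pieces at distance d / 2 to d contribute nonnegatively, and the outer pieces,
     of total length 1 - 2 d, at least -H B rho^k per unit length. *)
  assert (HgK : forall k, d * (H ^ 2 / 2 * rho1 ^ k) <= H * B * rho ^ k).
  { intros k.
    assert (X : forall a b, 0 <= a -> a <= b -> b <= 1 -> is_RInt (g k) a b (RInt (g k) a b)).
    { intros a b Ha Hab Hb. apply (RInt_correct (V := R_CompleteNormedModule)).
      apply (ex_RInt_Chasles_1 (V := R_CompleteNormedModule) (g k) a b 1); [lra|].
      apply (ex_RInt_Chasles_2 (V := R_CompleteNormedModule) (g k) 0 a 1); [lra|]. exists 0. apply Hg. }
    assert (I1 := X 0 (x0 - d) ltac:(lra) ltac:(lra) ltac:(lra)).
    assert (I2 := X (x0 - d) (x0 - d / 2) ltac:(lra) ltac:(lra) ltac:(lra)).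
    assert (I3 := X (x0 - d / 2) (x0 + d / 2) ltac:(lra) ltac:(lra) ltac:(lra)).
    assert (I4 := X (x0 + d / 2) (x0 + d) ltac:(lra) ltac:(lra) ltac:(lra)).
    assert (I5 := X (x0 + d) 1 ltac:(lra) ltac:(lra) ltac:(lra)).
    assert (I := is_RInt_Chasles _ _ _ _ _ _ (is_RInt_Chasles _ _ _ _ _ _ (is_RInt_Chasles _ _ _ _ _ _ (is_RInt_Chasles _ _ _ _ _ _ I1 I2) I3) I4) I5).
    assert (E := is_RInt_unique (V := R_CompleteNormedModule) _ _ _ _ I).
    rewrite (is_RInt_unique (V := R_CompleteNormedModule) _ _ _ _ (Hg k)) in E.
    assert (L1 : (x0 - d - 0) * - (H * B * rho ^ k) <= RInt (g k) 0 (x0 - d)).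
    { apply (is_RInt_lower (g k)); [lra | exact I1|]. intros x Hx. apply Hgl; [lra|]. unfold Rabs; destruct Rcase_abs; lra. }
    assert (L5 : (1 - (x0 + d)) * - (H * B * rho ^ k) <= RInt (g k) (x0 + d) 1).
    { apply (is_RInt_lower (g k)); [lra | exact I5|]. intros x Hx. apply Hgl; [lra|]. unfold Rabs; destruct Rcase_abs; lra. }
    assert (Hpos : forall x, Rabs (x - x0) <= d -> 0 <= g k x).
    { intros x Hx. unfold g. apply Rmult_le_pos; [|apply pow_le, peak_range].
      eapply Rle_trans; [|apply Hre, Hx]. nra. }
    assert (L2 : (x0 - d / 2 - (x0 - d)) * 0 <= RInt (g k) (x0 - d) (x0 - d / 2)).
    { apply (is_RInt_lower (g k)); [lra | exact I2|]. intros x Hx. apply Hpos. unfold Rabs; destruct Rcase_abs; lra. }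
    assert (L4 : (x0 + d - (x0 + d / 2)) * 0 <= RInt (g k) (x0 + d / 2) (x0 + d)).
    { apply (is_RInt_lower (g k)); [lra | exact I4|]. intros x Hx. apply Hpos. unfold Rabs; destruct Rcase_abs; lra. }
    assert (L3 : (x0 + d / 2 - (x0 - d / 2)) * (H ^ 2 / 2 * rho1 ^ k) <= RInt (g k) (x0 - d / 2) (x0 + d / 2)).
    { apply (is_RInt_lower (g k)); [lra | exact I3|]. intros x Hx. unfold g.
      assert (Hax : Rabs (x - x0) <= d / 2) by (unfold Rabs; destruct Rcase_abs; lra).
      apply Rmult_le_compat; [nra | apply pow_le; lra | apply Hre; lra |].
      apply pow_incr. split; [lra|]. apply peak_near; lra. }
    change (plus ?a ?b) with (a + b) in E. unfold plus in E; simpl in E.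
    assert (0 <= H * B * rho ^ k) by (apply Rmult_le_pos; [nra | apply pow_le, Hrho0]).
    replace (x0 + d / 2 - (x0 - d / 2)) with d in L3 by field.
    set (c := H * B * rho ^ k) in *.
    assert ((1 - 2 * d) * c <= c) by nra. 
    lra. }
  (* A power with (rho / rho1)^N below the ratio of the two constants violates the inequality just
     obtained. *)
  destruct (pow_lt_1_zero (rho / rho1)) with (y := d * (H ^ 2 / 2) / (H * B)) as [N HN].
  { rewrite Rabs_pos_eq; [apply Rmult_lt_reg_r with rho1; [lra|]; unfold Rdiv; rewrite Rmult_assoc, Rinv_l; lra|].
    apply Rmult_le_pos; [lra | apply Rlt_le, Rinv_0_lt_compat; lra]. }
  { apply Rdiv_lt_0_compat; [|nra]. apply Rmult_lt_0_compat; [lra|]. assert (0 < H ^ 2) by (apply pow_lt; lra). lra. }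
  specialize (HN N (le_n N)). specialize (HgK N).
  assert (Hr1 : 0 < rho1 ^ N) by (apply pow_lt; lra).
  rewrite Rabs_pos_eq in HN by (apply pow_le, Rmult_le_pos; [lra | apply Rlt_le, Rinv_0_lt_compat; lra]).
  unfold Rdiv at 1 in HN. rewrite Rpow_mult_distr, pow_inv in HN.
  apply (Rmult_lt_compat_r (rho1 ^ N)) in HN; [|exact Hr1]. rewrite Rmult_assoc, Rinv_l, Rmult_1_r in HN by lra.
  assert (HHB : 0 < H * B) by nra.
  apply (Rmult_lt_compat_l (H * B)) in HN; [|exact HHB].
  replace (H * B * (d * (H ^ 2 / 2) / (H * B) * rho1 ^ N)) with (d * (H ^ 2 / 2 * rho1 ^ N)) in HN by (field; lra).
  lra.
Qed.

(** * Hurwitz' formula *)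

(** Index [n] stands for the frequencies n + 1 and -(n + 1); frequency 0 is absent since zeta has
    mean 0 over the unit interval. *)
Definition hf_term (s : C) (a : R) (n : nat) : C :=
  (fourier_coef s 1 (S n) * wave (-1) (S n) a + fourier_coef s (-1) (S n) * wave 1 (S n) a)%C.

(** The zeta function for [Re s < 0] and [0 < a <= 1], by its Fourier expansion in [a]. *)
Definition zeta_hf (s : C) (a : R) : C := CSeries (hf_term s a).

Definition hf_bound (G B s1 : R) (n : nat) : R := 2 * (G * exp (2 * B)) * Rpower (INR n + 1) (- (1 - s1)).

Lemma Cmod_fourier_coef (s : C) (d G B s1 : R) (n : nat) : d = 1 \/ d = -1 ->
  Cmod (CGamma (1 - s)) <= G -> Cmod s <= B -> Re s <= s1 -> s1 < 0 ->
  Cmod (fourier_coef s d (S n)) <= G * exp (2 * B) * Rpower (INR n + 1) (- (1 - s1)).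
Proof.
  intros Hd HG HB Hs Hs1. unfold fourier_coef. assert (Tn := pos_INR n).
  assert (Hpi : 1 <= PI) by (assert (T := PI2_3_2); lra). assert (Hpi4 := PI_4).
  rewrite !Cmod_mult, Cmod_Rcpow, Cmod_Cexp, S_INR.
  assert (E1 : Rpower (2 * PI * (INR n + 1)) (Re (s - 1)) <= Rpower (INR n + 1) (- (1 - s1))).
  { rewrite Re_minus. simpl (Re 1).
    apply Rle_trans with (Rpower (INR n + 1) (Re s - 1)); [apply Rpower_le_anti; nra | apply Rpower_le_exp; lra]. }
  assert (E2 : exp (Re (Ci * RtoC (d * (PI / 2)) * (s - 1))) <= exp (2 * B)).
  { apply exp_le. assert (T := im_le_Cmod s). apply Rabs_le_between in T.
    replace (Re (Ci * RtoC (d * (PI / 2)) * (s - 1))) with (- (d * (PI / 2)) * Im s) by (simpl; unfold Im; ring).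
    assert (Tb := Cmod_ge_0 s).
    destruct Hd as [-> | ->].
    - assert (PI / 2 * - Im s <= 2 * B); [|lra].
      destruct (Rle_dec (- Im s) 0); [nra|]. apply Rmult_le_compat; lra.
    - assert (PI / 2 * Im s <= 2 * B); [|lra].
      destruct (Rle_dec (Im s) 0); [nra|]. apply Rmult_le_compat; lra. }
  replace (G * exp (2 * B) * Rpower (INR n + 1) (- (1 - s1))) with (G * Rpower (INR n + 1) (- (1 - s1)) * exp (2 * B)) by ring.
  apply Rmult_le_compat; [apply Rmult_le_pos; [apply Cmod_ge_0 | apply Rlt_le, Rpower_pos] | apply Rlt_le, exp_pos | | exact E2].
  apply Rmult_le_compat; [apply Cmod_ge_0 | apply Rlt_le, Rpower_pos | exact HG | exact E1].
Qed.

Lemma Cmod_hf_term (s : C) (a G B s1 : R) (n : nat) :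
  Cmod (CGamma (1 - s)) <= G -> Cmod s <= B -> Re s <= s1 -> s1 < 0 ->
  Cmod (hf_term s a n) <= hf_bound G B s1 n.
Proof.
  intros HG HB Hs Hs1. unfold hf_term, hf_bound. eapply Rle_trans; [apply Cmod_triangle|].
  rewrite !Cmod_mult, !Cmod_wave, !Rmult_1_r.
  assert (A1 := Cmod_fourier_coef s 1 G B s1 n (or_introl eq_refl) HG HB Hs Hs1).
  assert (A2 := Cmod_fourier_coef s (-1) G B s1 n (or_intror eq_refl) HG HB Hs Hs1). lra.
Qed.

Lemma ex_series_hf_bound (G B s1 : R) : s1 < 0 -> ex_series (hf_bound G B s1).
Proof.
  intros H. apply (ex_series_scal_l (K := R_AbsRing) (2 * (G * exp (2 * B))) (fun n => Rpower (INR n + 1) (- (1 - s1)))).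
  apply ex_series_Rpower; lra.
Qed.

Lemma zeta_hf_uniform (G B s1 eps : R) : s1 < 0 -> 0 < eps ->
  exists N, forall n (s : C) (a : R), (N <= n)%nat -> Cmod (CGamma (1 - s)) <= G -> Cmod s <= B -> Re s <= s1 ->
    Cmod (sumC (hf_term s a) n - zeta_hf s a)%C < eps.
Proof.
  intros Hs1 He. destruct (series_tail_small _ (ex_series_hf_bound G B s1 Hs1) eps He) as [N HN].
  exists N. intros n s a Hn HG HB Hs. eapply Rle_lt_trans; [|apply (HN n Hn)].
  apply CSeries_tail; [|apply ex_series_hf_bound, Hs1]. intros k. apply Cmod_hf_term; assumption.
Qed.

Lemma is_seriesC_hf (s : C) (a : R) : Re s < 0 -> is_seriesC (hf_term s a) (zeta_hf s a).
Proof.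
  intros Hs. apply (is_seriesC_CSeries _ (hf_bound (Cmod (CGamma (1 - s))) (Cmod s) (Re s))).
  - intros n. apply Cmod_hf_term; lra.
  - apply ex_series_hf_bound, Hs.
Qed.

Lemma zeta_hf_bounded (s : C) : Re s < 0 -> exists B, 0 <= B /\ forall a, Cmod (zeta_hf s a) <= B.
Proof.
  intros Hs. set (b := hf_bound (Cmod (CGamma (1 - s))) (Cmod s) (Re s)).
  exists (Series b + 1 + Rabs (Series b)). split.
  - assert (T := Rle_abs (- Series b)). rewrite Rabs_Ropp in T. lra.
  - intros a. assert (T := CSeries_tail (hf_term s a) b 0 ltac:(intros k; apply Cmod_hf_term; lra) (ex_series_hf_bound _ _ _ Hs)).
    rewrite sumC_O, sum_O in T. fold (zeta_hf s a) in T.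
    assert (T1 : Cmod (hf_term s a 0) <= b 0%nat) by (apply Cmod_hf_term; lra).
    assert (T2 := Cmod_triangle_inv (zeta_hf s a) (hf_term s a 0)). rewrite Cmod_minus_sym in T2.
    assert (T3 := Rabs_pos (Series b)). lra.
Qed.

Lemma contC_hf_term (s : C) (n : nat) (a : R) : contC (fun a => hf_term s a n) a.
Proof. unfold hf_term. apply contC_plus; apply contC_mult; try apply contC_const; apply contC_wave. Qed.

Lemma contC_zeta_hf (s : C) (a : R) : Re s < 0 -> contC (zeta_hf s) a.
Proof.
  intros Hs. apply (contC_uniform_limit (fun n a => sumC (hf_term s a) n) _ _ 1 Rlt_0_1).
  - intros n. apply contC_sumC. intros k. apply contC_hf_term.
  - intros eps He. destruct (zeta_hf_uniform (Cmod (CGamma (1 - s))) (Cmod s) (Re s) eps Hs He) as [N HN].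
    exists N. intros n y Hn _. apply HN; [exact Hn | lra..].
Qed.

(** Termwise integration, justified by uniform convergence in [a]. It serves with [g] = [expZ m] for
    the Fourier coefficients and with [g] = [zeta_hf s2] for Parseval's identity. *)
Lemma zeta_hf_integral (s : C) (g : R -> C) (l : nat -> C) : Re s < 0 ->
  (forall x, contC g x) ->
  (forall n, intC (fun a => hf_term s a n * g a)%C 0 1 (l n)) ->
  exists I, intC (fun a => zeta_hf s a * g a)%C 0 1 I /\ is_seriesC l I.
Proof.
  intros Hs Hg Hl.
  destruct (contC_bounded g 0 1 Rle_0_1 (fun t _ => Hg t)) as [B [HB0 HB]].
  destruct (intC_unif_lim (fun n a => sumC (fun k => hf_term s a k * g a)%C n) (fun a => zeta_hf s a * g a)%C 0 1 (sumC l) Rle_0_1) as [I [HI HL]].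
  - intros n. apply (intC_sum (fun k a => hf_term s a k * g a)%C), Hl.
  - intros eps He.
    destruct (zeta_hf_uniform (Cmod (CGamma (1 - s))) (Cmod s) (Re s) (eps / (B + 1)) Hs ltac:(apply Rdiv_lt_0_compat; lra)) as [N HN].
    exists N. intros n x Hn Hx. specialize (HN n s x Hn ltac:(lra) ltac:(lra) ltac:(lra)).
    replace (sumC (fun k => hf_term s x k * g x)%C n) with (sumC (hf_term s x) n * g x)%C.
    2:{ clear. induction n; [rewrite !sumC_O; reflexivity | rewrite !sumC_S, <- IHn; ring]. }
    replace (_ - _)%C with ((sumC (hf_term s x) n - zeta_hf s x) * g x)%C by ring.
    rewrite Cmod_mult. specialize (HB x ltac:(lra)).
    apply Rle_lt_trans with (Cmod (sumC (hf_term s x) n - zeta_hf s x)%C * (B + 1)); [apply Rmult_le_compat_l; [apply Cmod_ge_0 | lra]|].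
    apply (Rmult_lt_compat_r (B + 1)) in HN; [|lra].
    replace (eps / (B + 1) * (B + 1)) with eps in HN by (field; lra). exact HN.
  - exists I. split; [exact HI|]. apply is_seriesC_eps, HL.
Qed.

Lemma intC_expZ (m : Z) : intC (expZ m) 0 1 (if Z.eq_dec m 0 then RtoC 1 else RtoC 0).
Proof.
  destruct (Z.eq_dec m 0) as [->|Hm].
  - eapply intC_eq; [eapply intC_ext; [|apply (intC_const 1 0 1)]|].
    + intros x _. symmetry. apply expZ_0.
    + rewrite Rminus_0_r. ring.
  - assert (Hpi := PI_RGT_0).
    set (w := (Ci * RtoC (2 * PI * IZR m))%C).
    assert (Hw : w <> 0%C).
    { unfold w. apply Cmult_neq_0.
      - intros E. apply (f_equal Cmod) in E. rewrite Cmod_Ci, Cmod_0 in E. lra.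
      - intros E. apply RtoC_inj in E. apply Hm. apply eq_IZR.
        apply Rmult_eq_reg_l with (2 * PI); lra. }
    assert (D : forall x, derivC (fun x => / w * expZ m x)%C x (expZ m x)).
    { intros x. unfold expZ. eapply derivC_eq.
      - apply derivC_mult; [apply derivC_const|]. apply derivC_Cexp.
        apply (derivC_ext (fun t => w * RtoC t)%C).
        + intros t. unfold w. rewrite (RtoC_mult _ t). ring.
        + apply derivC_mult; [apply derivC_const | apply derivC_id].
      - cbv beta. fold w. field. exact Hw. }
    assert (I := intC_derive (fun x => / w * expZ m x)%C (expZ m) 0 1 (fun x _ => D x)).
    eapply intC_eq; [apply I|].
    + intros x _. unfold expZ. apply contC_Cexp, contC_mult; [apply contC_const|]. apply contC_RtoC.
      apply (ex_derive_continuous (V := R_NormedModule)). auto_derive. exact Logic.I.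
    + assert (E : expZ m 1 = expZ m 0).
      { unfold expZ. rewrite Rmult_0_r, Rmult_1_r, Cmult_0_r, Cexp_0.
        destruct (Z_le_gt_dec 0 m) as [Hle|Hle].
        - rewrite <- (Z2Nat.id m Hle), <- INR_IZR_INZ. apply Cexp_2PI_nat.
        - replace m with (- Z.of_nat (Z.to_nat (- m)))%Z by lia. rewrite opp_IZR, <- INR_IZR_INZ.
          replace (Ci * RtoC (2 * PI * - INR (Z.to_nat (- m))))%C with (- (Ci * RtoC (2 * PI * INR (Z.to_nat (- m)))))%C
            by (replace (2 * PI * - INR (Z.to_nat (- m))) with (- (2 * PI * INR (Z.to_nat (- m)))) by ring; rewrite RtoC_opp; ring).
          rewrite Cexp_opp, Cexp_2PI_nat. field. }
      cbv beta. rewrite E. ring.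
Qed.

Lemma is_seriesC_single (k : nat) (c : C) : is_seriesC (fun n => if Nat.eq_dec n k then c else RtoC 0) c.
Proof.
  apply is_seriesC_eps. intros eps He. exists k. intros n Hn.
  assert (E : forall m, sumC (fun n => if Nat.eq_dec n k then c else RtoC 0) m = if le_dec k m then c else RtoC 0).
  { induction m.
    - rewrite sumC_O. destruct (Nat.eq_dec 0 k), (le_dec k 0); try lia; reflexivity.
    - rewrite sumC_S, IHm. destruct (Nat.eq_dec (S m) k), (le_dec k m), (le_dec k (S m)); try lia; ring. }
  rewrite E. destruct (le_dec k n); [|lia]. rewrite Cmod_minus_diag. exact He.
Qed.

Lemma zeta_hf_expZ (s : C) (m : Z) : Re s < 0 ->
  intC (fun a => zeta_hf s a * expZ m a)%C 0 1
    (if Z.eq_dec m 0 then RtoC 0 else fourier_coef s (if Z_lt_ge_dec m 0 then 1 else -1) (Z.to_nat (Z.abs m))).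
Proof.
  intros Hs.
  assert (T : forall n, intC (fun a => hf_term s a n * expZ m a)%C 0 1
    (fourier_coef s 1 (S n) * (if Z.eq_dec (Z.of_nat (S n) + m) 0 then RtoC 1 else RtoC 0) +
     fourier_coef s (-1) (S n) * (if Z.eq_dec (- Z.of_nat (S n) + m) 0 then RtoC 1 else RtoC 0))%C).
  { intros n. eapply intC_ext; [|apply intC_plus; apply intC_mult_l; apply intC_expZ].
    intros a _. cbv beta. unfold hf_term. rewrite !expZ_plus.
    rewrite !wave_expZ by (left; reflexivity) || (right; reflexivity).
    destruct (Req_dec_T (-1) 1); [lra|]. destruct (Req_dec_T 1 1); [|lra]. ring. }
  assert (Cg : forall x, contC (expZ m) x).
  { intros x. unfold expZ. apply contC_Cexp, contC_mult; [apply contC_const|]. apply contC_RtoC.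
    apply (ex_derive_continuous (V := R_NormedModule)). auto_derive. exact Logic.I. }
  destruct (zeta_hf_integral s (expZ m) _ Hs Cg T) as [I [HI HS]].
  - eapply intC_eq; [exact HI|]. apply (is_seriesC_unique _ _ _ HS).
    destruct (Z.eq_dec m 0) as [->|Hm].
    + apply is_seriesC_eps. intros eps He. exists 0%nat. intros n _.
      match goal with |- Cmod (?S - _) < _ => replace S with (RtoC 0) end.
      { rewrite Cmod_minus_diag. exact He. }
      symmetry. induction n.
      * rewrite sumC_O. destruct (Z.eq_dec _ 0); [lia|]. destruct (Z.eq_dec _ 0); [lia|]. ring.
      * rewrite sumC_S, IHn. destruct (Z.eq_dec _ 0); [lia|]. destruct (Z.eq_dec _ 0); [lia|]. ring.
    + set (k := Z.to_nat (Z.abs m)).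
      set (c := fourier_coef s (if Z_lt_ge_dec m 0 then 1 else -1) k).
      (* Only the term of frequency k survives orthogonality; it has index k - 1 in the series. *)
      assert (X := is_seriesC_single (pred k) c).
      apply is_seriesC_eps. intros eps He. destruct (proj1 (is_seriesC_eps _ _) X eps He) as [N HN].
      exists N. intros n Hn. specialize (HN n Hn). 
      rewrite (sumC_ext _ (fun n => if Nat.eq_dec n (pred k) then c else RtoC 0)); [exact HN|].
      intros j _. unfold c. destruct (Z_lt_ge_dec m 0).
      * destruct (Z.eq_dec (- Z.of_nat (S j) + m) 0); [lia|].
        destruct (Z.eq_dec (Z.of_nat (S j) + m) 0), (Nat.eq_dec j (pred k)); unfold k in *; try lia; [|ring].
        replace (S j) with (Z.to_nat (Z.abs m)) by lia. ring.
      * destruct (Z.eq_dec (Z.of_nat (S j) + m) 0); [lia|].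
        destruct (Z.eq_dec (- Z.of_nat (S j) + m) 0), (Nat.eq_dec j (pred k)); unfold k in *; try lia; [|ring].
        replace (S j) with (Z.to_nat (Z.abs m)) by lia. ring.
Qed.

Lemma zeta_hf_wave (s : C) (d : R) (k : nat) : d = 1 \/ d = -1 -> (0 < k)%nat -> Re s < 0 ->
  intC (fun a => zeta_hf s a * wave d k a)%C 0 1 (fourier_coef s d k).
Proof.
  intros Hd Hk Hs. destruct Hd as [-> | ->].
  - eapply intC_eq; [eapply intC_ext; [|apply (zeta_hf_expZ s (- Z.of_nat k) Hs)]|].
    + intros a _. cbv beta. rewrite wave_expZ by (left; reflexivity). destruct (Req_dec_T 1 1); [reflexivity | lra].
    + destruct (Z.eq_dec (- Z.of_nat k) 0); [lia|]. destruct (Z_lt_ge_dec (- Z.of_nat k) 0); [|lia]. f_equal. lia.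
  - eapply intC_eq; [eapply intC_ext; [|apply (zeta_hf_expZ s (Z.of_nat k) Hs)]|].
    + intros a _. cbv beta. rewrite wave_expZ by (right; reflexivity). destruct (Req_dec_T (-1) 1); [lra | reflexivity].
    + destruct (Z.eq_dec (Z.of_nat k) 0); [lia|]. destruct (Z_lt_ge_dec (Z.of_nat k) 0); [lia|]. f_equal. lia.
Qed.

Lemma zeta_em_expZ (s : C) (m : Z) : - 1 < Re s < 0 ->
  intC (fun a => zeta_em s a * expZ m a)%C 0 1
    (if Z.eq_dec m 0 then RtoC 0 else fourier_coef s (if Z_lt_ge_dec m 0 then 1 else -1) (Z.to_nat (Z.abs m))).
Proof.
  intros Hs. destruct (Z.eq_dec m 0) as [->|Hm].
  - eapply intC_ext; [|apply zeta_em_mean, Hs]. intros a _. cbv beta. rewrite expZ_0. ring.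
  - destruct (Z_lt_ge_dec m 0).
    + eapply intC_ext; [|apply zeta_em_fourier; [left; reflexivity | lia | exact Hs]].
      intros a _. cbv beta. rewrite wave_expZ by (left; reflexivity). destruct (Req_dec_T 1 1); [|lra]. f_equal. f_equal. lia.
    + eapply intC_ext; [|apply zeta_em_fourier; [right; reflexivity | lia | exact Hs]].
      intros a _. cbv beta. rewrite wave_expZ by (right; reflexivity). destruct (Req_dec_T (-1) 1); [lra|]. f_equal. f_equal. lia.
Qed.

(** The function is uniformly close to an approximant, which [pw] makes continuous on the closed
    interval because Re s < 0. *)
Lemma zeta_em_bounded (s : C) : - 1 < Re s < 0 -> exists B, 0 <= B /\ forall a, 0 < a < 1 -> Cmod (zeta_em s a) <= B.
Proof.
  intros Hs. assert (Hs1 : s <> 1%C) by (apply Re_not_1; lra).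
  destruct (em_approx_uniform s 1 ltac:(lra) Hs1 Rlt_0_1) as [N HN].
  destruct (contC_bounded (em_approx s N) 0 1 Rle_0_1) as [B [HB0 HB]].
  - intros t _. unfold em_approx. apply contC_plus; [|apply contC_line].
    apply (contC_sumC (fun n a => pw (INR n + a) (- s))). intros k.
    apply (contC_comp (fun x => pw x (- s)) (fun a => INR k + a)).
    + apply (continuous_plus (V := R_NormedModule)); [apply continuous_const | apply continuous_id].
    + apply contC_pw. rewrite re_opp. lra.
  - exists (B + 1). split; [lra|]. intros a Ha. specialize (HN N a (le_n N) Ha). specialize (HB a ltac:(lra)).
    rewrite Cmod_minus_sym in HN. assert (T := Cmod_triangle_inv (zeta_em s a) (em_approx s N a)). lra.
Qed.

Lemma hurwitz_formula (s : C) (a : R) : - 1 < Re s < 0 -> 0 < a <= 1 -> zeta_em s a = zeta_hf s a.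
Proof.
  intros Hs. assert (Hs1 : s <> 1%C) by (apply Re_not_1; lra).
  set (h := fun a => (zeta_em s a - zeta_hf s a)%C).
  assert (Hh : forall a, 0 < a -> contC h a).
  { intros x Hx. apply contC_minus; [apply contC_zeta_em; [exact Hx | lra | exact Hs1] | apply contC_zeta_hf; lra]. }
  assert (Hopen : forall a, 0 < a < 1 -> h a = 0%C).
  { intros x Hx.
    destruct (zeta_em_bounded s Hs) as [B1 [HB1 H1]]. destruct (zeta_hf_bounded s (proj2 Hs)) as [B2 [HB2 H2]].
    apply (fourier_uniqueness h (B1 + B2) x Hx).
    - intros m. assert (I := intC_minus _ _ _ _ _ _ (zeta_em_expZ s m Hs) (zeta_hf_expZ s m (proj2 Hs))).
      eapply intC_eq; [eapply intC_ext; [|exact I]|]; [|ring]. intros y _. unfold h. ring.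
    - intros y Hy. unfold h, Cminus. eapply Rle_trans; [apply Cmod_triangle|]. rewrite Cmod_opp.
      specialize (H1 y Hy). specialize (H2 y). lra.
    - apply Hh. lra. }
  assert (Hall : forall a, 0 < a <= 1 -> h a = 0%C).
  (* [fourier_uniqueness] covers the open interval; a = 1 is reached by continuity from the left. *)
  { intros x Hx. destruct (Req_dec x 1) as [->|Hne]; [|apply Hopen; lra].
    apply Cmod_small_eq_0. intros eps He.
    destruct (proj1 (contC_eps h 1) (Hh 1 ltac:(lra)) eps He) as [d [Hd H]].
    set (y := 1 - Rmin (d / 2) (1 / 2)).
    assert (m1 := Rmin_l (d / 2) (1 / 2)). assert (m2 := Rmin_r (d / 2) (1 / 2)).
    assert (m3 : 0 < Rmin (d / 2) (1 / 2)) by (apply Rmin_pos; lra).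
    specialize (H y). rewrite Hopen in H by (unfold y; lra).
    replace (0 - h 1)%C with (- h 1)%C in H by ring. rewrite Cmod_opp in H. apply Rlt_le, H.
    unfold y. unfold Rabs; destruct Rcase_abs; lra. }
  intros Ha. apply C_eq_of_minus, Hall, Ha.
Qed.

(** * Continuation to the whole plane *)

Lemma QH_CGamma_reflect (z0 : C) : Re z0 < 1 -> QH (fun s => CGamma (1 - s)) z0 ((1 - Re z0) / 8).
Proof.
  intros H. apply (QH_reflect CGamma).
  replace ((1 - Re z0) / 8) with (Re (1 - z0) / 2 / 4) by (rewrite Re_minus; simpl (Re 1); field).
  apply QH_CGamma. rewrite Re_minus. simpl (Re 1). lra.
Qed.

Lemma QH_fourier_coef (d : R) (k : nat) (z0 : C) : Re z0 < 1 ->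
  QH (fun s => fourier_coef s d k) z0 ((1 - Re z0) / 8).
Proof.
  intros H. unfold fourier_coef. apply QH_mult; [apply QH_mult; [apply QH_CGamma_reflect, H|]|].
  - apply (QH_ext (fun s => Rcpow (2 * PI * INR k) s * Rcpow (2 * PI * INR k) (- (1)))%C).
    + intros s _. rewrite <- Rcpow_plus. reflexivity.
    + apply QH_mult; [apply QH_Rcpow | apply QH_const].
  - set (c := (Ci * RtoC (d * (PI / 2)))%C). apply (QH_ext (fun s => Cexp (s * c) * Cexp (- c))%C).
    + intros s _. rewrite <- Cexp_plus. f_equal. ring.
    + apply QH_mult; [apply QH_Cexp_mult | apply QH_const].
Qed.

Lemma QH_zeta_hf (a : R) (z0 : C) : Re z0 < 0 -> exists r, 0 < r /\ r <= - Re z0 /\ QH (fun s => zeta_hf s a) z0 r.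
Proof.
  intros Hz. set (r := Rmin ((1 - Re z0) / 8) (- Re z0 / 2)).
  assert (m1 := Rmin_l ((1 - Re z0) / 8) (- Re z0 / 2)). assert (m2 := Rmin_r ((1 - Re z0) / 8) (- Re z0 / 2)). fold r in m1, m2.
  assert (Hr : 0 < r) by (apply Rmin_pos; lra).
  assert (HQ : forall f, QH f z0 ((1 - Re z0) / 8) -> QH f z0 r).
  { intros f Hf. apply (QH_sub f z0 z0 _ _ Hf). rewrite Cmod_minus_diag. lra. }
  destruct (QH_bounds _ _ _ Hr (HQ _ (QH_CGamma_reflect z0 ltac:(lra)))) as [f' [K [G [_ [HG0 [_ [_ [HG _]]]]]]]].
  exists (r / 4). split; [lra|]. split; [lra|].
  apply (QH_uniform_limit (fun n s => sumC (hf_term s a) n)); [exact Hr | |].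
  - intros n. unfold sumC. apply (QH_sum_n (fun k s => hf_term s a k)). intros k. unfold hf_term.
    apply QH_plus; apply QH_mult; try apply QH_const; apply HQ, QH_fourier_coef; lra.
  - intros eps He.
    destruct (zeta_hf_uniform G (Cmod z0 + r) (Re z0 / 2) eps ltac:(lra) He) as [N HN].
    exists N. intros n z Hn Hzz. apply HN; [exact Hn | apply HG, Hzz | |].
    + assert (T := Cmod_triangle_inv z z0). lra.
    + assert (T := re_le_Cmod (z - z0)%C). rewrite Re_minus in T. apply Rabs_le_between in T. lra.
Qed.

(** For 0 < a <= 1 the two expressions agree on -1 < Re s < 0, so around every point other than 1
    one of them alone represents the function on a whole ball. *)
Definition zeta_full (a : R) (s : C) : C := if Rlt_dec (- 1) (Re s) then zeta_em s a else zeta_hf s a.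

Lemma zeta_full_em (a : R) (s : C) : - 1 < Re s -> zeta_full a s = zeta_em s a.
Proof. intros H. unfold zeta_full. destruct (Rlt_dec (-1) (Re s)); [reflexivity | contradiction]. Qed.

Lemma zeta_full_hf (a : R) (s : C) : 0 < a <= 1 -> Re s < 0 -> zeta_full a s = zeta_hf s a.
Proof.
  intros Ha H. unfold zeta_full. destruct (Rlt_dec (-1) (Re s)); [|reflexivity].
  apply hurwitz_formula; lra.
Qed.

Lemma QH_zeta_full (a : R) (z0 : C) : 0 < a <= 1 -> z0 <> 1%C -> exists r, 0 < r /\ QH (zeta_full a) z0 r.
Proof.
  intros Ha H1. destruct (Rlt_dec (-1) (Re z0)) as [Hre|Hre].
  - destruct (em_radius_spec z0 Hre H1) as [Hr [_ Hball]].
    exists (em_radius z0 / 4). split; [lra|].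
    apply (QH_ext (fun s => zeta_em s a)); [|apply QH_zeta_em; lra || assumption].
    intros z Hz. destruct (Hball z ltac:(lra)) as [T _]. symmetry. apply zeta_full_em. lra.
  - destruct (QH_zeta_hf a z0 ltac:(lra)) as [r [Hr [Hr2 HQ]]]. exists r. split; [exact Hr|].
    apply (QH_ext (fun s => zeta_hf s a)); [|exact HQ].
    intros z Hz. symmetry. apply zeta_full_hf; [exact Ha|].
    assert (T := re_le_Cmod (z - z0)%C). rewrite Re_minus in T. apply Rabs_le_between in T. lra.
Qed.

Lemma analytic_zeta_full (a : R) (s : C) : 0 < a <= 1 -> s <> 1%C -> analytic_at (zeta_full a) s.
Proof.
  intros Ha H1. destruct (QH_zeta_full a s Ha H1) as [r [Hr HQ]]. apply (QH_analytic_at _ _ r Hr HQ).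
Qed.

Lemma is_hurwitz_zeta_full (a : R) : 0 < a <= 1 -> is_hurwitz_zeta a (zeta_full a).
Proof.
  intros Ha. split.
  - intros s Hs. rewrite zeta_full_em by lra. apply zeta_em_series; lra.
  - intros s Hs. apply analytic_zeta_full; assumption.
Qed.

(** With [zeta_full] as a witness, [epsilon] returns some function satisfying [is_hurwitz_zeta].
    Both functions are the sum of the same series for Re s > 1, in particular between the lines |Re
    s| + 2 and |Re s| + 3, and the identity theorem carries the equality back to [s]. *)
Lemma hurwitz_zeta_full (a : R) (s : C) : 0 < a <= 1 -> s <> 1%C -> hurwitz_zeta s a = zeta_full a s.
Proof.
  intros Ha H1.
  assert (Hspec := epsilon_spec (inhabits (fun _ : C => RtoC 0)) (is_hurwitz_zeta a)
    (ex_intro _ _ (is_hurwitz_zeta_full a Ha))).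
  unfold hurwitz_zeta. set (f := epsilon _ _) in *. destruct Hspec as [F1 F2].
  destruct (is_hurwitz_zeta_full a Ha) as [G1 G2].
  apply C_eq_of_minus.
  apply (identity_strip (fun s => f s - zeta_full a s)%C 1 (Re s - 1) (Rabs (Re s) + 3) (Rabs (Re s) + 2) (Rabs (Re s) + 3)).
    - intros z _ Hz. apply analytic_at_minus; auto.
    - assert (T := Rle_abs (Re s)). lra.
    - lra.
    - lra.
    - intros z Hz. assert (T := Rabs_pos (Re s)).
      assert (E := is_seriesC_unique _ _ _ (F1 z ltac:(lra)) (G1 z ltac:(lra))). rewrite E. ring.
    - assert (T := Rle_abs (Re s)). lra.
    - exact H1.
Qed.

(** * Rational parameters *)

Lemma Ci_neq_0 : Ci <> 0%C.
Proof. intros E. apply (f_equal Cmod) in E. rewrite Cmod_Ci, Cmod_0 in E. lra. Qed.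

Lemma Ci_sqr : (Ci * Ci)%C = (- (1))%C.
Proof. Cparts. Qed.

(** With theta = pi s / 2 + 2 pi (n + 1) a the two phases are -i exp (i theta) and i exp (-i theta),
    whose sum is 2 sin theta. *)
Lemma hf_term_sin (s : C) (a : R) (n : nat) :
  hf_term s a n = (2 * CGamma (1 - s) * Rcpow (2 * PI * INR (S n)) (s - 1) *
    Csin (PI * s / 2 + RtoC (2 * PI * INR (S n) * a)))%C.
Proof.
  unfold hf_term, fourier_coef, wave, Csin.
  set (t := RtoC (2 * PI * INR (S n) * a)). set (P := Rcpow (2 * PI * INR (S n)) (s - 1)).
  assert (E1 : (Cexp (Ci * RtoC (1 * (PI / 2)) * (s - 1)) * Cexp (- (Ci * RtoC (-1) * t)))%C =
     (- Ci * Cexp (Ci * (PI * s / 2 + t)))%C).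
  { rewrite <- Cexp_plus.
    replace (Ci * RtoC (1 * (PI / 2)) * (s - 1) + - (Ci * RtoC (-1) * t))%C with
      (Ci * (PI * s / 2 + t) + - (Ci * RtoC (1 * (PI / 2))))%C.
    - rewrite Cexp_plus, (Cexp_opp (Ci * RtoC (1 * (PI / 2)))), Cexp_quarter_turn by (left; reflexivity).
      assert (Hi := Ci_neq_0). replace (- Ci)%C with (/ (Ci * 1))%C; [ring|].
      replace (- Ci)%C with (- (1) * / Ci * (Ci * Ci))%C by (field; exact Hi). rewrite Ci_sqr. field. exact Hi.
    - rewrite Rmult_1_l. replace (RtoC (PI / 2)) with (PI / 2)%C by (rewrite RtoC_div by lra; reflexivity).
      change (RtoC (-1)) with (RtoC (Ropp 1)). rewrite RtoC_opp. field. }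
  assert (E2 : (Cexp (Ci * RtoC (-1 * (PI / 2)) * (s - 1)) * Cexp (- (Ci * RtoC 1 * t)))%C =
     (Ci * Cexp (- (Ci * (PI * s / 2 + t))))%C).
  { rewrite <- Cexp_plus.
    replace (Ci * RtoC (-1 * (PI / 2)) * (s - 1) + - (Ci * RtoC 1 * t))%C with
      (- (Ci * (PI * s / 2 + t)) + (Ci * RtoC (1 * (PI / 2))))%C.
    - rewrite Cexp_plus, Cexp_quarter_turn by (left; reflexivity). ring.
    - rewrite Rmult_1_l. replace (-1 * (PI / 2)) with (- (PI / 2)) by ring. rewrite RtoC_opp.
      replace (RtoC (PI / 2)) with (PI / 2)%C by (rewrite RtoC_div by lra; reflexivity). field. }
  replace (_ + _)%C with (CGamma (1 - s) * P *
    ((Cexp (Ci * RtoC (1 * (PI / 2)) * (s - 1)) * Cexp (- (Ci * RtoC (-1) * t))) +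
     (Cexp (Ci * RtoC (-1 * (PI / 2)) * (s - 1)) * Cexp (- (Ci * RtoC 1 * t)))))%C by ring.
  rewrite E1, E2. set (X := Cexp (Ci * (PI * s / 2 + t))). set (Y := Cexp (- (Ci * (PI * s / 2 + t)))).
  assert (Hi := Ci_neq_0).
  replace (- Ci * X + Ci * Y)%C with ((Ci * Ci) * (Y - X) / Ci)%C by (field; exact Hi).
  rewrite Ci_sqr. field. exact Hi.
Qed.

Lemma Csin_period (z : C) (n : nat) : Csin (z + RtoC (2 * PI * INR n)) = Csin z.
Proof.
  unfold Csin. replace (Ci * (z + RtoC (2 * PI * INR n)))%C with (Ci * z + Ci * RtoC (2 * PI * INR n))%C by ring.
  replace (- (Ci * z + Ci * RtoC (2 * PI * INR n)))%C with (- (Ci * z) + - (Ci * RtoC (2 * PI * INR n)))%C by ring.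
  rewrite !Cexp_plus, !Cexp_opp, Cexp_2PI_nat. f_equal. f_equal; [ring|]. f_equal. field. apply Cexp_neq_0.
Qed.

Lemma sumC_append (f : nat -> C) (n p : nat) :
  sumC f (n + S p) = (sumC f n + sumC (fun j => f (S n + j)%nat) p)%C.
Proof.
  induction p.
  - rewrite Nat.add_1_r, sumC_S, sumC_O. f_equal. f_equal. lia.
  - rewrite Nat.add_succ_r, sumC_S, IHp, sumC_S. rewrite Cplus_assoc. reflexivity.
Qed.

Lemma sumC_blocks (f : nat -> C) (p M : nat) :
  sumC f (M * S p + p) = sumC (fun m => sumC (fun j => f (m * S p + j)%nat) p) M.
Proof.
  induction M.
  - rewrite sumC_O. reflexivity.
  - rewrite sumC_S, <- IHM. replace (S M * S p + p)%nat with ((M * S p + p) + S p)%nat by lia.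
    rewrite sumC_append. f_equal. apply sumC_ext. intros j _. f_equal. lia.
Qed.

(** Grouping into blocks of length p + 1 passes to a subsequence of the partial sums. *)
Lemma is_seriesC_blocks (f : nat -> C) (l : C) (p : nat) : is_seriesC f l ->
  is_seriesC (fun m => sumC (fun j => f (m * S p + j)%nat) p) l.
Proof.
  intros H. apply is_seriesC_eps. intros eps He.
  destruct (proj1 (is_seriesC_eps _ _) H eps He) as [N HN]. exists N. intros n Hn.
  rewrite <- sumC_blocks. apply HN. nia.
Qed.

Lemma is_seriesC_plus (f g : nat -> C) (l m : C) : is_seriesC f l -> is_seriesC g m ->
  is_seriesC (fun n => f n + g n)%C (l + m)%C.
Proof. apply (is_series_plus (K := C_AbsRing) (V := C_NormedModule)). Qed.

Lemma is_seriesC_mult_l (c : C) (f : nat -> C) (l : C) : is_seriesC f l ->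
  is_seriesC (fun n => c * f n)%C (c * l)%C.
Proof. apply (is_series_scal (K := C_AbsRing) (V := C_NormedModule)). Qed.

Lemma is_seriesC_ext (f g : nat -> C) (l : C) : (forall n, f n = g n) -> is_seriesC f l -> is_seriesC g l.
Proof. apply is_series_ext. Qed.

Lemma is_seriesC_sum (F : nat -> nat -> C) (L : nat -> C) (p : nat) :
  (forall j, (j <= p)%nat -> is_seriesC (fun m => F m j) (L j)) ->
  is_seriesC (fun m => sumC (F m) p) (sumC L p).
Proof.
  induction p; intros H.
  - rewrite sumC_O. apply (is_seriesC_ext (fun m => F m 0%nat)); [intros; rewrite sumC_O; reflexivity | apply H; lia].
  - rewrite sumC_S. apply (is_seriesC_ext (fun m => sumC (F m) p + F m (S p))%C); [intros; rewrite sumC_S; reflexivity|].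
    apply is_seriesC_plus; [apply IHp; intros; apply H; lia | apply H; lia].
Qed.

(** Write the frequency as m q + r with q = p + 1 and r = j + 1 running from 1 to q. By periodicity
    the sine depends on r only, and (m q + r)^(s - 1) = q^(s - 1) (m + r / q)^(s - 1) sums over m to
    zeta (1 - s, r / q), where Re (1 - s) > 1. *)
Lemma zeta_hf_rational (s : C) (a p : nat) : Re s < 0 ->
  zeta_hf s (INR a / INR (S p)) =
  (2 * Rcpow (2 * PI * INR (S p)) (s - 1) * CGamma (1 - s) *
   sumC (fun j => Csin (PI * s / 2 + RtoC (2 * PI * INR (S j) * INR a / INR (S p))) *
      zeta_em (1 - s) (INR (S j) / INR (S p))%R) p)%C.
Proof.
  intros Hs. assert (Hpi := PI_RGT_0).
  assert (Hq : 0 < INR (S p)) by (apply lt_0_INR; lia). set (q := INR (S p)) in *.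
  apply (is_seriesC_unique _ _ _ (is_seriesC_blocks _ _ p (is_seriesC_hf s (INR a / q) Hs))).
  rewrite <- sumC_mult_l.
  apply is_seriesC_sum. intros j Hj.
  assert (Hj0 : 0 < INR (S j)) by (apply lt_0_INR; lia).
  assert (Z := zeta_em_series (1 - s) (INR (S j) / q) ltac:(apply Rdiv_lt_0_compat; lra) ltac:(rewrite Re_minus; simpl (Re 1); lra)).
  apply (is_seriesC_mult_l (2 * Rcpow (2 * PI * q) (s - 1) * CGamma (1 - s) * Csin (PI * s / 2 + RtoC (2 * PI * INR (S j) * INR a / q)))%C) in Z.
  cbv beta. rewrite Cmult_assoc. eapply is_seriesC_ext; [|exact Z].
  intros m. cbv beta. rewrite hf_term_sin.
  assert (Tm := pos_INR m).
  assert (E : INR (S (m * S p + j)) = q * (INR m + INR (S j) / q)).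
  { rewrite S_INR, plus_INR, mult_INR, (S_INR j). fold q. field. lra. }
  assert (Hpos : 0 < INR m + INR (S j) / q) by (assert (0 < INR (S j) / q) by (apply Rdiv_lt_0_compat; lra); lra).
  rewrite E.
  replace (2 * PI * (q * (INR m + INR (S j) / q))) with ((2 * PI * q) * (INR m + INR (S j) / q)) at 1 by ring.
  rewrite (Rcpow_mult (2 * PI * q) (INR m + INR (S j) / q)) by nra.
  replace (2 * PI * (q * (INR m + INR (S j) / q)) * (INR a / q)) with (2 * PI * INR (S j) * INR a / q + 2 * PI * INR (m * a))
    by (rewrite mult_INR; field; lra).
  rewrite (RtoC_plus (2 * PI * INR (S j) * INR a / q)), Cplus_assoc, Csin_period.
  replace (- (1 - s))%C with (s - 1)%C by ring. ring.
Qed.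

Lemma sum_n_m_sumC (f : nat -> C) (p : nat) :
  sum_n_m (G := C_AbelianMonoid) f 1 (S p) = sumC (fun j => f (S j)) p.
Proof.
  unfold sumC, sum_n. symmetry. apply (sum_n_m_S (G := C_AbelianMonoid) f 0 p).
Qed.

Lemma QH_Csin_shift (c z0 : C) (r : R) : QH (fun s => Csin (PI * s / 2 + c)%C) z0 r.
Proof.
  set (l := (Ci * (PI / 2))%C).
  apply (QH_ext (fun s => (Cexp (s * l) * Cexp (Ci * c) - Cexp (s * - l) * Cexp (- (Ci * c))) * / (2 * Ci))%C).
  - intros s _. unfold Csin, l. rewrite <- !Cexp_plus. unfold Cdiv. f_equal. f_equal.
    + f_equal. ring.
    + f_equal. f_equal. ring.
  - apply QH_mult; [|apply QH_const]. apply QH_minus; apply QH_mult; try apply QH_const; apply QH_Cexp_mult.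
Qed.

Lemma INR_div_range (k q : nat) : (1 <= k <= q)%nat -> 0 < INR k / INR q <= 1.
Proof.
  intros Hk. assert (Hq : 0 < INR q) by (apply lt_0_INR; lia).
  split; [apply Rdiv_lt_0_compat; [apply lt_0_INR; lia | exact Hq]|].
  apply Rmult_le_reg_r with (INR q); [exact Hq|]. unfold Rdiv. rewrite Rmult_assoc, Rinv_l by lra.
  rewrite Rmult_1_r, Rmult_1_l. apply le_INR. lia.
Qed.

Lemma rational_formula_continued (s : C) (a p : nat) : (1 <= a <= S p)%nat -> s <> 0%C -> Re s < 1 ->
  zeta_full (INR a / INR (S p)) s =
  (2 * Rcpow (2 * PI * INR (S p)) (s - 1) * CGamma (1 - s) *
   sumC (fun j => Csin (PI * s / 2 + RtoC (2 * PI * INR (S j) * INR a / INR (S p))) *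
      zeta_em (1 - s) (INR (S j) / INR (S p))%R) p)%C.
Proof.
  intros Ha Hs0 Hs.
  assert (Hq : 0 < INR (S p)) by (apply lt_0_INR; lia).
  assert (Hfrac := fun k => INR_div_range k (S p)).
  set (rhs := fun s => (2 * Rcpow (2 * PI * INR (S p)) (s - 1) * CGamma (1 - s) *
   sumC (fun j => Csin (PI * s / 2 + RtoC (2 * PI * INR (S j) * INR a / INR (S p))) *
      zeta_em (1 - s) (INR (S j) / INR (S p))%R) p)%C).
  change (zeta_full (INR a / INR (S p)) s = rhs s).
  assert (Hneg : forall z, Re z < 0 -> zeta_full (INR a / INR (S p)) z = rhs z).
  { intros z Hz. rewrite zeta_full_hf by (auto || exact Hz). apply zeta_hf_rational, Hz. }
  destruct (Rlt_dec (Re s) 0) as [H|H]; [apply Hneg, H|].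
  apply C_eq_of_minus.
  (* The excluded point is s = 0, where 1 - s meets the pole; equality is already known on -1 < Re s
     < 0. *)
  apply (identity_strip (fun s => zeta_full (INR a / INR (S p)) s - rhs s)%C 0 (-1) 1 (-1) 0); try lra; [| |exact Hs0].
    - intros z Hz Hz0. assert (Hz1 : z <> 1%C) by (apply Re_not_1; lra).
      apply analytic_at_minus; [apply analytic_zeta_full; auto|].
      assert (Hw1 : (1 - z)%C <> 1%C).
      { intros E. apply Hz0. replace z with (1 - (1 - z))%C by ring. rewrite E. ring. }
      assert (Hwre : - 1 < Re (1 - z)) by (rewrite Re_minus; simpl (Re 1); lra).
      destruct (em_radius_spec (1 - z)%C Hwre Hw1) as [Hr _].
      set (r := Rmin (em_radius (1 - z) / 4) ((1 - Re z) / 8)).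
      assert (m1 := Rmin_l (em_radius (1 - z) / 4) ((1 - Re z) / 8)). assert (m2 := Rmin_r (em_radius (1 - z) / 4) ((1 - Re z) / 8)).
      fold r in m1, m2. assert (Hrp : 0 < r) by (apply Rmin_pos; lra).
      assert (Hsub : forall g R1, QH g z R1 -> r <= R1 -> QH g z r).
      { intros g R1 Hg HR. apply (QH_sub g z z _ _ Hg). rewrite Cmod_minus_diag. lra. }
      apply (QH_analytic_at _ _ r Hrp). unfold rhs.
      apply QH_mult; [apply QH_mult; [apply QH_mult; [apply QH_const|]|]|].
      + apply (QH_ext (fun s => Rcpow (2 * PI * INR (S p)) s * Rcpow (2 * PI * INR (S p)) (- (1)))%C).
        * intros y _. rewrite <- Rcpow_plus. reflexivity.
        * apply QH_mult; [apply QH_Rcpow | apply QH_const].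
      + apply (Hsub _ _ (QH_CGamma_reflect z (proj2 Hz)) m2).
      + unfold sumC. apply (QH_sum_n (fun j s => Csin (PI * s / 2 + RtoC (2 * PI * INR (S j) * INR a / INR (S p))) *
          zeta_em (1 - s) (INR (S j) / INR (S p))%R)%C).
        intros j. apply QH_mult; [apply QH_Csin_shift|].
        apply (Hsub _ (em_radius (1 - z) / 4)); [|exact m1].
        apply (QH_reflect (fun w => zeta_em w (INR (S j) / INR (S p)))). apply QH_zeta_em; [|exact Hwre|exact Hw1].
        apply Rdiv_lt_0_compat; [apply lt_0_INR; lia | exact Hq].
    - intros z Hz. rewrite Hneg by lra. ring.
Qed.

Lemma hurwitz_zeta_rational (a q : nat) (s : C) : (1 <= a <= q)%nat -> s <> 0%C -> Re s < 1 ->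
  hurwitz_zeta s (INR a / INR q) =
    (2 * Rcpow (2 * PI * INR q) (s - 1) * CGamma (1 - s) *
     sum_n_m (G := C_AbelianMonoid)
       (fun r : nat =>
          Csin (PI * s / 2 + RtoC (2 * PI * INR r * INR a / INR q)) *
          hurwitz_zeta (1 - s) (INR r / INR q)%R)
       1 q)%C.
Proof.
  intros Ha Hs0 Hs. destruct q as [|p]; [lia|].
  assert (Hq : 0 < INR (S p)) by (apply lt_0_INR; lia).
  assert (Hfrac := fun k => INR_div_range k (S p)).
  rewrite hurwitz_zeta_full by (auto || (apply Re_not_1; exact Hs)).
  rewrite rational_formula_continued by assumption. f_equal.
  rewrite sum_n_m_sumC. apply sumC_ext. intros j Hj.
  rewrite hurwitz_zeta_full.
  - rewrite zeta_full_em by (rewrite Re_minus; simpl (Re 1); lra). reflexivity.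
  - apply Hfrac. lia.
  - intros E. apply Hs0. replace s with (1 - (1 - s))%C by ring. rewrite E. ring.
Qed.

(** * Integrals of products *)

(** The products may blow up at 0, so their integrals are limits of integrals over [e, 1]. *)
Definition improper (f : R -> C) (I : C) : Prop :=
  forall eps, 0 < eps -> exists d, 0 < d <= 1 /\ forall e, 0 < e <= d -> Cmod (IntC f e 1 - I) < eps.

Lemma improper_is_RInt_gen (f : R -> C) (I : C) : (forall t, 0 < t <= 1 -> contC f t) -> improper f I ->
  is_RInt_gen (V := C_R_NormedModule) f (at_right 0) (at_point 1) I.
Proof.
  intros Hf HI P HP. apply locally_C in HP. destruct HP as [eps [He HP]].
  destruct (HI eps He) as [d [Hd H]].
  apply Filter_prod with (fun e => 0 < e <= d) (fun x => x = 1).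
  - exists (mkposreal d (proj1 Hd)). intros y Hy Hy0. change (Rabs (y - 0) < d) in Hy.
    rewrite Rminus_0_r in Hy. apply Rabs_def2 in Hy. lra.
  - reflexivity.
  - intros e x Hee ->. simpl. exists (IntC f e 1). split; [|apply HP, H, Hee].
    apply intC_cont. intros t Ht. rewrite Rmin_left, Rmax_right in Ht by lra. apply Hf. lra.
Qed.

Lemma improper_unique (f : R -> C) (I J : C) : improper f I -> improper f J -> I = J.
Proof.
  intros HI HJ. apply C_eq_eps. intros eps He.
    destruct (HI (eps / 2) ltac:(lra)) as [d1 [Hd1 H1]]. destruct (HJ (eps / 2) ltac:(lra)) as [d2 [Hd2 H2]].
    assert (m1 := Rmin_l d1 d2). assert (m2 := Rmin_r d1 d2). assert (m3 : 0 < Rmin d1 d2) by (apply Rmin_pos; lra).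
    specialize (H1 (Rmin d1 d2) ltac:(lra)). specialize (H2 (Rmin d1 d2) ltac:(lra)).
    assert (T := Cmod_dist_triangle I (IntC f (Rmin d1 d2) 1) J). rewrite (Cmod_minus_sym I (IntC f (Rmin d1 d2) 1)) in T. lra.
Qed.

Lemma improper_ext (f g : R -> C) (I : C) : (forall t, 0 < t < 1 -> f t = g t) ->
  (forall t, 0 < t <= 1 -> contC f t) -> improper f I -> improper g I.
Proof.
  intros Hfg Hf HI eps He. destruct (HI eps He) as [d [Hd H]]. exists d. split; [exact Hd|].
  intros e Hee. replace (IntC g e 1) with (IntC f e 1); [apply H, Hee|].
  symmetry. apply (is_RInt_unique (V := C_R_CompleteNormedModule)).
  apply (intC_ext f).
  - intros t Ht. rewrite Rmin_left, Rmax_right in Ht by lra. apply Hfg. lra.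
  - apply intC_cont. intros t Ht. rewrite Rmin_left, Rmax_right in Ht by lra. apply Hf. lra.
Qed.

Lemma improper_proper (f : R -> C) (I : C) (B : R) : 0 <= B -> (forall t, 0 < t < 1 -> Cmod (f t) <= B) ->
  (forall t, 0 < t <= 1 -> contC f t) -> intC f 0 1 I -> improper f I.
Proof.
  intros HB0 HB Hf HI eps He. exists (Rmin 1 (eps / 2 / (B + 1))).
  assert (m1 := Rmin_l 1 (eps / 2 / (B + 1))). assert (m2 := Rmin_r 1 (eps / 2 / (B + 1))).
  split; [split; [apply Rmin_pos; [lra | apply Rdiv_lt_0_compat; lra] | exact m1]|].
  intros e Hee.
  assert (H1 : intC f e 1 (IntC f e 1)).
  { apply intC_cont. intros t Ht. rewrite Rmin_left, Rmax_right in Ht by lra. apply Hf. lra. }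
  assert (H0 : intC f 0 e (IntC f 0 e)).
  { apply (RInt_correct (V := C_R_CompleteNormedModule)).
    apply (ex_RInt_Chasles_1 (V := C_R_CompleteNormedModule) f 0 e 1); [lra | exists I; exact HI]. }
  rewrite (intC_unique _ _ _ _ _ HI (intC_Chasles _ _ _ _ _ _ H0 H1)).
  replace (_ - _)%C with (- IntC f 0 e)%C by ring. rewrite Cmod_opp.
  assert (T := intC_bound_open f 0 e _ B ltac:(lra) HB0 ltac:(intros x Hx; apply HB; lra) H0).
  apply Rle_lt_trans with (e * (B + 1)); [nra|].
  apply Rle_lt_trans with (eps / 2 / (B + 1) * (B + 1)); [apply Rmult_le_compat_r; lra|].
  replace (eps / 2 / (B + 1) * (B + 1)) with (eps / 2) by (field; lra). lra.
Qed.

Lemma improper_exists (f : R -> C) (A tau : R) : 0 <= A -> tau < 1 ->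
  (forall t, 0 < t <= 1 -> contC f t) ->
  (forall t, 0 < t <= 1 -> Cmod (f t) <= A * Rpower t (- tau)) ->
  exists I, improper f I /\ forall e, 0 < e <= 1 -> Cmod (IntC f e 1 - I) <= A * Rpower e (1 - tau) / (1 - tau).
Proof.
  intros HA Ht Hc Hb. destruct (improper_at_0 f A tau HA Ht Hc Hb) as [I HI]. exists I. split; [|exact HI].
  intros eps He.
  destruct (Rpower_small_at_0 (1 - tau) (eps * (1 - tau) / (A + 1))) as [d [Hd H]]; [lra | |].
  { apply Rdiv_lt_0_compat; [apply Rmult_lt_0_compat|]; lra. }
  exists (Rmin 1 d). assert (m1 := Rmin_l 1 d). assert (m2 := Rmin_r 1 d).
  split; [split; [apply Rmin_pos; lra | exact m1]|].
  intros e Hee. eapply Rle_lt_trans; [apply HI; lra|]. specialize (H e ltac:(lra) ltac:(lra)).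
  set (x := Rpower e (1 - tau)) in *. assert (Hx : 0 < x) by apply Rpower_pos.
  apply Rmult_lt_reg_r with (1 - tau); [lra|].
  replace (A * x / (1 - tau) * (1 - tau)) with (A * x) by (field; lra).
  apply Rle_lt_trans with ((A + 1) * x); [nra|].
  apply (Rmult_lt_compat_l (A + 1)) in H; [|lra].
  replace ((A + 1) * (eps * (1 - tau) / (A + 1))) with (eps * (1 - tau)) in H by (field; lra). exact H.
Qed.

Lemma Cmod_CSeries_le (a : nat -> C) (b : nat -> R) : (forall k, Cmod (a k) <= b k) -> ex_series b ->
  Cmod (CSeries a) <= Series b.
Proof.
  intros H Hb. assert (T := CSeries_tail a b 0 H Hb). rewrite sumC_O, sum_O in T.
  assert (T1 := H 0%nat). assert (T2 := Cmod_triangle_inv (CSeries a) (a 0%nat)). rewrite Cmod_minus_sym in T2. lra.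
Qed.

Lemma Rpower_1_2_le (y p B : R) : 1 <= y <= 2 -> Rabs p <= B -> Rpower y p <= exp B.
Proof.
  intros Hy Hp. unfold Rpower. apply exp_le.
  assert (Hl : 0 <= ln y <= 1).
  { split.
    - rewrite <- ln_1. destruct (proj1 Hy) as [H| <-]; [left; apply ln_increasing; lra | right; reflexivity].
    - rewrite <- (ln_exp 1). assert (T := exp_ineq1_le 1).
      assert (Hy2 : y <= exp 1) by lra. destruct Hy2 as [H| ->]; [left; apply ln_increasing; lra | right; reflexivity]. }
  apply Rabs_le_between in Hp. nra.
Qed.

(** Only the term a^(-s) can be unbounded near 0, the others being taken at a + 1 and beyond; [d]
    keeps [s] away from the pole. With the exponent max (Re s, 0) the power is at least 1 on (0, 1]
    and so dominates the bounded part too. *)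
Lemma zeta_em_bound (s0 B d : R) : - 1 < s0 -> 0 < d -> 0 <= B ->
  exists C0, 0 <= C0 /\ forall (s : C) a, 0 < a <= 1 -> s0 <= Re s -> Cmod s <= B -> d <= Cmod (s - 1) ->
    Cmod (zeta_em s a) <= (1 + C0) * Rpower a (- Rmax (Re s) 0).
Proof.
  intros Hs0 Hd HB. set (b := fun n => B * (B + 1) * Rpower (INR n + 1) (- (s0 + 2))).
  (* The first two summands bound the boundary terms at a + 1, which lies in [1, 2]; the third
     bounds the series of trapezoidal errors. *)
  set (C0 := exp B + exp (B + 1) / d + Rabs (Series b)).
  assert (P1 := exp_pos B). assert (P2 : 0 < exp (B + 1) / d) by (apply Rdiv_lt_0_compat; [apply exp_pos | exact Hd]).
  assert (P3 := Rabs_pos (Series b)).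
  exists C0. split; [unfold C0; lra|].
  intros s a Ha Hs HsB Hsd.
  assert (Hs1 : s <> 1%C).
  { intros ->. replace (1 - 1)%C with (RtoC 0) in Hsd by ring. rewrite Cmod_0 in Hsd. lra. }
  assert (HRe := re_le_Cmod s).
  assert (Hrest : Cmod (zeta_em s a - Rcpow a (- s))%C <= C0).
  { unfold zeta_em.
    replace (_ - _)%C with (Rcpow (a + 1) (- s) / 2 + Rcpow (a + 1) (1 - s) / (s - 1) + CSeries (fun n => trap s (INR n + (a + 1))%R))%C by ring.
    eapply Rle_trans; [apply Cmod_triangle|]. eapply Rle_trans; [apply Rplus_le_compat_r, Cmod_triangle|].
    unfold C0. apply Rplus_le_compat; [apply Rplus_le_compat|].
    - apply Cdiv_2_le. rewrite Cmod_Rcpow, re_opp. apply Rpower_1_2_le; [lra|]. rewrite Rabs_Ropp. lra.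
    - rewrite Cmod_div, Cmod_Rcpow by (apply C_minus_1_neq_0, Hs1).
      apply Rmult_le_compat; [apply Rlt_le, Rpower_pos | apply Rlt_le, Rinv_0_lt_compat; lra | | apply Rinv_le_contravar; lra].
      apply Rpower_1_2_le; [lra|]. rewrite Re_minus. simpl (Re 1).
      unfold Rminus. eapply Rle_trans; [apply Rabs_triang|]. rewrite Rabs_R1, Rabs_Ropp. lra.
    - eapply Rle_trans; [apply (Cmod_CSeries_le _ b)|apply Rle_abs].
      + intros k. apply Cmod_trap_shift; try assumption; lra.
      + apply ex_series_trap_bound, Hs0. }
  assert (T := Cmod_triangle_inv (zeta_em s a) (Rcpow a (- s))).
  rewrite Cmod_Rcpow, re_opp in T.
  assert (Hmax := Rmax_l (Re s) 0). assert (Hmax0 := Rmax_r (Re s) 0).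
  assert (Hla : ln a <= 0).
  { rewrite <- ln_1. destruct (proj2 Ha) as [H| ->]; [left; apply ln_increasing; lra | right; reflexivity]. }
  assert (E1 : Rpower a (- Re s) <= Rpower a (- Rmax (Re s) 0)) by (unfold Rpower; apply exp_le; nra).
  assert (E2 : 1 <= Rpower a (- Rmax (Re s) 0)).
  { unfold Rpower. rewrite <- exp_0 at 1. apply exp_le. nra. }
  assert (0 <= C0) by (unfold C0; lra). nra.
Qed.

Lemma QH_shifted_power_integral (w : R -> C) (y e : R) (c z0 : C) (r : R) : 0 <= y -> 0 < e <= 1 -> 0 <= r ->
  (forall t, 0 < t <= 1 -> contC w t) ->
  QH (fun s => IntC (fun a => Rcpow (y + a) (c - s) * w a)%C e 1) z0 r.
Proof.
  intros Hy He Hr Hw.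
  assert (Hln : forall t, e <= t <= 1 -> continuous (fun a => ln (y + a)) t).
  { intros t Ht. apply (ex_derive_continuous (V := R_NormedModule)). auto_derive. lra. }
  apply (QH_integral (fun a => - ln (y + a)) (fun a => Cexp (c * RtoC (ln (y + a))) * w a)%C e 1); [lra | exact Hr | | |].
  - intros t Ht. apply (continuous_opp (V := R_NormedModule)), Hln, Ht.
  - intros t Ht. apply contC_mult; [|apply Hw; lra].
    apply contC_Cexp, contC_mult; [apply contC_const|]. apply contC_RtoC, Hln, Ht.
  - intros z _. apply (intC_ext (fun a => Rcpow (y + a) (c - z) * w a)%C).
    + intros t _. unfold Rcpow. rewrite Cmult_assoc, <- Cexp_plus. f_equal. f_equal. rewrite RtoC_opp. ring.
    + apply intC_cont. intros t Ht. rewrite Rmin_left, Rmax_right in Ht by lra.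
      apply contC_mult; [apply contC_Rcpow_shift; lra | apply Hw; lra].
Qed.

(** The series and the integral are truncated with the same index, so that a single uniform limit
    gives analyticity. *)
Definition weighted_partial (w : R -> C) (n : nat) (s : C) : C :=
  IntC (fun a => zeta_em_partial n s a * w a)%C (/ (INR n + 1)) 1.

Lemma inv_succ_range (n : nat) : 0 < / (INR n + 1) <= 1.
Proof.
  assert (T := pos_INR n). split; [apply Rinv_0_lt_compat; lra|].
  rewrite <- Rinv_1 at 2. apply Rinv_le_contravar; lra.
Qed.

(** By [zeta_em_partial_eq] the integrand is a finite combination of terms (y + a)^(c - s) w(a) with
    coefficients free of [a], and each of these is covered by [QH_shifted_power_integral]. *)
Lemma QH_weighted_partial (w : R -> C) (n : nat) (z0 : C) (r : R) : 0 < r -> r < Cmod (z0 - 1) ->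
  (forall t, 0 < t <= 1 -> contC w t) -> QH (weighted_partial w n) z0 r.
Proof.
  intros Hr Hr1 Hw. assert (Hn := inv_succ_range n). set (e := / (INR n + 1)) in *.
  set (K := fun (y : R) (c s : C) => IntC (fun a => Rcpow (y + a) (c - s) * w a)%C e 1).
  assert (Hint : forall y (c s : C), 0 <= y -> intC (fun a => Rcpow (y + a) (c - s) * w a)%C e 1 (K y c s)).
  { intros y c s Hy. apply intC_cont. intros t Ht. rewrite Rmin_left, Rmax_right in Ht by lra.
    apply contC_mult; [apply contC_Rcpow_shift; lra | apply Hw; lra]. }
  assert (Tn := pos_INR n).
  apply (QH_ext (fun s => sumC (fun k => K (INR k) 0 s) (S n) + K (INR n + 2)%R 0%C s * / 2 - K (INR n + 2)%R 1%C s * / (1 - s))%C).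
  - intros s Hs. assert (Hs1 : s <> 1%C) by (intros ->; rewrite Cmod_minus_sym in Hs; lra).
    unfold weighted_partial. symmetry. apply (is_RInt_unique (V := C_R_CompleteNormedModule)). fold e.
    eapply intC_ext; [|apply intC_minus; [apply intC_plus; [apply (intC_sum (fun k a => Rcpow (INR k + a) (0 - s) * w a)%C) |]|]].
    2:{ intros k. apply Hint, pos_INR. }
    2:{ apply intC_mult_r. apply Hint. lra. }
    2:{ apply intC_mult_r. apply Hint. lra. }
    intros a _. cbv beta. rewrite zeta_em_partial_eq by exact Hs1.
    replace (0 - s)%C with (- s)%C by ring.
    replace (sumC (fun k => Rcpow (INR k + a) (- s) * w a)%C (S n)) with (sumC (fun k => Rcpow (INR k + a) (- s)) (S n) * w a)%C.
    2:{ generalize (S n). intros m. induction m; [rewrite !sumC_O; reflexivity | rewrite !sumC_S, <- IHm; ring]. }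
    unfold Cdiv. ring.
  - assert (HK : forall y (c : C), 0 <= y -> QH (fun s => K y c s) z0 r).
    { intros y c Hy. apply QH_shifted_power_integral; lra || assumption. }
    apply QH_minus; [apply QH_plus|].
    + unfold sumC. apply (QH_sum_n (fun k s => K (INR k) 0%C s)). intros k. apply HK, pos_INR.
    + apply QH_mult; [apply HK; lra | apply QH_const].
    + apply QH_mult; [apply HK; lra | apply QH_inv_1_minus; assumption].
Qed.

(** Two errors must be uniform in [s] near [z0]: that of the partial sums, integrated against the
    majorant of [w], and the missing piece near 0, controlled by an exponent [tau'] below 1. *)
Lemma QH_weighted_integral (w : R -> C) (A tau : R) (F : C -> C) (z0 : C) :
  0 <= A -> 0 <= tau < 1 -> (forall t, 0 < t <= 1 -> contC w t) ->
  (forall t, 0 < t <= 1 -> Cmod (w t) <= A * Rpower t (- tau)) ->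
  - 1 < Re z0 < 1 - tau ->
  (forall s, - 1 < Re s < 1 - tau -> improper (fun a => zeta_em s a * w a)%C (F s)) ->
  exists r, 0 < r /\ QH F z0 r.
Proof.
  intros HA Htau Hw Hb Hz HF.
  assert (Hz1 : z0 <> 1%C) by (apply Re_not_1; lra).
  destruct (em_radius_spec z0 ltac:(lra) Hz1) as [Hr0 [Hr1 Hball]].
  set (r := Rmin (em_radius z0 / 2) ((1 - tau - Re z0) / 2)).
  assert (m1 := Rmin_l (em_radius z0 / 2) ((1 - tau - Re z0) / 2)). assert (m2 := Rmin_r (em_radius z0 / 2) ((1 - tau - Re z0) / 2)).
  fold r in m1, m2. assert (Hr : 0 < r) by (apply Rmin_pos; lra).
  (* An upper bound for Re z on the ball: the midpoint between Re z0 and 1 - tau, so that s1 + tau <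
     1. It is made nonnegative to dominate the max (Re z, 0) of [zeta_em_bound]. *)
  set (s1 := Rmax 0 ((Re z0 + 1 - tau) / 2)).
  assert (Hs1 : 0 <= s1 < 1 - tau) by (unfold s1; split; [apply Rmax_l | apply Rmax_lub_lt; lra]).
  assert (Hin : forall z, Cmod (z - z0) < r -> (Re z0 - 1) / 2 <= Re z /\ Re z <= s1 /\ Cmod z <= Cmod z0 + em_radius z0 /\ z <> 1%C /\ em_radius z0 / 2 <= Cmod (z - 1)).
  { intros z Hzz. destruct (Hball z ltac:(lra)) as [B1 [B2 B3]].
    assert (T := re_le_Cmod (z - z0)%C). rewrite Re_minus in T. apply Rabs_le_between in T.
    repeat split; try assumption.
    - unfold s1. eapply Rle_trans; [|apply Rmax_r]. lra.
    - assert (T2 := Cmod_dist_triangle z0 z 1). rewrite (Cmod_minus_sym z0 z) in T2. lra. }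
  set (B := Cmod z0 + em_radius z0).
  assert (HB : 0 <= B) by (unfold B; assert (T := Cmod_ge_0 z0); lra).
  destruct (zeta_em_bound ((Re z0 - 1) / 2) B (em_radius z0 / 2) ltac:(lra) ltac:(lra) HB) as [C0 [HC0 HC]].
  set (A' := (1 + C0) * A). set (tau' := s1 + tau).
  assert (HA' : 0 <= A') by (unfold A'; nra).
  assert (Hfc : forall s t, - 1 < Re s -> s <> 1%C -> 0 < t <= 1 -> contC (fun a => zeta_em s a * w a)%C t).
  { intros s t H1 H2 Ht. apply contC_mult; [apply contC_zeta_em; [lra | exact H1 | exact H2] | apply Hw, Ht]. }
  assert (Hfb : forall z t, Cmod (z - z0) < r -> 0 < t <= 1 -> Cmod (zeta_em z t * w t) <= A' * Rpower t (- tau')).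
  { intros z t Hzz Ht. destruct (Hin z Hzz) as [B1 [B2 [B3 [B4 B5]]]].
    rewrite Cmod_mult. unfold A', tau'.
    replace ((1 + C0) * A * Rpower t (- (s1 + tau))) with (((1 + C0) * Rpower t (- s1)) * (A * Rpower t (- tau))).
    2:{ replace (- (s1 + tau)) with (- s1 + - tau) by ring. rewrite Rpower_plus. ring. }
    apply Rmult_le_compat; [apply Cmod_ge_0 | apply Cmod_ge_0 | | apply Hb, Ht].
    eapply Rle_trans; [apply HC; assumption|]. apply Rmult_le_compat_l; [lra|].
    unfold Rpower. apply exp_le.
    assert (Hla : ln t <= 0).
    { rewrite <- ln_1. destruct (proj2 Ht) as [H| ->]; [left; apply ln_increasing; lra | right; reflexivity]. }
    assert (Rmax (Re z) 0 <= s1) by (apply Rmax_lub; lra). nra. }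
  assert (Htail : forall z e, Cmod (z - z0) < r -> 0 < e <= 1 ->
     Cmod (IntC (fun a => zeta_em z a * w a)%C e 1 - F z)%C <= A' * Rpower e (1 - tau') / (1 - tau')).
  { intros z e Hzz He. destruct (Hin z Hzz) as [B1 [B2 [B3 [B4 B5]]]].
    destruct (improper_exists (fun a => zeta_em z a * w a)%C A' tau' HA' ltac:(unfold tau'; lra)) as [I [HI HE]].
    - intros t Ht. apply Hfc; [lra | exact B4 | exact Ht].
    - intros t Ht. apply Hfb; assumption.
    - assert (EF : F z = I) by (apply (improper_unique (fun a => zeta_em z a * w a)%C); [apply HF; lra | exact HI]).
      rewrite EF. apply HE, He. }
  exists (r / 4). split; [lra|].
  apply (QH_uniform_limit (weighted_partial w)); [exact Hr | |].
  - intros n. apply QH_weighted_partial; [exact Hr | lra | exact Hw].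
  - intros eps He.
    (* A / (1 - tau) is the integral over (0, 1) of the majorant of [w]; adding 1 makes [c]
       positive. *)
    set (c := A / (1 - tau) + 1). assert (Hc : 0 < c).
    { unfold c. assert (0 <= A / (1 - tau)) by (apply Rmult_le_pos; [exact HA | apply Rlt_le, Rinv_0_lt_compat; lra]). lra. }
    destruct (zeta_em_partial_uniform ((Re z0 - 1) / 2) B (eps / 2 / c) ltac:(lra) ltac:(apply Rdiv_lt_0_compat; lra)) as [N1 H1].
    assert (Ht' : 0 < 1 - tau') by (unfold tau'; lra).
    destruct (Rpower_lt_small_nat (1 - tau') (eps / 2 * (1 - tau') / (A' + 1)) Ht') as [N2 H2].
    { apply Rdiv_lt_0_compat; [apply Rmult_lt_0_compat|]; lra. }
    exists (N1 + N2)%nat. intros n z Hn Hzz. destruct (Hin z Hzz) as [B1 [B2 [B3 [B4 B5]]]].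
    assert (Hne := inv_succ_range n). assert (Tn := pos_INR n).
    specialize (H2 n 1 ltac:(lia) ltac:(lra)).
    assert (E2 : A' * Rpower (/ (INR n + 1)) (1 - tau') / (1 - tau') < eps / 2).
    { replace (Rpower (/ (INR n + 1)) (1 - tau')) with (Rpower (INR n + 1) (- (1 - tau')))
        by (unfold Rpower; rewrite ln_Rinv by lra; f_equal; ring).
      set (x := Rpower (INR n + 1) (- (1 - tau'))) in *. assert (Hx : 0 < x) by apply Rpower_pos.
      apply Rmult_lt_reg_r with (1 - tau'); [lra|].
      replace (A' * x / (1 - tau') * (1 - tau')) with (A' * x) by (field; lra).
      apply Rle_lt_trans with ((A' + 1) * x); [nra|].
      apply (Rmult_lt_compat_l (A' + 1)) in H2; [|lra].
      replace ((A' + 1) * (eps / 2 * (1 - tau') / (A' + 1))) with (eps / 2 * (1 - tau')) in H2 by (field; lra). exact H2. }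
    set (e := / (INR n + 1)) in *.
    assert (I1 : intC (fun a => zeta_em_partial n z a * w a)%C e 1 (weighted_partial w n z)).
    { apply intC_cont. intros t Ht. rewrite Rmin_left, Rmax_right in Ht by lra.
      apply contC_mult; [apply contC_zeta_em_partial; lra | apply Hw; lra]. }
    assert (I2 : intC (fun a => zeta_em z a * w a)%C e 1 (IntC (fun a => zeta_em z a * w a)%C e 1)).
    { apply intC_cont. intros t Ht. rewrite Rmin_left, Rmax_right in Ht by lra. apply Hfc; lra || assumption. }
    assert (E1 : Cmod (weighted_partial w n z - IntC (fun a => zeta_em z a * w a)%C e 1)%C <= eps / 2).
    { assert (I3 := is_RInt_scal (V := R_NormedModule) _ _ _ (eps / 2 / c * A) _ (is_RInt_Rpower tau e 1 ltac:(lra) ltac:(lra) ltac:(lra))).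
      eapply Rle_trans.
      - apply (intC_bound _ (fun t => eps / 2 / c * A * Rpower t (- tau)) e 1 _ _ ltac:(lra)) with (2 := intC_minus _ _ _ _ _ _ I1 I2) (3 := I3).
        intros t Ht. replace (_ - _)%C with ((zeta_em_partial n z t - zeta_em z t) * w t)%C by ring.
        rewrite Cmod_mult, Rmult_assoc. apply Rmult_le_compat; [apply Cmod_ge_0 | apply Cmod_ge_0 | | apply Hb; lra].
        apply Rlt_le, H1; try assumption; [lia | lra].
      - unfold scal; simpl. unfold mult; simpl. unfold Rpower at 1. rewrite ln_1, Rmult_0_r, exp_0.
        assert (T := Rpower_pos e (1 - tau)).
        apply Rle_trans with (eps / 2 / c * (A / (1 - tau))).
        + rewrite Rmult_assoc. apply Rmult_le_compat_l; [apply Rlt_le, Rdiv_lt_0_compat; lra|].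
          apply Rmult_le_compat_l; [exact HA|]. unfold Rdiv. rewrite <- (Rmult_1_l (/ (1 - tau))) at 2.
          apply Rmult_le_compat_r; [apply Rlt_le, Rinv_0_lt_compat; lra | lra].
        + apply Rle_trans with (eps / 2 / c * c); [|right; field; lra].
          apply Rmult_le_compat_l; [apply Rlt_le, Rdiv_lt_0_compat; lra | unfold c; lra]. }
    assert (T := Cmod_dist_triangle (weighted_partial w n z) (IntC (fun a => zeta_em z a * w a)%C e 1) (F z)).
    specialize (Htail z e Hzz Hne). lra.
Qed.

Definition product_value (s1 s2 : C) : C :=
  (2 * Rcpow (2 * PI) (s1 + s2 - 2) * CGamma (1 - s1) * CGamma (1 - s2) *
   Ccos (PI / 2 * (s1 - s2)) * zeta_em (2 - s1 - s2) 1)%C.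

Lemma Ccos_opp (z : C) : Ccos (- z) = Ccos z.
Proof.
  unfold Ccos. replace (Ci * - z)%C with (- (Ci * z))%C by ring.
  replace (- - (Ci * z))%C with (Ci * z)%C by ring. f_equal. ring.
Qed.

Lemma product_value_sym (s1 s2 : C) : product_value s1 s2 = product_value s2 s1.
Proof.
  unfold product_value. rewrite <- (Ccos_opp (PI / 2 * (s1 - s2))).
  replace (- (PI / 2 * (s1 - s2)))%C with (PI / 2 * (s2 - s1))%C by ring.
  replace (2 - s1 - s2)%C with (2 - s2 - s1)%C by ring.
  replace (s1 + s2 - 2)%C with (s2 + s1 - 2)%C by ring. ring.
Qed.

(** Opposite frequencies are paired, so the phases are exp (i d (pi / 2) (s1 - s2)) for d = 1 and d
    = -1, which add up to twice the cosine. *)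
Lemma fourier_coef_product (s1 s2 : C) (n : nat) :
  (fourier_coef s1 1 (S n) * fourier_coef s2 (-1) (S n) + fourier_coef s1 (-1) (S n) * fourier_coef s2 1 (S n))%C =
  (2 * Rcpow (2 * PI) (s1 + s2 - 2) * CGamma (1 - s1) * CGamma (1 - s2) * Ccos (PI / 2 * (s1 - s2)) *
   Rcpow (INR n + 1) (- (2 - s1 - s2)))%C.
Proof.
  assert (Hpi := PI_RGT_0). assert (Tn := pos_INR n).
  unfold fourier_coef, Ccos. rewrite S_INR.
  assert (EP : (Rcpow (2 * PI * (INR n + 1)) (s1 - 1) * Rcpow (2 * PI * (INR n + 1)) (s2 - 1))%C =
     (Rcpow (2 * PI) (s1 + s2 - 2) * Rcpow (INR n + 1) (- (2 - s1 - s2)))%C).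
  { rewrite <- Rcpow_plus. rewrite Rcpow_mult by lra. f_equal; f_equal; ring. }
  assert (Ehalf : RtoC (PI / 2) = (PI / 2)%C) by (rewrite RtoC_div by lra; reflexivity).
  assert (Eh1 : RtoC (1 * (PI / 2)) = (PI / 2)%C) by (rewrite Rmult_1_l; exact Ehalf).
  assert (Eh2 : RtoC (-1 * (PI / 2)) = (- (PI / 2))%C).
  { replace (-1 * (PI / 2)) with (- (PI / 2)) by ring. rewrite RtoC_opp, Ehalf. reflexivity. }
  rewrite Eh1, Eh2.
  assert (E1 : (Cexp (Ci * (PI / 2) * (s1 - 1)) * Cexp (Ci * - (PI / 2) * (s2 - 1)))%C = Cexp (Ci * (PI / 2 * (s1 - s2)))).
  { rewrite <- Cexp_plus. f_equal. ring. }
  assert (E2 : (Cexp (Ci * - (PI / 2) * (s1 - 1)) * Cexp (Ci * (PI / 2) * (s2 - 1)))%C = Cexp (- (Ci * (PI / 2 * (s1 - s2))))).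
  { rewrite <- Cexp_plus. f_equal. ring. }
  replace (_ + _)%C with (CGamma (1 - s1) * CGamma (1 - s2) * (Rcpow (2 * PI * (INR n + 1)) (s1 - 1) * Rcpow (2 * PI * (INR n + 1)) (s2 - 1)) *
    (Cexp (Ci * (PI / 2) * (s1 - 1)) * Cexp (Ci * - (PI / 2) * (s2 - 1)) + Cexp (Ci * - (PI / 2) * (s1 - 1)) * Cexp (Ci * (PI / 2) * (s2 - 1))))%C by ring.
  rewrite EP, E1, E2. field.
Qed.

(** Only the first factor is expanded: integrating each of its terms against [zeta_hf s2] picks out
    a Fourier coefficient, and no double series arises. The resulting series is that of Riemann's
    zeta at 2 - s1 - s2. *)
Lemma zeta_hf_product (s1 s2 : C) : Re s1 < 0 -> Re s2 < 0 ->
  intC (fun a => zeta_hf s1 a * zeta_hf s2 a)%C 0 1 (product_value s1 s2).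
Proof.
  intros H1 H2.
  assert (Hl : forall n, intC (fun a => hf_term s1 a n * zeta_hf s2 a)%C 0 1
    (fourier_coef s1 1 (S n) * fourier_coef s2 (-1) (S n) + fourier_coef s1 (-1) (S n) * fourier_coef s2 1 (S n))%C).
  { intros n. eapply intC_ext; [|apply intC_plus; apply intC_mult_l; apply zeta_hf_wave; (lia || exact H2 || (left; reflexivity) || (right; reflexivity))].
    intros a _. cbv beta. unfold hf_term. ring. }
  destruct (zeta_hf_integral s1 (zeta_hf s2) _ H1 (fun x => contC_zeta_hf s2 x H2) Hl) as [I [HI HS]].
  eapply intC_eq; [exact HI|]. apply (is_seriesC_unique _ _ _ HS). unfold product_value.
  eapply is_seriesC_ext; [|apply is_seriesC_mult_l, (zeta_em_series (2 - s1 - s2) 1 Rlt_0_1)].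
  - intros n. cbv beta. symmetry. apply fourier_coef_product.
  - rewrite !Re_minus. simpl (Re 2). lra.
Qed.

Lemma contC_zeta_full (s : C) (t : R) : 0 < t -> s <> 1%C -> contC (fun a => zeta_full a s) t.
Proof.
  intros Ht Hs. unfold zeta_full. destruct (Rlt_dec (-1) (Re s)).
  - apply contC_zeta_em; assumption.
  - apply contC_zeta_hf. lra.
Qed.

Lemma product_integral_negative (s1 s2 : C) : Re s1 < 0 -> Re s2 < 0 ->
  improper (fun a => zeta_full a s1 * zeta_full a s2)%C (product_value s1 s2).
Proof.
  intros H1 H2.
  destruct (zeta_hf_bounded s1 H1) as [B1 [P1 HB1]]. destruct (zeta_hf_bounded s2 H2) as [B2 [P2 HB2]].
  assert (Hc : forall t, 0 < t <= 1 -> contC (fun a => zeta_hf s1 a * zeta_hf s2 a)%C t)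
    by (intros t _; apply contC_mult; apply contC_zeta_hf; assumption).
  apply (improper_ext (fun a => zeta_hf s1 a * zeta_hf s2 a)%C); [|exact Hc|].
  - intros t Ht. rewrite !zeta_full_hf by (lra || assumption). reflexivity.
  - apply (improper_proper _ _ (B1 * B2)); [apply Rmult_le_pos; assumption | | exact Hc | apply zeta_hf_product; assumption].
    intros t _. rewrite Cmod_mult. apply Rmult_le_compat; try apply Cmod_ge_0; auto.
Qed.

Lemma weighted_improper_exists (w : R -> C) (A tau : R) (s : C) :
  0 <= A -> 0 <= tau < 1 -> (forall t, 0 < t <= 1 -> contC w t) ->
  (forall t, 0 < t <= 1 -> Cmod (w t) <= A * Rpower t (- tau)) ->
  - 1 < Re s < 1 - tau -> exists I, improper (fun a => zeta_em s a * w a)%C I.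
Proof.
  intros HA Htau Hw Hb Hs. assert (Hs1 : s <> 1%C) by (apply Re_not_1; lra).
  assert (Hd : 0 < Cmod (s - 1)) by (apply Cmod_gt_0, C_minus_1_neq_0, Hs1).
  destruct (zeta_em_bound (Re s) (Cmod s) (Cmod (s - 1)) ltac:(lra) Hd (Cmod_ge_0 s)) as [C0 [HC0 HC]].
  destruct (improper_exists (fun a => zeta_em s a * w a)%C ((1 + C0) * A) (Rmax (Re s) 0 + tau)) as [I [HI _]].
  - apply Rmult_le_pos; lra.
  - assert (Rmax (Re s) 0 < 1 - tau) by (apply Rmax_lub_lt; lra). lra.
  - intros t Ht. apply contC_mult; [apply contC_zeta_em; lra || exact Hs1 | apply Hw, Ht].
  - intros t Ht. rewrite Cmod_mult.
    replace ((1 + C0) * A * Rpower t (- (Rmax (Re s) 0 + tau))) with (((1 + C0) * Rpower t (- Rmax (Re s) 0)) * (A * Rpower t (- tau))).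
    + apply Rmult_le_compat; [apply Cmod_ge_0 | apply Cmod_ge_0 | apply HC; lra | apply Hb, Ht].
    + replace (- (Rmax (Re s) 0 + tau)) with (- Rmax (Re s) 0 + - tau) by ring. rewrite Rpower_plus. ring.
  - exists I. exact HI.
Qed.

Lemma QH_product_value (s2 z : C) : Re z < 1 -> Re (z + s2) < 1 ->
  exists r, 0 < r /\ QH (fun s => product_value s s2) z r.
Proof.
  intros Hz Hzs. rewrite re_plus in Hzs.
  assert (Hwre : 1 < Re (2 - s2 - z)) by (rewrite !Re_minus; simpl (Re 2); lra).
  assert (Hw1 : (2 - s2 - z)%C <> 1%C) by (intros E; rewrite E in Hwre; simpl in Hwre; lra).
  destruct (em_radius_spec (2 - s2 - z)%C ltac:(lra) Hw1) as [Hr _].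
  set (r := Rmin (em_radius (2 - s2 - z) / 4) ((1 - Re z) / 8)).
  assert (m1 := Rmin_l (em_radius (2 - s2 - z) / 4) ((1 - Re z) / 8)). assert (m2 := Rmin_r (em_radius (2 - s2 - z) / 4) ((1 - Re z) / 8)).
  fold r in m1, m2. assert (Hrp : 0 < r) by (apply Rmin_pos; lra).
  assert (Hsub : forall g R1, QH g z R1 -> r <= R1 -> QH g z r).
  { intros g R1 Hg HR. apply (QH_sub g z z _ _ Hg). rewrite Cmod_minus_diag. lra. }
  exists r. split; [exact Hrp|]. unfold product_value.
  apply QH_mult; [apply QH_mult; [apply QH_mult; [apply QH_mult; [apply QH_mult; [apply QH_const|]|]|]|]|].
  - apply (QH_ext (fun s => Rcpow (2 * PI) s * Rcpow (2 * PI) (s2 - 2))%C).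
    + intros y _. rewrite <- Rcpow_plus. f_equal. ring.
    + apply QH_mult; [apply QH_Rcpow | apply QH_const].
  - apply (Hsub _ _ (QH_CGamma_reflect z Hz) m2).
  - apply QH_const.
  - set (l := (Ci * (PI / 2))%C).
    apply (QH_ext (fun s => (Cexp (s * l) * Cexp (- (l * s2)) + Cexp (s * - l) * Cexp (l * s2)) * / 2)%C).
    + intros s _. unfold Ccos, l. rewrite <- !Cexp_plus. unfold Cdiv. f_equal. f_equal; f_equal; ring.
    + apply QH_mult; [|apply QH_const]. apply QH_plus; apply QH_mult; try apply QH_const; apply QH_Cexp_mult.
  - apply (QH_ext (fun s => zeta_em (2 - s2 - s) 1)).
    + intros s _. f_equal. ring.
    + apply (Hsub _ (em_radius (2 - s2 - z) / 4)); [|exact m1].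
      apply (QH_reflect (fun w => zeta_em w 1)). apply QH_zeta_em; lra || assumption.
Qed.

(** One continuation step in the first variable, with the second factor entering as a weight. The
    condition Re s2 <= tau keeps Re (2 - s - s2) > 1 on the strip, so the right-hand side stays
    analytic there. *)
Lemma product_integral_continuation (w : R -> C) (A tau : R) (s2 : C) :
  0 <= A -> 0 <= tau < 1 -> (forall t, 0 < t <= 1 -> contC w t) ->
  (forall t, 0 < t <= 1 -> Cmod (w t) <= A * Rpower t (- tau)) -> Re s2 <= tau ->
  (forall s, - 1 < Re s < 0 -> improper (fun a => zeta_em s a * w a)%C (product_value s s2)) ->
  forall s, - 1 < Re s < 1 - tau -> improper (fun a => zeta_em s a * w a)%C (product_value s s2).
Proof.
  intros HA Htau Hw Hb Hs2 Hneg.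
  (* The value of the integral as a function of [s]: wherever the integral converges, [epsilon]
     returns it. *)
  set (F := fun s => epsilon (inhabits (RtoC 0)) (improper (fun a => zeta_em s a * w a)%C)).
  assert (HF : forall s, - 1 < Re s < 1 - tau -> improper (fun a => zeta_em s a * w a)%C (F s)).
  { intros s Hs. apply epsilon_spec, (weighted_improper_exists w A tau); assumption. }
  intros s Hs.
  replace (product_value s s2) with (F s); [apply HF, Hs|].
  apply C_eq_of_minus.
  apply (identity_strip (fun s => F s - product_value s s2)%C 1 (-1) (1 - tau) (-1) 0); try lra.
    - intros z Hz _. apply analytic_at_minus.
      + destruct (QH_weighted_integral w A tau F z HA Htau Hw Hb Hz HF) as [r [Hr HQ]]. apply (QH_analytic_at _ _ r Hr HQ).
      + destruct (QH_product_value s2 z) as [r [Hr HQ]]; [lra | rewrite re_plus; lra |]. apply (QH_analytic_at _ _ r Hr HQ).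
    - intros z Hz. rewrite (improper_unique _ _ _ (HF z ltac:(lra)) (Hneg z Hz)). ring.
    - apply Re_not_1. lra.
Qed.

(** For Re s2 < 0 the weight zeta (s2, a) is bounded, so the continuation step applies with tau =
    0. *)
Lemma product_integral_half (s1 s2 : C) : Re s1 < 1 -> Re s2 < 0 ->
  improper (fun a => zeta_full a s1 * zeta_full a s2)%C (product_value s1 s2).
Proof.
  intros H1 H2. destruct (Rlt_dec (Re s1) 0) as [Hlt|Hge]; [apply product_integral_negative; assumption|].
  assert (Hs1 := Re_not_1 s1 H1). assert (Hs2 : s2 <> 1%C) by (apply Re_not_1; lra).
  destruct (zeta_hf_bounded s2 H2) as [B [HB0 HB]].
  assert (Hw : forall t, 0 < t <= 1 -> contC (fun a => zeta_full a s2) t) by (intros; apply contC_zeta_full; lra || assumption).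
  apply (improper_ext (fun a => zeta_em s1 a * zeta_full a s2)%C).
  - intros t Ht. rewrite (zeta_full_em t s1) by lra. reflexivity.
  - intros t Ht. apply contC_mult; [apply contC_zeta_em; lra || assumption | apply Hw, Ht].
  - apply (product_integral_continuation (fun a => zeta_full a s2) B 0); [exact HB0 | lra | exact Hw | | lra | | lra].
    + intros t Ht. rewrite zeta_full_hf by assumption. rewrite Ropp_0, Rpower_O by lra. rewrite Rmult_1_r. apply HB.
    + intros s Hs. apply (improper_ext (fun a => zeta_full a s * zeta_full a s2)%C).
      * intros t Ht. rewrite (zeta_full_em t s) by lra. reflexivity.
      * intros t Ht. apply contC_mult; apply contC_zeta_full; lra || (apply Re_not_1; lra).
      * apply product_integral_negative; lra.
Qed.

(** When both real parts are nonnegative the weight is zeta (s2, a) with tau = Re s2, and the strip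
    Re s < 1 - tau is exactly Re (s + s2) < 1. The starting strip -1 < Re s < 0 comes from
    [product_integral_half] with the variables exchanged, whence the appeal to symmetry. *)
Lemma product_integral (s1 s2 : C) : Re s1 < 1 -> Re s2 < 1 -> Re (s1 + s2) < 1 ->
  improper (fun a => zeta_full a s1 * zeta_full a s2)%C (product_value s1 s2).
Proof.
  intros H1 H2 H12. rewrite re_plus in H12.
  assert (Hs1 := Re_not_1 s1 H1). assert (Hs2 := Re_not_1 s2 H2).
  assert (Hsym : forall z1 z2 : C, z1 <> 1%C -> z2 <> 1%C ->
    improper (fun a => zeta_full a z2 * zeta_full a z1)%C (product_value z2 z1) ->
    improper (fun a => zeta_full a z1 * zeta_full a z2)%C (product_value z1 z2)).
  { intros z1 z2 Hz1 Hz2 Hi. rewrite product_value_sym. 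
    apply (improper_ext (fun a => zeta_full a z2 * zeta_full a z1)%C); [intros; apply Cmult_comm | | exact Hi].
    intros t Ht. apply contC_mult; apply contC_zeta_full; lra || assumption. }
  destruct (Rlt_dec (Re s2) 0) as [Hn2|Hp2]; [apply product_integral_half; assumption|].
  destruct (Rlt_dec (Re s1) 0) as [Hn1|Hp1]; [apply Hsym; try assumption; apply product_integral_half; assumption|].
  assert (Hd : 0 < Cmod (s2 - 1)) by (apply Cmod_gt_0, C_minus_1_neq_0, Hs2).
  destruct (zeta_em_bound (Re s2) (Cmod s2) (Cmod (s2 - 1)) ltac:(lra) Hd (Cmod_ge_0 s2)) as [C0 [HC0 HC]].
  assert (Hw : forall t, 0 < t <= 1 -> contC (fun a => zeta_em s2 a) t) by (intros; apply contC_zeta_em; lra || assumption).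
  apply (improper_ext (fun a => zeta_em s1 a * zeta_em s2 a)%C).
  - intros t Ht. rewrite !zeta_full_em by lra. reflexivity.
  - intros t Ht. apply contC_mult; [apply contC_zeta_em; lra || assumption | apply Hw, Ht].
  - apply (product_integral_continuation (fun a => zeta_em s2 a) (1 + C0) (Re s2)); [lra | lra | exact Hw | | lra | | lra].
    + intros t Ht. replace (Re s2) with (Rmax (Re s2) 0) by (apply Rmax_left; lra). apply HC; lra.
    + intros s Hs. apply (improper_ext (fun a => zeta_full a s * zeta_full a s2)%C).
      * intros t Ht. rewrite !zeta_full_em by lra. reflexivity.
      * intros t Ht. apply contC_mult; apply contC_zeta_full; lra || (apply Re_not_1; lra).
      * apply Hsym; [apply Re_not_1; lra | exact Hs2 |]. apply product_integral_half; lra.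
Qed.

Lemma hurwitz_zeta_product (s1 s2 : C) : Re s1 < 1 -> Re s2 < 1 -> Re (s1 + s2) < 1 ->
  is_RInt_gen (V := C_R_NormedModule)
    (fun alpha : R => (hurwitz_zeta s1 alpha * hurwitz_zeta s2 alpha)%C)
    (at_right 0) (at_point 1)
    (2 * Rcpow (2 * PI) (s1 + s2 - 2) * CGamma (1 - s1) * CGamma (1 - s2) *
     Ccos (PI / 2 * (s1 - s2)) * riemann_zeta (2 - s1 - s2))%C.
Proof.
  intros H1 H2 H12. assert (Hs1 := Re_not_1 s1 H1). assert (Hs2 := Re_not_1 s2 H2).
  assert (Hwre : 1 < Re (2 - s1 - s2)) by (rewrite !Re_minus; rewrite re_plus in H12; simpl (Re 2); lra).
  replace (riemann_zeta (2 - s1 - s2)) with (zeta_em (2 - s1 - s2) 1).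
  2:{ unfold riemann_zeta. rewrite hurwitz_zeta_full; [|lra|].
      - symmetry. apply zeta_full_em. lra.
      - intros E. rewrite E in Hwre. simpl in Hwre. lra. }
  apply (is_RInt_gen_ext (V := C_R_NormedModule) (fun a => zeta_full a s1 * zeta_full a s2)%C).
  (* Only parameters in (0, 1) enter the integral, and there [hurwitz_zeta] coincides with
     [zeta_full]. *)
  - apply Filter_prod with (fun e => 0 < e < 1) (fun x => x = 1).
    + exists (mkposreal 1 Rlt_0_1). intros y Hy Hy0. change (Rabs (y - 0) < 1) in Hy.
      rewrite Rminus_0_r in Hy. apply Rabs_def2 in Hy. lra.
    + reflexivity.
    + intros e x He -> t Ht. simpl in Ht. rewrite Rmin_left, Rmax_right in Ht by lra.
      rewrite !hurwitz_zeta_full by (lra || assumption). reflexivity.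
  - apply improper_is_RInt_gen.
    + intros t Ht. apply contC_mult; apply contC_zeta_full; lra || assumption.
    + apply product_integral; assumption.
Qed.

Open Scope C_scope.

Theorem mainTheorem3 :
  (forall (a q : nat) (s : C),
     (1 <= a <= q)%nat -> s <> 0 -> (Re s < 1)%R ->
     hurwitz_zeta s (INR a / INR q) =
       2 * Rcpow (2 * PI * INR q) (s - 1) * CGamma (1 - s) *
       sum_n_m (G := C_AbelianMonoid)
         (fun r : nat =>
            Csin (PI * s / 2 + RtoC (2 * PI * INR r * INR a / INR q)) *
            hurwitz_zeta (1 - s) (INR r / INR q))
         1 q)
  /\
  (forall s1 s2 : C,
     (Re s1 < 1)%R -> (Re s2 < 1)%R -> (Re (s1 + s2) < 1)%R ->
     is_RInt_gen (V := C_R_NormedModule)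
       (fun alpha : R => hurwitz_zeta s1 alpha * hurwitz_zeta s2 alpha)
       (at_right 0) (at_point 1)
       (2 * Rcpow (2 * PI) (s1 + s2 - 2) * CGamma (1 - s1) * CGamma (1 - s2) *
        Ccos (PI / 2 * (s1 - s2)) * riemann_zeta (2 - s1 - s2))).
Proof.
  split.
  - exact hurwitz_zeta_rational.
  - exact hurwitz_zeta_product.
Qed.
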